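(* Let $n\ge0$ and let $D\subset F_n$ be a (closed, not necessarily open) $\sigma$-invariant normal subgroup that is contained in the Frattini subgroup $\mathrm{Fr}(F_n)$ and invariant under $\mathrm{Aut}_\sigma(F_n)$. Let $G$ be a weak Schur $\sigma$-group with $d_G=n$. If $G_D$ is finite, then $U_{D,G}$ is an open and closed subset of $\mathrm{Sch}$ of measure $$\mu_\infty(U_{D,G})\ =\ \frac{C_\infty}{C_{n-m_{D,G}}}\cdot\frac{1}{|\mathrm{Aut}_\sigma(G_D)|}.$$
   Context: Fix a prime $p>2$ and a group $\{1,\sigma\}$ of order $2$. All homomorphisms of pro-$p$-groups are continuous, all subgroups are closed, and ''generated'' means topologically generated. A $\sigma$-pro-$p$-group is a pro-$p$-group $G$ with a continuous action of $\{1,\sigma\}$, written $a\mapsto{}^\sigma a$; $\sigma$-homomorphisms and $\sigma$-isomorphisms are the $\sigma$-equivariant ones, and $\mathrm{Aut}_\sigma(G)$ is the group of $\sigma$-equivariant automorphisms. Put $G^-:=\{a\in G\mid {}^\sigma a=a^{-1}\}$. Let $d_G:=\dim_{\mathbb F_p}H^1(G,\mathbb F_p)$ be the minimal number of generators of $G$. Let $D_i(G)$ ($i\ge1$) be the Zassenhaus filtration (dimension subgroups mod $p$): $D_1(G)=G$, and $D_i(G)$ is generated by the $p$-th powers of elements of $D_{\lceil i/p\rceil}(G)$ and all $[D_j(G),D_k(G)]$ with $j+k=i$. $F_n$ is the free pro-$p$-group on $x_1,\dots,x_n$, made a $\sigma$-pro-$p$-group by ${}^\sigma x_i=x_i^{-1}$.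 For $r=(r_1,\dots,r_n)\in(F_n^-)^n$ let $N_r$ be the normal subgroup of $F_n$ generated by all conjugates of $r_1,\dots,r_n$, and $G_r:=F_n/N_r$. A weak Schur $\sigma$-group is a $\sigma$-pro-$p$-group $\sigma$-isomorphic to some $G_r$ with $n\ge0$, $r\in(F_n^-)^n$. $\mathrm{Sch}$ is the set of $\sigma$-isomorphism classes $[G]$ of weak Schur $\sigma$-groups, with the topology having as basis the sets $U_{i,G}:=\{[H]\in\mathrm{Sch}\mid H/D_i(H)\cong G/D_i(G)\ \sigma\text{-isomorphic}\}$ for all $i\ge2$ and all weak Schur $\sigma$-groups $G$. The Haar measure on $F_n^-$ is the unique Borel probability measure such that for every $\sigma$-invariant open normal subgroup $N\triangleleft F_n$ every fiber of the (surjective) map $F_n^-\to(F_n/N)^-$ has measure $1/|(F_n/N)^-|$. Let $\tilde\mu_n$ be the product measure on $(F_n^-)^n$, and $\mu_n$ its pushforward under the continuous map $(F_n^-)^n\to\mathrm{Sch}$, $r\mapsto[G_r]$. The probability measure $\mu_\infty$ on $\mathrm{Sch}$ is the limit $\mu_\infty(A)=\lim_{n\to\infty}\mu_n(A)$ for all Borel $A\subset\mathrm{Sch}$ (which exists). For $0\le k\le\infty$ put $C_k:=\prod_{i=1}^k(1-p^{-i})$. For $n$, $D$ as in the claim and a weak Schur $\sigma$-group $G$ with $d_G=n$, there is a surjective $\sigma$-homomorphism $\pi\colon F_n\twoheadrightarrow G$, unique up to composition with an element of $\mathrm{Aut}_\sigma(F_n)$. Put $G_D:=G/\pi(D)$ and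 $N:=\ker\pi$; $\pi(D)$ does not depend on $\pi$ and $N$ is unique up to $\mathrm{Aut}_\sigma(F_n)$. Let $m_{D,G}$ be the minimal number of generators of $ND/D$ as a normal subgroup of $F_n/D$; it depends only on $D$ and $G$ and satisfies $m_{D,G}\le n$. Define $U_{D,G}:=\{[H]\in\mathrm{Sch}\mid d_H=n \text{ and } H_D\cong G_D\ \sigma\text{-isomorphic}\}$. *)

(* Defs.v *)
From HB Require Import structures.
From mathcomp Require Import all_boot all_order all_algebra fingroup morphism.
From mathcomp Require Import quotient pgroup zmodp generic_quotient.
From mathcomp Require Import finmap zify.
From mathcomp Require Import all_classical all_reals all_analysis.

Set Implicit Arguments.
Unset Strict Implicit.
Unset Printing Implicit Defensive.

Import Order.TTheory GRing.Theory Num.Theory.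
Import numFieldNormedType.Exports.

Local Open Scope classical_set_scope.
Local Open Scope group_scope.
Local Open Scope quotient_scope.

Definition is_subgroup (T : groupType) (A : set T) : Prop :=
  [/\ A 1, forall x y, A x -> A y -> A (x * y) & forall x, A x -> A x^-1].

Definition is_normal (T : groupType) (A : set T) : Prop :=
  is_subgroup A /\ forall x y, A x -> A (x ^ y).

(* The last axiom says that the topology is that of an inverse limit of finite
   p-groups: the kernels of the continuous homomorphisms to finite p-groups
   form a neighbourhood basis of 1. *)
HB.mixin Record isProP (p : nat) T of monoid.Group T & Topological T := {
  mulg_continuous : continuous (fun xy : T * T => xy.1 * xy.2);
  invg_continuous : continuous (fun x : T => x^-1);
  proP_compact : compact [set: T];
  proP_hausdorff : hausdorff_space T;
  proP_basis : forall U : set T, nbhs (1 : T) U ->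
    exists (P : finGroupType) (f : T -> P),
      [/\ p.-group [set: P]%G, {morph f : x y / x * y},
          open (f @^-1` [set 1]) & f @^-1` [set 1] `<=` U]
}.

#[short(type="proPType")]
HB.structure Definition ProP (p : nat) :=
  {T of monoid.Group T & Topological T & isProP p T}.

HB.mixin Record hasSigma (p : nat) T of ProP p T := {
  sigma : T -> T;
  sigmaK : involutive sigma;
  sigmaM : {morph sigma : x y / x * y};
  sigma_continuous : continuous sigma
}.

#[short(type="sigmaProPType")]
HB.structure Definition SigmaProP (p : nat) := {T of ProP p T & hasSigma p T}.

Section Groups.
Variable T : groupType.
Implicit Type A : set T.

Lemma subgroup_bigcap (I : Type) (P : set I) (F : I -> set T) :
  (forall i, P i -> is_subgroup (F i)) -> is_subgroup (\bigcap_(i in P) F i).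
Proof.
move=> h; split=> [i /h[]//|x y hx hy i Pi|x hx i Pi].
  by have [_ m _] := h i Pi; apply: m; [apply: hx|apply: hy].
by have [_ _ v] := h i Pi; apply: v; apply: hx.
Qed.

End Groups.

Section ProPGroups.
Variables (p : nat) (G : proPType p).
Implicit Types A S : set G.

(* The closed subgroup topologically generated by [S]. *)
Definition generated S : set G :=
  smallest (fun A => closed A /\ is_subgroup A) S.

Definition normally_generated S : set G :=
  generated [set y | exists2 s, S s & exists g, y = s ^ g].

(* Minimal number of generators of [A] as a closed normal subgroup. *)
Definition min_normal_generators A (m : nat) : Prop :=
  (exists y : 'I_m -> G, A = normally_generated (range y)) /\
  forall k (y : 'I_k -> G), A = normally_generated (range y) -> (m <= k)%N.

Definition maximal_subgroup A : Prop :=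
  [/\ closed A, is_subgroup A, A != setT &
      forall B, closed B -> is_subgroup B -> A `<=` B -> B = A \/ B = setT].

Definition frattini : set G := \bigcap_(A in maximal_subgroup) A.

(* H^1(G, F_p): continuous homomorphisms to the discrete group F_p. *)
Definition H1 : set (G -> 'F_p) :=
  [set chi | (forall c, open (chi @^-1` [set c])) /\
             forall x y, chi (x * y) = (chi x + chi y)%R].

Definition dimH1 (d : nat) : Prop :=
  exists b : 'I_d -> G -> 'F_p, (forall i, H1 (b i)) /\
    forall chi, H1 chi -> exists! c : {ffun 'I_d -> 'F_p},
      forall x, chi x = (\sum_(i < d) c i * b i x)%R.

(* [zassenhaus_rec f i] unfolds the recursion for D_i at most [f] times; as all
   indices decrease (for p > 1), [f = i] is enough, see [zassenhausE]. *)
Fixpoint zassenhaus_rec (f i : nat) : set G :=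
  if f is f'.+1 then
    if (i <= 1)%N then setT else
    generated
      ([set a ^+ p | a in zassenhaus_rec f' ((i + p.-1) %/ p)] `|`
       [set c | exists j k a b, [/\ (0 < j)%N, (0 < k)%N, (j + k = i)%N,
          zassenhaus_rec f' j a & zassenhaus_rec f' k b /\ c = [~ a, b]]])
  else setT.

Definition zassenhaus (i : nat) : set G := zassenhaus_rec i i.

Lemma mulr_continuous (k : G) : continuous (fun x : G => x * k).
Proof.
move=> x W /(@mulg_continuous p G (x, k)) -[[A B] [/= nA nB] AB].
by apply: filterS nA => y Ay; apply: (AB (y, k)); split=> //; exact: nbhs_singleton.
Qed.

Lemma mull_continuous (k : G) : continuous (fun x : G => k * x).
Proof.
move=> x W /(@mulg_continuous p G (k, x)) -[[A B] [/= nA nB] AB].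
by apply: filterS nB => y By; apply: (AB (k, y)); split=> //; exact: nbhs_singleton.
Qed.

Lemma generated_closed S : closed (generated S).
Proof. by apply: closed_bigI => B [[]]. Qed.

Lemma generated_subgroup S : is_subgroup (generated S).
Proof. by apply: subgroup_bigcap => B [[_ //]]. Qed.

Lemma generatedS S S' : S `<=` S' -> generated S `<=` generated S'.
Proof.
move=> SS'; apply: smallest_sub.
  by split; [exact: generated_closed|exact: generated_subgroup].
by apply: subset_trans SS' _; exact: sub_gen_smallest.
Qed.

Lemma zassenhaus_rec_closed f i : closed (zassenhaus_rec f i).
Proof.
case: f => [|f] /=; first exact: closedT.
by case: ifP => _; [exact: closedT|exact: generated_closed].
Qed.

Lemma zassenhaus_rec_subgroup f i : is_subgroup (zassenhaus_rec f i).
Proof.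
case: f => [|f] /=; first by split.
by case: ifP => _; [split|exact: generated_subgroup].
Qed.

Lemma zassenhaus_rec_fuel f i : (1 < p)%N -> (i <= f)%N ->
  zassenhaus_rec f i = zassenhaus i.
Proof.
move=> p1; rewrite /zassenhaus.
suff h : forall m f i, (i <= f <= m)%N -> zassenhaus_rec f i = zassenhaus_rec i i.
  by move=> le; apply: (h f); rewrite le leqnn.
elim=> [|m IH] {}f {}i /andP[le fm].
  by move: fm le; rewrite leqn0 => /eqP->; rewrite leqn0 => /eqP->.
case: f le fm => [|f] le fm; first by move: le; rewrite leqn0 => /eqP->.
case: i le => [//|i] le /=; case: ifP => // i1.
have e k : (k < i.+1)%N -> zassenhaus_rec f k = zassenhaus_rec i k.
  move=> ki; rewrite (IH f k) ?(IH i k) //; lia.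
rewrite e; last first.
  by rewrite ltn_divLR; nia.
congr (generated (_ `|` _)); apply/seteqP; split=> c.
  move=> [j [k [x [y [j0 k0 jk hx [hy ->]]]]]]; exists j, k, x, y.
  by split=> //; rewrite -?e //; lia.
move=> [j [k [x [y [j0 k0 jk hx [hy ->]]]]]]; exists j, k, x, y.
by split=> //; rewrite ?e //; lia.
Qed.

Lemma zassenhaus1 : zassenhaus 1 = setT. Proof. by []. Qed.

Lemma zassenhausE i : (1 < p)%N -> (1 < i)%N ->
  zassenhaus i = generated
    ([set a ^+ p | a in zassenhaus ((i + p.-1) %/ p)] `|`
     [set c | exists j k a b, [/\ (0 < j)%N, (0 < k)%N, (j + k = i)%N,
        zassenhaus j a & zassenhaus k b /\ c = [~ a, b]]]).
Proof.
move=> p1; case: i => [//|i] i1.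
rewrite {1}/zassenhaus /= leqNgt i1 /=.
rewrite zassenhaus_rec_fuel //; last first.
  by rewrite -ltnS ltn_divLR; nia.
congr (generated (_ `|` _)); apply/seteqP; split=> c.
  move=> [j [k [x [y [j0 k0 jk hx [hy ->]]]]]]; exists j, k, x, y.
  by split=> //; rewrite -(@zassenhaus_rec_fuel i) //; lia.
move=> [j [k [x [y [j0 k0 jk hx [hy ->]]]]]]; exists j, k, x, y.
by split=> //; rewrite zassenhaus_rec_fuel //; lia.
Qed.

End ProPGroups.

Arguments frattini {p} G _.
Arguments H1 {p} G _.
Arguments dimH1 {p} G d.
Arguments zassenhaus_rec {p} G f i _.
Arguments zassenhaus {p} G i _.

Section SigmaSubsets.
Variables (p : nat) (G : sigmaProPType p).
Implicit Types A : set G.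

Definition sigma_stable A : Prop := forall x, A x -> A (sigma x).

Definition closed_sigma_normal A : Prop :=
  [/\ closed A, is_normal A & sigma_stable A].

Definition minus_part : set G := [set a | sigma a = a^-1].

(* The smallest closed normal sigma-stable subgroup containing [A]. *)
Definition sigma_kernel A : set G := smallest closed_sigma_normal A.

Lemma sigma_kernel_csn A : closed_sigma_normal (sigma_kernel A).
Proof.
split.
- by apply: closed_bigI => B [[]].
- split; first by apply: subgroup_bigcap => B [[_ [] //]].
  move=> x y hx B [csB AB]; have [_ [_ nB] _] := csB.
  by apply: nB; exact: hx.
- by move=> x hx B [csB AB]; have [_ _ ssB] := csB; apply: ssB; exact: hx.
Qed.

Lemma sigma_kernel_id A : closed_sigma_normal A -> sigma_kernel A = A.
Proof. exact: smallest_id. Qed.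

End SigmaSubsets.

Arguments minus_part {p} G _.

Section Quotient.
Variables (p : nat) (G : sigmaProPType p) (N : set G).

Let K := sigma_kernel N.

Let csnK : closed_sigma_normal K := sigma_kernel_csn N.
Let K1 : K 1.
Proof. by have [_ [[h _ _] _] _] := csnK. Qed.
Let KM x y : K x -> K y -> K (x * y).
Proof. by have [_ [[_ h _] _] _] := csnK; exact: h. Qed.
Let KV x : K x -> K x^-1.
Proof. by have [_ [[_ _ h] _] _] := csnK; exact: h. Qed.
Let KJ x y : K x -> K (x ^ y).
Proof. by have [_ [_ h] _] := csnK; exact: h. Qed.
Let KS x : K x -> K (sigma x).
Proof. by have [_ _ h] := csnK; exact: h. Qed.
Let Kc : closed K. Proof. by have [] := csnK. Qed.

Definition coset_eq : rel G := fun x y => `[< K (x^-1 * y) >].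

Let coset_eq_refl : reflexive coset_eq.
Proof. by move=> x; apply/asboolP; rewrite mulVg. Qed.
Let coset_eq_sym : symmetric coset_eq.
Proof.
move=> x y; apply/asboolP/asboolP => /KV; by rewrite invgM invgK.
Qed.
Let coset_eq_trans : transitive coset_eq.
Proof.
move=> y x z /asboolP h1 /asboolP h2; apply/asboolP.
by have := KM h1 h2; rewrite mulgA mulgK.
Qed.

Definition coset_equiv : equiv_rel G :=
  EquivRel coset_eq coset_eq_refl coset_eq_sym coset_eq_trans.

(* G/N. To make this total, an arbitrary set [N] is first replaced by
   [sigma_kernel N], which is [N] itself if [N] is a closed normal sigma-stable
   subgroup, see [sigma_kernel_id]. All the quotients taken below are by such
   subgroups, see [zassenhaus_csn], [relators_csn] and [epi_image_csn]. *)
Definition quo : Type := quotient_topology {eq_quot coset_equiv}.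
HB.instance Definition _ :=
  Topological.copy quo (quotient_topology {eq_quot coset_equiv}).
HB.instance Definition _ := Quotient.on quo.

Definition quo_pi (x : G) : quo := \pi_quo x.

Lemma quo_piP x y : quo_pi x = quo_pi y <-> K (x^-1 * y).
Proof.
split; first by move=> /eqmodP /asboolP.
by move=> h; apply/eqmodP/asboolP.
Qed.

Lemma quo_pi_surj (y : quo) : exists x, quo_pi x = y.
Proof. by exists (repr y); exact: reprK. Qed.

Lemma quo_pi_continuous : continuous quo_pi.
Proof. exact: pi_continuous. Qed.

Let reprP x : K (x^-1 * repr (quo_pi x)).
Proof. by apply/quo_piP; rewrite /quo_pi reprK. Qed.

Definition quo_mul (x y : quo) : quo := quo_pi (repr x * repr y).
Definition quo_inv (x : quo) : quo := quo_pi (repr x)^-1.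
Definition quo_sigma (x : quo) : quo := quo_pi (sigma (repr x)).

Let quo_mulE x y : quo_mul (quo_pi x) (quo_pi y) = quo_pi (x * y).
Proof.
apply/esym/quo_piP; rewrite invgM.
have -> : y^-1 * x^-1 * (repr (quo_pi x) * repr (quo_pi y)) =
   (x^-1 * repr (quo_pi x)) ^ y * (y^-1 * repr (quo_pi y)).
  by rewrite /conjg !mulgA mulgK.
by apply: KM => //; apply: KJ.
Qed.

Let quo_invE x : quo_inv (quo_pi x) = quo_pi x^-1.
Proof.
apply/quo_piP; rewrite invgK.
have -> : repr (quo_pi x) * x^-1 = (x^-1 * repr (quo_pi x)) ^ x^-1.
  by rewrite /conjg invgK !mulgA mulgV mul1g.
exact: KJ.
Qed.

Let sigma1 : sigma (1 : G) = 1.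
Proof. by apply: (mulgI (sigma 1)); rewrite -sigmaM !mulg1. Qed.
Let sigmaV (x : G) : sigma x^-1 = (sigma x)^-1.
Proof. by apply: (mulgI (sigma x)); rewrite -sigmaM !mulgV sigma1. Qed.

Let quo_sigmaE x : quo_sigma (quo_pi x) = quo_pi (sigma x).
Proof. by apply/esym/quo_piP; rewrite -sigmaV -sigmaM; apply: KS. Qed.

Let quo_mulA : associative quo_mul.
Proof.
move=> x y z; have [[a <-] [b <-] [c <-]] := And3 (quo_pi_surj x) (quo_pi_surj y) (quo_pi_surj z).
by rewrite !quo_mulE mulgA.
Qed.
Let quo_mul1 : left_id (quo_pi 1) quo_mul.
Proof. by move=> x; have [a <-] := quo_pi_surj x; rewrite quo_mulE mul1g. Qed.
Let quo_1mul : right_id (quo_pi 1) quo_mul.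
Proof. by move=> x; have [a <-] := quo_pi_surj x; rewrite quo_mulE mulg1. Qed.
Let quo_mulV : left_inverse (quo_pi 1) quo_inv quo_mul.
Proof.
by move=> x; have [a <-] := quo_pi_surj x; rewrite quo_invE quo_mulE mulVg.
Qed.
Let quo_Vmul : right_inverse (quo_pi 1) quo_inv quo_mul.
Proof.
by move=> x; have [a <-] := quo_pi_surj x; rewrite quo_invE quo_mulE mulgV.
Qed.

HB.instance Definition _ :=
  isGroup.Build quo quo_mulA quo_mul1 quo_1mul quo_mulV quo_Vmul.

Lemma quo_piM : {morph quo_pi : x y / x * y}.
Proof. by move=> x y; rewrite -quo_mulE. Qed.

Lemma quo_piV : {morph quo_pi : x / x^-1}.
Proof. by move=> x; rewrite -quo_invE. Qed.

Lemma quo_pi1 : quo_pi 1 = 1. Proof. by []. Qed.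

Let quo_openP (A : set quo) : open A = open (quo_pi @^-1` A).
Proof. by []. Qed.

Lemma quo_pi_open (A : set G) : open A -> open (quo_pi @` A).
Proof.
move=> oA; rewrite quo_openP.
have -> : quo_pi @^-1` (quo_pi @` A) =
    \bigcup_(k in K) ((fun x => x * k) @^-1` A).
  apply/seteqP; split=> [x [a Aa /esym/quo_piP h]|x [k Kk] /= Axk].
    by exists (x^-1 * a) => //=; rewrite mulKVg.
  by exists (x * k) => //; apply/esym/quo_piP; rewrite mulKg.
apply: bigcup_open => k _.
by apply: open_comp => // x _; exact: mulr_continuous.
Qed.

Let quo_nbhs (x : G) (A : set G) : nbhs x A -> nbhs (quo_pi x) (quo_pi @` A).
Proof.
rewrite nbhsE => -[B [oB Bx] BA]; rewrite nbhsE; exists (quo_pi @` B).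
  by split; [exact: quo_pi_open|exists x].
by move=> _ [b Bb <-]; exists b => //; apply: BA.
Qed.

Let quo_mul_continuous : continuous (fun xy : quo * quo => xy.1 * xy.2).
Proof.
move=> [x y]; have [[a <-] [b <-]] := conj (quo_pi_surj x) (quo_pi_surj y).
move=> W /=; rewrite -quo_piM => /quo_pi_continuous /(@mulg_continuous p G (a, b)).
move=> -[[A B] [/= nA nB] AB]; exists (quo_pi @` A, quo_pi @` B).
  by split; apply: quo_nbhs.
move=> [_ _] [/= [u Au <-] [v Bv <-]]; rewrite /= -quo_piM.
exact: (AB (u, v)).
Qed.

Let quo_inv_continuous : continuous (fun x : quo => x^-1).
Proof.
move=> x; have [a <-] := quo_pi_surj x.
move=> W /=; rewrite -quo_piV => /quo_pi_continuous /(@invg_continuous p G a) /quo_nbhs.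
apply: filterS => _ [b /= Wb <-] /=; by rewrite -quo_piV.
Qed.

Let quo_compact : compact [set: quo].
Proof.
have -> : [set: quo] = quo_pi @` setT.
  by apply/seteqP; split=> // x _; have [a <-] := quo_pi_surj x; exists a.
apply: continuous_compact; last exact: (@proP_compact p G).
by apply/continuous_subspaceT => x; exact: quo_pi_continuous.
Qed.

Let quo_hausdorff : hausdorff_space quo.
Proof.
rewrite open_hausdorff => x y; have [[a <-] [b <-]] := conj (quo_pi_surj x) (quo_pi_surj y).
move=> /eqP ab; have nK : ~ K (a^-1 * b) by move=> /quo_piP.
have : nbhs (1 : G) [set m | ~ K (a^-1 * b * m)].
  apply: (@mull_continuous p G (a^-1 * b) 1 [set y | ~ K y]); rewrite /= mulg1.
  by apply: open_nbhs_nbhs; split; [exact: closed_openC|].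
move=> /proP_basis[P [f [_ fM of1 f1]]].
pose M := f @^-1` [set 1].
have f11 : f 1 = 1 by apply: (mulgI (f 1)); rewrite -fM !mulg1.
have fV u : f u^-1 = (f u)^-1 by apply: (mulgI (f u)); rewrite -fM !mulgV.
have oM (c : G) : open ((fun x => c^-1 * x) @^-1` M).
  by apply: open_comp => // u _; exact: mull_continuous.
exists (quo_pi @` ((fun x => a^-1 * x) @^-1` M),
        quo_pi @` ((fun x => b^-1 * x) @^-1` M)) => /=.
  by split; apply/mem_set; [exists a|exists b]; rewrite //= mulVg.
split; [exact: quo_pi_open|exact: quo_pi_open|].
apply/eqP/seteqP; split=> // _ [[u /= Mu <-] [v /= Mv /esym/quo_piP Kuv]].
apply: (f1 (b^-1 * v * (a^-1 * u)^-1)); first by rewrite /= fM fV Mu Mv mulgV.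
have := KJ (a^-1 * u)^-1 Kuv; rewrite /conjg invgK.
by rewrite !mulgA (mulgK u) (mulgK b).
Qed.

Let quo_basis (U : set quo) : nbhs (1 : quo) U ->
  exists (P : finGroupType) (f : quo -> P),
    [/\ p.-group [set: P]%G, {morph f : x y / x * y},
        open (f @^-1` [set 1]) & f @^-1` [set 1] `<=` U].
Proof.
move=> nU; have : nbhs (1 : G) (quo_pi @^-1` U) by exact: quo_pi_continuous.
move=> /proP_basis[P [f [pP fM of1 f1]]].
have f11 : f 1 = 1 by apply: (mulgI (f 1)); rewrite -fM !mulg1.
have fV u : f u^-1 = (f u)^-1 by apply: (mulgI (f u)); rewrite -fM !mulgV.
pose im (A : set G) := finset (fun y => `[< exists2 x, A x & f x = y >]).
have imP A y : reflect (exists2 x, A x & f x = y) (y \in im A).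
  by rewrite inE; exact: asboolP.
have gK : group_set (im K).
  apply/group_setP; split; first by apply/imP; exists 1.
  move=> _ _ /imP[x Kx <-] /imP[y Ky <-]; apply/imP; exists (x * y) => //.
  by auto.
pose L := group gK.
have nL x : f x \in 'N(L).
  rewrite inE; apply/fintype.subsetP => _ /imsetP[_ /imP[y Ky <-] ->].
  by apply/imP; exists (y ^ x); [exact: KJ|rewrite /conjg !fM fV].
pose g (x : quo) := coset L (f (repr x)).
have gE x : g (quo_pi x) = coset L (f x).
  apply/rcoset_kercosetP => //; rewrite mem_rcoset; apply/imP.
  exists ((x^-1 * repr (quo_pi x)) ^ x^-1); first exact: KJ.
  by rewrite /conjg invgK !mulgA mulgV mul1g fM fV.
have g1P x : g (quo_pi x) = 1 <-> exists2 k, K k & f (k^-1 * x) = 1.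
  rewrite gE; split=> [/coset_idr|[k Kk]].
    move=> /(_ (nL x)) /imP[k Kk fk]; exists k => //.
    by rewrite fM fV fk mulVg.
  rewrite fM fV => /(congr1 (fun y => f k * y)).
  rewrite mulKVg mulg1 => ->; apply: coset_id; apply/imP; by exists k.
exists (coset_of L), g; split.
- apply: pgroupS (quotient_pgroup L pP).
  apply/fintype.subsetP => xb _; have [x Nx ->] := cosetP xb.
  by apply: mem_quotient; rewrite inE.
- move=> x y; have [[a <-] [b <-]] := conj (quo_pi_surj x) (quo_pi_surj y).
  by rewrite -quo_piM !gE fM morphM.
- rewrite quo_openP.
  have -> : quo_pi @^-1` (g @^-1` [set 1]) =
      \bigcup_(k in K) ((fun x => k^-1 * x) @^-1` (f @^-1` [set 1])).
    by apply/seteqP; split=> [x /g1P//|x /g1P].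
  by apply: bigcup_open => k _; apply: open_comp => // x _; exact: mull_continuous.
- move=> x; have [a <-] := quo_pi_surj x => /g1P[k Kk /f1] /=.
  suff -> : quo_pi (k^-1 * a) = quo_pi a by [].
  by apply/quo_piP; rewrite invgM invgK -mulgA; exact: KJ.
Qed.

HB.instance Definition _ := @isProP.Build p quo quo_mul_continuous
  quo_inv_continuous quo_compact quo_hausdorff quo_basis.

Let quo_sigmaK : involutive quo_sigma.
Proof.
by move=> x; have [a <-] := quo_pi_surj x; rewrite !quo_sigmaE sigmaK.
Qed.

Let quo_sigmaM : {morph quo_sigma : x y / x * y}.
Proof.
move=> x y; have [[a <-] [b <-]] := conj (quo_pi_surj x) (quo_pi_surj y).
by rewrite -quo_piM !quo_sigmaE sigmaM quo_piM.
Qed.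

Let quo_sigma_continuous : continuous quo_sigma.
Proof.
move=> x; have [a <-] := quo_pi_surj x.
move=> W /=; rewrite quo_sigmaE => /quo_pi_continuous.
move=> /(@sigma_continuous p G a) /quo_nbhs.
by apply: filterS => _ [b /= Wb <-]; rewrite /= quo_sigmaE.
Qed.

HB.instance Definition _ :=
  @hasSigma.Build p quo quo_sigma quo_sigmaK quo_sigmaM quo_sigma_continuous.

Lemma quo_pi_sigma x : quo_pi (sigma x) = sigma (quo_pi x).
Proof. by rewrite -quo_sigmaE. Qed.

End Quotient.


Section Homs.
Variable p : nat.

Definition is_hom (G H : proPType p) (f : G -> H) : Prop :=
  continuous f /\ {morph f : x y / x * y}.

Definition is_sigma_hom (G H : sigmaProPType p) (f : G -> H) : Prop :=
  is_hom f /\ {morph f : x / sigma x}.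

Definition is_sigma_iso (G H : sigmaProPType p) (f : G -> H) : Prop :=
  is_sigma_hom f /\ exists g : H -> G, [/\ is_sigma_hom g, cancel f g & cancel g f].

Definition sigma_isomorphic (G H : sigmaProPType p) : Prop :=
  exists f : G -> H, is_sigma_iso f.

Definition sigma_Aut (G : sigmaProPType p) : set (G -> G) :=
  [set f | is_sigma_iso f].

Definition is_sigma_epi (G H : sigmaProPType p) (f : G -> H) : Prop :=
  is_sigma_hom f /\ set_surj setT setT f.

Section HomTheory.
Variables (G H : proPType p) (f : G -> H).
Hypothesis hf : is_hom f.

Lemma hom1 : f 1 = 1.
Proof. by case: hf => _ fM; apply: (mulgI (f 1)); rewrite -fM !mulg1. Qed.

Lemma homV : {morph f : x / x^-1}.
Proof.
by move=> x; case: hf => _ fM; apply: (mulgI (f x)); rewrite -fM !mulgV hom1.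
Qed.

Lemma homX n : {morph f : x / x ^+ n}.
Proof.
move=> x; case: hf => _ fM; elim: n => [|n IH]; first by rewrite !expg0 hom1.
by rewrite !expgS fM IH.
Qed.

Lemma homJ : {morph f : x y / x ^ y}.
Proof. by move=> x y; case: hf => _ fM; rewrite /conjg !fM homV. Qed.

Lemma homR : {morph f : x y / [~ x, y]}.
Proof. by move=> x y; case: hf => _ fM; rewrite /commg /conjg !fM !homV. Qed.

Lemma hom_preimage_closed A : closed A -> closed (f @^-1` A).
Proof. by case: hf => /continuous_closedP fc _; exact: fc. Qed.

Lemma hom_preimage_subgroup A : is_subgroup A -> is_subgroup (f @^-1` A).
Proof.
case: hf => _ fM [A1 AM AV]; split=> [|x y Ax Ay|x Ax] /=.
- by rewrite hom1.
- by rewrite fM; exact: AM.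
- by rewrite homV; exact: AV.
Qed.

Lemma hom_image_closed A : closed A -> closed (f @` A).
Proof.
move=> cA; apply: compact_closed; first exact: (@proP_hausdorff p H).
apply: continuous_compact; last first.
  exact: (subclosed_compact cA (@proP_compact p G)).
by apply: continuous_subspaceT => x; case: hf => fc _; exact: fc.
Qed.

Lemma hom_image_subgroup A : is_subgroup A -> is_subgroup (f @` A).
Proof.
case: hf => _ fM [A1 AM AV]; split=> [|_ _ [x Ax <-] [y Ay <-]|_ [x Ax <-]].
- by exists 1 => //; exact: hom1.
- by exists (x * y); [exact: AM|exact: fM].
- by exists x^-1; [exact: AV|exact: homV].
Qed.

Lemma zassenhaus_rec_hom n i : zassenhaus_rec G n i `<=` f @^-1` (zassenhaus_rec H n i).
Proof.
elim: n i => [|n IH] i //=; case: ifP => // _.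
apply: smallest_sub.
  split; first by apply: hom_preimage_closed; exact: generated_closed.
  by apply: hom_preimage_subgroup; exact: generated_subgroup.
move=> x [[a Da <-]|[j [k [a [b [j0 k0 jk Da [Db ->]]]]]]] /=; apply: sub_gen_smallest.
  by left; exists (f a); [exact: IH|rewrite homX].
by right; exists j, k, (f a), (f b); split=> //; [exact: IH|split; [exact: IH|exact: homR]].
Qed.

Lemma zassenhaus_rec_epi n i : set_surj setT setT f ->
  zassenhaus_rec H n i `<=` f @` (zassenhaus_rec G n i).
Proof.
move=> fs; elim: n i => [|n IH] i //=; case: ifP => // _.
apply: smallest_sub.
  split; first by apply: hom_image_closed; exact: generated_closed.
  by apply: hom_image_subgroup; exact: generated_subgroup.
move=> x [[y /IH[a Da <-] <-]|].
  by exists (a ^+ p); [apply: sub_gen_smallest; left; exists a|exact: homX].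
move=> [j [k [y [z [j0 k0 jk /IH[a Da <-] [/IH[b Db <-] ->]]]]]].
exists [~ a, b]; last exact: homR.
by apply: sub_gen_smallest; right; exists j, k, a, b.
Qed.

End HomTheory.

Lemma id_hom (G : sigmaProPType p) : is_sigma_hom (@id G).
Proof. by split=> //; split=> // x. Qed.

Lemma comp_hom (G H K : sigmaProPType p) (f : G -> H) (g : H -> K) :
  is_sigma_hom f -> is_sigma_hom g -> is_sigma_hom (g \o f).
Proof.
move=> [[fc fM] fS] [[gc gM] gS]; split=> [|x] /=; last by rewrite fS gS.
split=> [x|x y] /=; last by rewrite fM gM.
by apply: continuous_comp; [exact: fc|exact: gc].
Qed.

Lemma sigma_iso_bij (G H : sigmaProPType p) (f : G -> H) :
  is_sigma_hom f -> injective f -> set_surj setT setT f -> is_sigma_iso f.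
Proof.
move=> hf fi fs; split=> //.
have /choice[g fg] : forall y, exists x, f x = y.
  by move=> y; have [x _ <-] := fs y I; exists x.
have gf : cancel f g by move=> x; apply: fi.
exists g; split=> //; have [[fc fM] fS] := hf.
split; last by move=> x; apply: fi; rewrite fS !fg.
split; last by move=> x y; apply: fi; rewrite fM !fg.
apply/continuous_closedP => A cA.
have -> : g @^-1` A = f @` A.
  apply/seteqP; split=> [y Ay|_ [x Ax <-]] /=; last by rewrite gf.
  by exists (g y).
exact: (hom_image_closed hf.1).
Qed.

Lemma sigma_iso_refl (G : sigmaProPType p) : sigma_isomorphic G G.
Proof. by exists id; split; [exact: id_hom|exists id; split=> //; exact: id_hom]. Qed.

Lemma sigma_iso_sym (G H : sigmaProPType p) :
  sigma_isomorphic G H -> sigma_isomorphic H G.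
Proof. by move=> [f [hf [g [hg fg gf]]]]; exists g; split=> //; exists f. Qed.

Lemma sigma_iso_trans (G H K : sigmaProPType p) :
  sigma_isomorphic G H -> sigma_isomorphic H K -> sigma_isomorphic G K.
Proof.
move=> [f [hf [f' [hf' ff' f'f]]]] [g [hg [g' [hg' gg' g'g]]]].
exists (g \o f); split; first exact: comp_hom.
exists (f' \o g'); split; [exact: comp_hom|exact: can_comp|exact: can_comp].
Qed.

Lemma conj_hom (G : proPType p) (y : G) : @is_hom G G (fun x => x ^ y).
Proof.
split; last by move=> a b; exact: conjMg.
move=> a; rewrite /conjg.
apply: (@continuous_comp _ _ _ (fun x : G => x * y) (fun x => y^-1 * x)).
  exact: mulr_continuous.
exact: mull_continuous.
Qed.

Lemma sigma_hom (G : sigmaProPType p) : @is_hom G G sigma.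
Proof. by split; [exact: sigma_continuous|exact: sigmaM]. Qed.

Lemma zassenhaus_csn (G : sigmaProPType p) i :
  closed_sigma_normal (zassenhaus G i).
Proof.
split.
- exact: zassenhaus_rec_closed.
- split; first exact: zassenhaus_rec_subgroup.
  by move=> x y; exact: (zassenhaus_rec_hom (conj_hom y)).
- exact/zassenhaus_rec_hom/sigma_hom.
Qed.

Lemma normally_generated_normal (G : proPType p) (S : set G) :
  is_normal (normally_generated S).
Proof.
split=> [|x y]; first exact: generated_subgroup.
suff : normally_generated S `<=` (fun x => x ^ y) @^-1` normally_generated S.
  exact.
apply: smallest_sub.
  split; first by apply: hom_preimage_closed (conj_hom y) _ _; exact: generated_closed.
  by apply: hom_preimage_subgroup (conj_hom y) _ _; exact: generated_subgroup.
move=> _ [s Ss [g ->]]; apply: sub_gen_smallest; exists s => //.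
by exists (g * y); rewrite conjgM.
Qed.

Lemma normally_generated_csn (G : sigmaProPType p) (S : set G) :
  S `<=` minus_part G -> closed_sigma_normal (normally_generated S).
Proof.
move=> Sm; split; [exact: generated_closed|exact: normally_generated_normal|].
suff h : normally_generated S `<=` sigma @^-1` normally_generated S by exact: h.
apply: smallest_sub.
  split; first by apply: hom_preimage_closed (sigma_hom G) _ _; exact: generated_closed.
  by apply: hom_preimage_subgroup (sigma_hom G) _ _; exact: generated_subgroup.
move=> _ [s Ss [g ->]] /=; rewrite (homJ (sigma_hom G)) (Sm _ Ss) conjVg.
have [_ _ NV] := generated_subgroup [set y | exists2 s, S s & exists g, y = s ^ g].
apply: NV; apply: sub_gen_smallest; exists s => //; by exists (sigma g).
Qed.

Lemma epi_image_csn (G H : sigmaProPType p) (f : G -> H) (D : set G) :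
  is_sigma_epi f -> closed_sigma_normal D -> closed_sigma_normal (f @` D).
Proof.
move=> [[hf fS] fs] [cD [sD nD] ssD]; split.
- exact: hom_image_closed.
- split; first exact: hom_image_subgroup.
  move=> _ y [x Dx <-]; have [z _ <-] := fs y I.
  by exists (x ^ z); [exact: nD|exact: homJ].
- by move=> _ [x Dx <-]; exists (sigma x); [exact: ssD|exact: fS].
Qed.

Lemma zassenhaus_le (G : sigmaProPType p) i j : (i <= j)%N ->
  zassenhaus G j `<=` zassenhaus G i.
Proof.
have index n k : zassenhaus_rec G n k.+1 `<=` zassenhaus_rec G n k.
  elim: n k => [//|n IH] k /=.
  have IHle k1 k2 : (k1 <= k2)%N -> zassenhaus_rec G n k2 `<=` zassenhaus_rec G n k1.
    move=> /subnK <-; elim: (k2 - k1)%N => [|l] //; rewrite addSn.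
    by apply: subset_trans; exact: IH.
  case: k => [|[|k]] //=; apply: generatedS => x [].
    move=> [a Da <-]; left; exists a => //; apply: IHle Da.
    by apply: leq_div2r; rewrite leq_add2r.
  move=> [u [v [a [b [u0 v0 uv Da [Db ->]]]]]]; right.
  case: u u0 uv Da => [//|[|u]] _ uv Da.
    exists 1%N, v.-1, a, b; split=> //; [lia|lia|].
    by split=> //; apply: IHle Db; lia.
  exists u.+1, v, a, b; split=> //; [lia|].
  exact: IH.
have fuel n k : zassenhaus_rec G n.+1 k `<=` zassenhaus_rec G n k.
  elim: n k => [//|n IH] k /=; case: (k <= 1)%N => //.
  apply: generatedS => x [].
    by move=> [a Da <-]; left; exists a => //; exact: IH.
  move=> [u [v [a [b [u0 v0 uv Da [Db ->]]]]]]; right; exists u, v, a, b.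
  by split=> //; [exact: IH|split=> //; exact: IH].
move=> /subnK <-; elim: (j - i)%N => [|l] //; rewrite addSn.
by apply: subset_trans; apply: subset_trans (fuel _ _); exact: index.
Qed.

Lemma quo_iso (A B : sigmaProPType p) (f : A -> B) (K : set A) (L : set B) :
  closed_sigma_normal K -> closed_sigma_normal L -> is_sigma_epi f ->
  f @^-1` L = K -> sigma_isomorphic (quo K) (quo L).
Proof.
move=> cK cL [hf fs] fLK; have [[fc fM] fS] := hf.
have eK x y : @quo_pi p A K x = quo_pi K y <-> K (x^-1 * y).
  by have := @quo_piP p A K x y; rewrite sigma_kernel_id.
have eL x y : @quo_pi p B L x = quo_pi L y <-> L (x^-1 * y).
  by have := @quo_piP p B L x y; rewrite sigma_kernel_id.
pose g (x : quo K) : quo L := quo_pi L (f (repr x)).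
have gE x : g (quo_pi K x) = quo_pi L (f x).
  apply/eL; rewrite -(homV hf.1) -fM -[L _]/((f @^-1` L) _) fLK.
  by apply/eK; rewrite /quo_pi reprK.
exists g; apply: sigma_iso_bij.
- split; first split.
  + apply/quotient_continuous.
    rewrite (_ : _ \o _ = quo_pi L \o f); last by apply/funext => x; exact: gE.
    move=> x; apply: continuous_comp; [exact: fc|exact: quo_pi_continuous].
  + move=> x y; have [[a <-] [b <-]] := conj (quo_pi_surj x) (quo_pi_surj y).
    by rewrite -quo_piM !gE fM quo_piM.
  + move=> x; have [a <-] := quo_pi_surj x.
    by rewrite -quo_pi_sigma !gE fS quo_pi_sigma.
- move=> x y; have [[a <-] [b <-]] := conj (quo_pi_surj x) (quo_pi_surj y).
  by rewrite !gE => /eL; rewrite -(homV hf.1) -fM => h; apply/eK; rewrite -fLK.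
- move=> y _; have [b <-] := quo_pi_surj y; have [a _ <-] := fs b I.
  by exists (quo_pi K a).
Qed.

Lemma quo_pi_epi (A : sigmaProPType p) (K : set A) : is_sigma_epi (@quo_pi p A K).
Proof.
split; last by move=> y _; have [x <-] := quo_pi_surj y; exists x.
split; last exact: quo_pi_sigma.
by split; [exact: quo_pi_continuous|exact: quo_piM].
Qed.

Lemma quo_zassenhaus_iso (A B : sigmaProPType p) i :
  sigma_isomorphic A B ->
  sigma_isomorphic (quo (zassenhaus A i)) (quo (zassenhaus B i)).
Proof.
move=> [f [hf [g [hg fg gf]]]]; apply: (@quo_iso _ _ f).
- exact: zassenhaus_csn.
- exact: zassenhaus_csn.
- by split=> // y _; exists (g y).
- apply/seteqP; split=> x /=; last exact: (zassenhaus_rec_hom hf.1).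
  by move=> /(zassenhaus_rec_hom hg.1) /=; rewrite fg.
Qed.

Lemma quo_zassenhaus_le (A B : sigmaProPType p) i j : (i <= j)%N ->
  sigma_isomorphic (quo (zassenhaus A j)) (quo (zassenhaus B j)) ->
  sigma_isomorphic (quo (zassenhaus A i)) (quo (zassenhaus B i)).
Proof.
move=> ij AB.
have h (C : sigmaProPType p) : sigma_isomorphic (quo (zassenhaus C i))
    (quo (zassenhaus (quo (zassenhaus C j)) i)).
  apply: (@quo_iso _ _ (quo_pi (zassenhaus C j))).
  - exact: zassenhaus_csn.
  - exact: zassenhaus_csn.
  - exact: quo_pi_epi.
  have [[hp _] ps] := @quo_pi_epi C (zassenhaus C j).
  apply/seteqP; split=> x; last exact: (zassenhaus_rec_hom hp).
  move=> /(zassenhaus_rec_epi hp ps)[y Dy /quo_piP].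
  rewrite sigma_kernel_id; last exact: zassenhaus_csn.
  move=> /(zassenhaus_le ij) Dx.
  have [_ DM _] := zassenhaus_rec_subgroup C i i.
  by rewrite -[x](mulKVg y); apply: DM.
apply: (sigma_iso_trans (h A)); apply: sigma_iso_trans (sigma_iso_sym (h B)).
exact: quo_zassenhaus_iso.
Qed.

End Homs.

Arguments sigma_Aut {p} G _.

(* The free pro-p-group on n generators, characterised by its universal property,
   with the action of sigma inverting the generators. *)
Record freeSigmaProP (p n : nat) := FreeSigmaProP {
  free_group :> sigmaProPType p;
  free_gen : 'I_n -> free_group;
  free_univ : forall (H : proPType p) (y : 'I_n -> H),
    exists! f : free_group -> H, is_hom f /\ forall i, f (free_gen i) = y i;
  free_gen_sigma : forall i, sigma (free_gen i) = (free_gen i)^-1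
}.

Definition minus_type (p : nat) (G : sigmaProPType p) : Type :=
  set_type (minus_part G).

Section MinusType.
Variables (p : nat) (G : sigmaProPType p).

Let minus1 : (1 : G) \in minus_part G.
Proof. by apply/mem_set; rewrite /minus_part /= (hom1 (sigma_hom G)) invg1. Qed.

HB.instance Definition _ :=
  Topological.copy (minus_type G) (set_type (minus_part G)).
HB.instance Definition _ :=
  isPointed.Build (minus_type G) (exist _ (1 : G) minus1 : set_type (minus_part G)).

(* G^- with its Borel sigma-algebra. *)
Definition borel_minus : Type := g_sigma_algebraType (@open (minus_type G)).
HB.instance Definition _ := Measurable.copy borel_minus
  (g_sigma_algebraType (@open (minus_type G))).

Definition minus_val (a : borel_minus) : G :=
  set_val (a : set_type (minus_part G)).

Lemma relators_csn n (r : n.-tuple borel_minus) :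
  closed_sigma_normal (normally_generated (range (fun i => minus_val (tnth r i)))).
Proof.
by apply: normally_generated_csn => _ [i _ <-]; exact: set_valP.
Qed.
End MinusType.

(* The cardinality of a finite set (and 0 for an infinite one). *)
Definition ncard (T : choiceType) (A : set T) : nat := #|` fset_set A|.

Section Sch.
Variables (p : nat) (F : forall n, freeSigmaProP p n).

(* G_r = F_n / N_r. *)
Definition presented n (r : n.-tuple (borel_minus (F n))) : sigmaProPType p :=
  quo (normally_generated (range (fun i => minus_val (tnth r i)))).

Definition weak_schur (G : sigmaProPType p) : Prop :=
  exists n (r : n.-tuple (borel_minus (F n))), sigma_isomorphic G (presented r).

(* The isomorphism class [G], cut down to the groups G_r, of which it contains
   at least one as soon as G is a weak Schur sigma-group; this makes [Sch] a
   type in the same universe as the groups themselves. *)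
Definition iso_class (G : sigmaProPType p) :
    set {n : nat & n.-tuple (borel_minus (F n))} :=
  [set nr | sigma_isomorphic (presented (projT2 nr)) G].

Definition Sch : Type :=
  {C : set {n : nat & n.-tuple (borel_minus (F n))} |
    exists2 G, weak_schur G & C = iso_class G}.

Definition Sch_class G (wG : weak_schur G) : Sch :=
  exist _ (iso_class G) (ex_intro2 _ _ G wG erefl).

Definition basic_open (i : nat) (G : sigmaProPType p) : set Sch :=
  [set c | exists H (wH : weak_schur H), c = Sch_class wH /\
     sigma_isomorphic (quo (zassenhaus H i)) (quo (zassenhaus G i))].

Definition Sch_open (A : set Sch) : Prop :=
  forall c, A c -> exists i G,
    [/\ (2 <= i)%N, weak_schur G, basic_open i G c & basic_open i G `<=` A].

Lemma Sch_classP G H (wG : weak_schur G) (wH : weak_schur H) :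
  Sch_class wG = Sch_class wH <-> sigma_isomorphic G H.
Proof.
split=> [/(congr1 (@proj1_sig _ _)) /= e|GH].
  have [n [r Gr]] := wG; apply: (sigma_iso_trans Gr).
  have : iso_class G (existT _ n r) by exact: sigma_iso_sym.
  by rewrite e.
apply: eq_exist => /=; apply/seteqP; split=> K /= KG.
  exact: sigma_iso_trans KG GH.
exact: sigma_iso_trans KG (sigma_iso_sym GH).
Qed.

Lemma Sch_class_surj (c : Sch) : exists G (wG : weak_schur G), c = Sch_class wG.
Proof.
case: c => C [G wG eC]; exists G, wG.
by apply: eq_exist.
Qed.

Lemma basic_openP i G H (wH : weak_schur H) : basic_open i G (Sch_class wH) <->
  sigma_isomorphic (quo (zassenhaus H i)) (quo (zassenhaus G i)).
Proof.
split=> [[K [wK [/Sch_classP HK]]]|HG]; last by exists H, wH.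
exact/sigma_iso_trans/quo_zassenhaus_iso.
Qed.

Let Sch_openT : Sch_open setT.
Proof.
move=> c _; have [G [wG ->]] := Sch_class_surj c; exists 2, G.
by split=> //; apply/basic_openP; exact: sigma_iso_refl.
Qed.

Let Sch_openI : setI_closed Sch_open.
Proof.
move=> A B oA oB c [/oA[i [G [i2 wG cG GA]]] /oB[j [H [j2 wH cH HB]]]].
have [K [wK ecK]] := Sch_class_surj c.
move: cG cH; rewrite ecK => /basic_openP KG /basic_openP KH.
exists (maxn i j), K; split=> //.
- by rewrite leq_max i2.
- by apply/basic_openP; exact: sigma_iso_refl.
move=> d; have [L [wL ->]] := Sch_class_surj d => /basic_openP LK; split.
  apply: GA; apply/basic_openP; apply: sigma_iso_trans KG.
  by apply: quo_zassenhaus_le LK; rewrite leq_maxl.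
apply: HB; apply/basic_openP; apply: sigma_iso_trans KH.
by apply: quo_zassenhaus_le LK; rewrite leq_maxr.
Qed.

Let Sch_open_bigcup (I : Type) (f : I -> set Sch) :
  (forall i, Sch_open (f i)) -> Sch_open (\bigcup_i f i).
Proof.
move=> fo c [i _ /fo[k [G [k2 wG cG Gf]]]]; exists k, G; split=> //.
by apply: subset_trans Gf _ => d fd; exists i.
Qed.

HB.instance Definition _ := gen_eqMixin Sch.
HB.instance Definition _ := gen_choiceMixin Sch.
HB.instance Definition _ :=
  isOpenTopological.Build Sch Sch_openT Sch_openI Sch_open_bigcup.

Lemma weak_schur_presented n (r : n.-tuple (borel_minus (F n))) :
  weak_schur (presented r).
Proof. by exists n, r; exact: sigma_iso_refl. Qed.

Definition Sch_presented n (r : n.-tuple (borel_minus (F n))) : Sch :=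
  Sch_class (weak_schur_presented r).

(* pi(D), with pi ranging over all surjections F_n ->> G: for the subgroups [D]
   considered here these all give the same subgroup. *)
Definition image_of n (D : set (F n)) (G : sigmaProPType p) : set G :=
  [set g | exists2 pi : F n -> G, is_sigma_epi pi & (pi @` D) g].

Definition quo_by n (D : set (F n)) (G : sigmaProPType p) : sigmaProPType p :=
  quo (@image_of n D G).

(* [m] is the minimal number of generators of ND/D, where N is the kernel of a
   surjection F_n ->> G. *)
Definition is_mDG n (D : set (F n)) (G : sigmaProPType p) (m : nat) : Prop :=
  exists2 pi : F n -> G, is_sigma_epi pi &
    min_normal_generators (quo_pi D @` (pi @^-1` [set 1])) m.

Definition U_DG n (D : set (F n)) (G : sigmaProPType p) : set Sch :=
  [set c | exists H (wH : weak_schur H), [/\ c = Sch_class wH, dimH1 H n &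
     sigma_isomorphic (quo_by D H) (quo_by D G)]].

End Sch.

Section Measures.
Variables (R : realType) (p : nat).
Local Open Scope ring_scope.

(* Here N, being an open subgroup, is also closed. *)
Definition is_haar (G : sigmaProPType p) (mu : probability (borel_minus G) R) :
  Prop := forall N : set G, open N -> is_normal N -> sigma_stable N ->
    forall b : quo N, minus_part (quo N) b ->
      mu [set a | quo_pi N (minus_val a) = b] =
      ((ncard (minus_part (quo N)))%:R^-1)%:E.

(* [nu] is the n-fold product measure of [mu]. *)
Definition is_power_measure d (T : measurableType d) (mu : probability T R)
    n (nu : probability (n.-tuple T) R) : Prop :=
  forall A : 'I_n -> set T, (forall i, measurable (A i)) ->
    nu [set t | forall i, A i (tnth t i)] = (\prod_(i < n) mu (A i))%E.

(* The pushforward of the measure [nu n] on (F_n^-)^n under r |-> [G_r]. *)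
Definition mu_n (F : forall n, freeSigmaProP p n)
    (nu : forall n, probability (n.-tuple (borel_minus (F n))) R) (n : nat)
    (A : set (Sch F)) : \bar R :=
  nu n (@Sch_presented p F n @^-1` A).

Definition mu_infty (F : forall n, freeSigmaProP p n)
    (nu : forall n, probability (n.-tuple (borel_minus (F n))) R)
    (A : set (Sch F)) : \bar R :=
  lim (mu_n nu n A @[n --> \oo]).

Definition C_part (k : nat) : R := \prod_(1 <= i < k.+1) (1 - (p%:R)^-1 ^+ i).

Definition C_infty : R := lim (C_part @ \oo).

End Measures.

(* Main.v *)
(* Put Q := G_D, a finite sigma-p-group, and let M be the kernel of F_n ->> Q, so
   that M = ND. A tuple r in (F_k^-)^k satisfies [G_r] in U_{D,G} if and only if
   some sigma-epimorphism phi : F_k ->> Q identifies G_r modulo the image of D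
   with Q, and Aut_sigma(Q) acts simply transitively on the phi with the same
   kernel. After a change of basis of F_k the map phi is the composite of
   F_k ->> F_n ->> Q with the projection killing x_{n+1}, ..., x_k; then r has
   this property if and only if all r_i lie in L := ker phi and span the F_p-vector
   space V := L / D L^p[L, F_k] (a Frattini argument, with D embedded in F_k
   by x_i |-> x_i). It has dimension m + k - n, and sigma acts on it by -1. The image of a Haar random element of
   F_k^- is uniformly distributed on the minus part of F_k / D L^p[L, F_k], hence
   each phi contributes |Q^-|^-k C_k / C_{n-m}, while the number of phi is
   |Q^-|^k C_k / C_{k-n}. Dividing by |Aut_sigma(Q)| and letting k tend to
   infinity gives the formula. For the topology: D_i(F_n) lies in D M^p[M, F_n]
   for large i, so that H_D is determined by H / D_i(H). *)
Require Import Defs.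
From HB Require Import structures.
From mathcomp Require Import all_boot all_order all_algebra.
From mathcomp Require Import all_fingroup all_solvable mxabelem.
From mathcomp Require Import finmap zify ring.
From mathcomp Require Import all_classical all_reals all_analysis.

Set Implicit Arguments.
Unset Strict Implicit.
Unset Printing Implicit Defensive.

Import Order.TTheory GRing.Theory Num.Theory.
Import numFieldNormedType.Exports.

Local Open Scope classical_set_scope.
Local Open Scope ring_scope.

(** * Invariant characters of finite p-groups and pro-p groups *)

(** The Frattini arguments are run dually: the quotient V is never built, only its linear forms are
    used, as locally constant functions that are additive on L and invariant under conjugation. In a
    finite p-group a smaller normal subgroup is always detected by such a form, and this passes to
    closed normal subgroups. Generation, spanning and minimality thus become statements about forms
    vanishing on given elements. It takes place in F_n: if the relators span V, the presentation F_k
    ->> H is onto already on F_n and factors through a retraction of F_k onto F_n, which carries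
    enough relations into F_n to fill M / D M^p[M, F_n]. The change of basis and the independence of
    pi(D) from pi both rest on the injectivity of surjective endomorphisms of F_k. That G has as
    many relators as generators yields m <= n. *)

Section FiniteCharacters.
Local Open Scope group_scope.

(** Let T be generated by Phi(A), [A, G] and B. Then A / T is elementary abelian with trivial
    G-action, and it is nontrivial because elements of Phi(A) are non-generators. A coordinate of
    this F_p-space that is nonzero at some a outside T serves as l. *)
Lemma invariant_character (gT : finGroupType) (p : nat) (G A B : {group gT}) :
  prime p -> p.-group G -> normal A G -> B \subset A ->
  ~~ (A \subset [~: A, G] <*> B) ->
  exists l : gT -> 'F_p, [/\ {in A &, forall x y, l (x * y) = (l x + l y)%R},
    {in A & G, forall x g, l (x ^ g) = l x}, {in B, forall x, l x = 0%R} &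
    exists2 a, a \in A & l a != 0%R].
Proof.
move=> pp pG /andP[AG nAG] BA nA.
have pA := pgroupS AG pG.
pose T := ('Phi(A) <*> ([~: A, G] <*> B))%G.
have RT : [~: A, G] \subset T.
  by apply: fintype.subset_trans (joing_subr _ _); exact: joing_subl.
have BT : B \subset T.
  by apply: fintype.subset_trans (joing_subr _ _); exact: joing_subr.
have TA : T \subset A.
  by rewrite !join_subG Phi_sub BA andbT /= commg_subl.
have neTA : ~~ (A \subset T).
  apply: contra nA => AT.
  have := @Phi_nongen _ A ([~: A, G] <*> B).
  rewrite (genGid ([~: A, G] <*> B)%G) => -> //.
  by apply/eqP; rewrite finset.eqEsubset TA.
have dT : [~: A, A] \subset T by apply: fintype.subset_trans RT; exact: commgS.
have nTA : normal T A by exact: sub_der1_normal.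
have abE : p.-abelem (A / T).
  apply/abelemP => //; split; first exact: sub_der1_abelian.
  move=> _ /morphimP[x Nx Ax ->]; rewrite -morphX //; apply: coset_id.
  apply: (fintype.subsetP (joing_subl _ _)).
  rewrite (Phi_joing pA); apply: (fintype.subsetP (joing_subr _ _)).
  by rewrite (MhoE 1 pA) expn1; apply: mem_gen; exact: imset_f.
have ntE : A / T != 1.
  apply: contra neTA => /eqP E1.
  by rewrite -quotient_sub1 ?E1 // normal_norm.
have NA x : x \in A -> x \in 'N(T) by apply: fintype.subsetP; exact: normal_norm.
have EA x : x \in A -> coset T x \in A / T.
  by move=> Ax; apply: mem_quotient.
have [a Aa nTa] : exists2 a, a \in A & a \notin T by apply/fintype.subsetPn.
pose v x := abelem_rV abE ntE (coset T x).
have [i vi] : exists i, v a 0%R i != 0%R.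
  apply: contrapT => /forallNP v0; move: nTa; apply/negP/negPn.
  have va : v a = 0%R.
    by apply/rowP => i; rewrite mxE; apply/eqP/negPn/negP; exact: v0.
  apply: coset_idr; first exact: NA.
  have ia := @abelem_rV_inj _ _ _ abE ntE _ _ (EA _ Aa) (group1 _).
  apply: ia.
  by rewrite abelem_rV_1; exact: va.
exists (fun x => v x 0%R i); split=> [x y Ax Ay|x g Ax Gg|x Bx|].
- rewrite /v morphM ?NA // abelem_rV_M ?EA // mxE; done.
- congr (_ 0%R i); rewrite /v; congr (abelem_rV _ _ _).
  have Rxg : [~ x, g] \in T by apply: (fintype.subsetP RT); exact: mem_commg.
  have gT1 : coset T [~ x, g] = 1 by exact: coset_id.
  have RA : [~ x, g] \in A by exact: (fintype.subsetP TA).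
  by rewrite (conjg_mulR x g) (morphM (coset_morphism T)) ?NA //= gT1 mulg1.
- by rewrite /v coset_id ?abelem_rV_1 ?mxE //; exact: (fintype.subsetP BT).
- by exists a.
Qed.

(** For normal B the group G / B is nilpotent, so [A/B, G/B] is proper in A/B as soon as A/B is
    nontrivial; hence A is not contained in [A, G] B. *)
Lemma normal_character (gT : finGroupType) (p : nat) (G A B : {group gT}) :
  prime p -> p.-group G -> normal A G -> normal B G -> B \subset A -> ~~ (A \subset B) ->
  exists l : gT -> 'F_p, [/\ {in A &, forall x y, l (x * y) = (l x + l y)%R},
    {in A & G, forall x g, l (x ^ g) = l x}, {in B, forall x, l x = 0%R} &
    exists2 a, a \in A & l a != 0%R].
Proof.
move=> pp pG nA nB BA AB; apply: invariant_character => //.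
apply: contra AB => AR.
have nBG := normal_norm nB; have AG := normal_sub nA.
have nBA := fintype.subset_trans AG nBG.
have nBR : [~: A, G] \subset 'N(B).
  by apply: fintype.subset_trans nBA; rewrite commg_subl; exact: normal_norm.
have ARB : A / B \subset [~: A / B, G / B].
  rewrite -quotientR //; apply: fintype.subset_trans (quotientS B AR) _.
  by rewrite quotientYidr.
have [AB1|n1] := eqVneq (A / B) 1; first by rewrite -quotient_sub1 ?AB1.
have nAB : G / B \subset (G / B) :&: 'N(A / B).
  by rewrite finset.subsetI fintype.subxx quotient_norms // normal_norm.
have := nil_comm_properl (quotient_nil B (pgroup_nil pG)) (quotientS B AG) n1 nAB.
by rewrite properE ARB andbF.
Qed.

End FiniteCharacters.

Section LocallyConstant.

(** The codomain is a bare type, so that finite groups and row vectors can serve as targets without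
    being given the discrete topology. *)
Definition locally_constant (T : topologicalType) (Y : Type) (f : T -> Y) :=
  forall x, \forall y \near x, f y = f x.

Variable T : topologicalType.

Lemma locally_constant_open (Y : Type) (f : T -> Y) (S : set Y) :
  locally_constant f -> open (f @^-1` S).
Proof.
move=> lf; rewrite openE => x Sx; have := lf x.
by apply: filterS => y /= ->.
Qed.

Lemma locally_constant_closed (Y : Type) (f : T -> Y) (S : set Y) :
  locally_constant f -> closed (f @^-1` S).
Proof. by move=> lf; rewrite -openC; exact: (@locally_constant_open _ f (~` S)). Qed.

Lemma fibers_locally_constant (Y : Type) (f : T -> Y) :
  (forall y, open (f @^-1` [set y])) -> locally_constant f.
Proof. by move=> h x; apply: (@open_nbhs_nbhs _ x (f @^-1` [set f x])); split. Qed.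

Lemma locally_constant_comp (Y Z : Type) (f : T -> Y) (g : Y -> Z) :
  locally_constant f -> locally_constant (g \o f).
Proof. by move=> lf x; apply: filterS (lf x) => y /= ->. Qed.

Lemma locally_constant_comp2 (Y Z W : Type) (f : T -> Y) (g : T -> Z)
    (h : Y -> Z -> W) :
  locally_constant f -> locally_constant g ->
  locally_constant (fun x => h (f x) (g x)).
Proof. by move=> lf lg x; apply: filterS2 (lf x) (lg x) => y -> ->. Qed.

Lemma locally_constant_continuous (S : topologicalType) (Y : Type) (f : T -> Y)
    (h : S -> T) :
  locally_constant f -> continuous h -> locally_constant (f \o h).
Proof. by move=> lf ch x; exact: ch (lf (h x)). Qed.

Lemma locally_constant_cst (Y : Type) (y : Y) : locally_constant (fun _ : T => y).
Proof. by move=> x; exact: nearW. Qed.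

Lemma locally_constant_big (I : finType) (Y : Type) (f : I -> T -> Y) (x : T) :
  (forall i, locally_constant (f i)) -> \forall y \near x, forall i, f i y = f i x.
Proof. by move=> lf; apply: filter_forall => i; exact: lf. Qed.

Lemma locally_constant_continuousT (S : topologicalType) (f : T -> S) :
  locally_constant f -> continuous f.
Proof.
move=> lf x W /nbhs_singleton Wx; have := lf x.
by apply: filterS => y /= ->.
Qed.

End LocallyConstant.

Section FiniteQuotients.
Local Open Scope group_scope.

Lemma morph_group1 (G H : groupType) (f : G -> H) :
  {morph f : x y / x * y} -> f 1 = 1.
Proof. by move=> fM; apply: (mulgI (f 1)); rewrite -fM !mulg1. Qed.

Lemma morph_groupV (G H : groupType) (f : G -> H) :
  {morph f : x y / x * y} -> {morph f : x / x^-1}.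
Proof.
by move=> fM x; apply: (mulgI (f x)); rewrite -fM !mulgV (morph_group1 fM).
Qed.

Lemma morph_groupJ (G H : groupType) (f : G -> H) :
  {morph f : x y / x * y} -> {morph f : x y / x ^ y}.
Proof. by move=> fM x y; rewrite /conjg !fM morph_groupV. Qed.

Lemma subgroupX (G : groupType) (A : set G) x k :
  is_subgroup A -> A x -> A (x ^+ k).
Proof.
move=> [A1 AM _] Ax; elim: k => [|k IH]; first by rewrite expg0.
by rewrite expgS; exact: AM.
Qed.

Section Image.
Variables (G : groupType) (P : finGroupType) (f : G -> P).
Hypothesis fM : {morph f : x y / x * y}.

Definition group_image (A : set G) : {set P} :=
  finset (fun y => `[< (f @` A) y >]).

Lemma group_imageP A y : reflect ((f @` A) y) (y \in group_image A).
Proof. by rewrite inE; exact: asboolP. Qed.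

Lemma group_image_group_set A : is_subgroup A -> group_set (group_image A).
Proof.
move=> [A1 AM AV]; apply/group_setP; split.
  by apply/group_imageP; exists 1 => //; exact: morph_group1.
move=> _ _ /group_imageP[x Ax <-] /group_imageP[y Ay <-].
by apply/group_imageP; exists (x * y); [exact: AM|exact: fM].
Qed.

Definition image_group A (sA : is_subgroup A) : {group P} :=
  Group (group_image_group_set sA).

Lemma image_groupP A (sA : is_subgroup A) y :
  reflect ((f @` A) y) (y \in image_group sA).
Proof. exact: group_imageP. Qed.

Lemma image_groupS A B (sA : is_subgroup A) (sB : is_subgroup B) :
  A `<=` B -> image_group sA \subset image_group sB.
Proof.
move=> AB; apply/fintype.subsetP => _ /image_groupP[x Ax <-].
by apply/image_groupP; exists x => //; exact: AB.
Qed.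

Lemma subgroupT : is_subgroup [set: G].
Proof. by split. Qed.

Lemma image_group_normal A (nA : is_normal A) :
  normal (image_group nA.1) (image_group subgroupT).
Proof.
apply/andP; split; first exact: image_groupS.
apply/fintype.subsetP => _ /image_groupP[g _ <-].
rewrite inE; apply/fintype.subsetP => _ /imsetP[_ /image_groupP[x Ax <-] ->].
by apply/image_groupP; exists (x ^ g); [exact: nA.2|exact: morph_groupJ].
Qed.

End Image.

Variables (p : nat) (X : proPType p).
Implicit Types A B : set X.

Lemma fibers_finite_quotient (P : finGroupType) (f : X -> P) :
  {morph f : x y / x * y} -> open (f @^-1` [set 1]) -> locally_constant f.
Proof.
move=> fM o1 x.
have : nbhs (x^-1 * x) (f @^-1` [set 1]).
  by rewrite mulVg; apply: open_nbhs_nbhs; split => //=; exact: morph_group1 fM.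
move=> /(@mull_continuous p X x^-1 x) nx.
have {nx} : nbhs x [set y | f (x^-1 * y) = 1] by exact: nx.
apply: filterS => y /=.
by rewrite fM (morph_groupV fM) => /(congr1 (fun z => f x * z)); rewrite mulKVg mulg1.
Qed.

(** The complement of B contains a coset a ker f with f as in [proP_basis], and f a = f b would put
    b into that coset. *)
Lemma separate_closed B a : closed B -> ~ B a ->
  exists (P : finGroupType) (f : X -> P),
    [/\ p.-group [set: P]%G, {morph f : x y / x * y}, locally_constant f &
        ~ (f @` B) (f a)].
Proof.
move=> cB nBa; have : nbhs (1 : X) [set m | ~ B (a * m)].
  apply: (@mull_continuous p X a 1 [set y | ~ B y]); rewrite /= mulg1.
  by apply: open_nbhs_nbhs; split; [exact: closed_openC|].
move=> /proP_basis[P [f [pP fM of1 f1]]]; exists P, f; split=> //.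
  exact: fibers_finite_quotient.
move=> [b Bb fba]; apply: (f1 (a^-1 * b)); last by rewrite mulKVg.
by rewrite /= fM fba (morph_groupV fM) mulVg.
Qed.

(** For a finite F_p-space V these represent the continuous homomorphisms from A / A^p[A, X] to V.
    The function lives on all of X, with arbitrary values outside A, which avoids turning the
    subgroup A into a pro-p-group of its own. *)
Definition invariant_hom A (V : zmodType) (l : X -> V) := [/\ locally_constant l,
  forall x y, A x -> A y -> l (x * y) = (l x + l y)%R &
  forall x g, A x -> l (x ^ g) = l x].

Hypothesis p_prime : prime p.

(** A finite p-quotient of X separates A from B, and there [normal_character] applies. The typical
    use is contrapositive: B fills A once every invariant homomorphism killing B kills A. *)
Lemma exists_invariant_hom A B : is_normal A -> closed B -> is_normal B ->
  B `<=` A -> ~ A `<=` B ->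
  exists l : X -> 'F_p, [/\ invariant_hom A l, forall x, B x -> l x = 0%R &
    exists2 a, A a & l a != 0%R].
Proof.
move=> nA cB nB BA /existsNP[a /not_implyP[Aa nBa]].
have [P [f [pP fM lf fa]]] := separate_closed cB nBa.
have pG : p.-group (image_group fM (subgroupT X)) by exact: pgroupS (finset.subsetT _) pP.
have [||l [lM lJ lB [_ /image_groupP[b Ab <-] lb]]] := normal_character p_prime pG
    (image_group_normal fM nA) (image_group_normal fM nB).
- exact: image_groupS.
- apply/fintype.subsetPn; exists (f a); first by apply/image_groupP; exists a.
  by apply/image_groupP.
have iA x : A x -> f x \in image_group fM nA.1 by move=> Ax; apply/image_groupP; exists x.
exists (l \o f); split; last by exists b.
  split; first exact: locally_constant_comp.
    by move=> x y Ax Ay; rewrite /= fM lM ?iA.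
  move=> x g Ax; rewrite /= (morph_groupJ fM) lJ ?iA //.
  by apply/image_groupP; exists g.
by move=> x Bx /=; apply: lB; apply/image_groupP; exists x.
Qed.

(** In the finite image G of X, with H the image of B, the equality G = [G, G] H would give G =
    Phi(G) H and so G = H. Hence [invariant_character] applies with A = G. *)
Lemma exists_H1 B : closed B -> is_subgroup B -> B <> setT ->
  exists2 chi, H1 X chi & (forall x, B x -> chi x = 0%R) /\
    exists a, chi a <> 0%R.
Proof.
move=> cB sB BT; have [a nBa] : exists a, ~ B a.
  by apply: contrapT => /forallNP h; apply: BT; apply/seteqP; split=> // x _; exact: contrapT (h x).
have [P [f [pP fM lf fa]]] := separate_closed cB nBa.
pose G := image_group fM (subgroupT X); pose H := image_group fM sB.
have pG : p.-group G by exact: pgroupS (finset.subsetT _) pP.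
have HG : H \subset G by exact: image_groupS.
have faG : f a \in G by apply/image_groupP; exists a.
have nHG : ~~ (G \subset [~: G, G] <*> H).
  apply/negP => GR; have : ~~ (G \subset H).
    apply/fintype.subsetPn; exists (f a) => //.
    by apply/image_groupP.
  apply/negP/negPn; have := @Phi_nongen _ G H; rewrite (genGid H) => -> //.
  apply/eqP; rewrite finset.eqEsubset join_subG Phi_sub HG /=.
  apply: fintype.subset_trans GR _; rewrite join_subG joing_subr andbT.
  apply: fintype.subset_trans (joing_subl _ _).
  by rewrite (Phi_joing pG) joing_subl.
have [l [lM lJ lB [_ /image_groupP[b _ <-] lb]]] :=
  invariant_character p_prime pG (normal_refl G) HG nHG.
have iG x : f x \in G by apply/image_groupP; exists x.
exists (l \o f); last split.
- split; last by move=> x y; rewrite /= fM lM ?iG.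
  by move=> c; apply: locally_constant_open; exact: locally_constant_comp.
- by move=> x Bx /=; apply: lB; apply/image_groupP; exists x.
- by exists b; apply/eqP.
Qed.

Lemma H1_locally_constant (chi : X -> 'F_p) : H1 X chi -> locally_constant chi.
Proof. by move=> [h _]; exact: fibers_locally_constant. Qed.

End FiniteQuotients.

Section InvariantHoms.
Variables (p : nat) (X : proPType p).
Implicit Types A B S : set X.
Local Open Scope group_scope.

Lemma normal_setT : is_normal [set: X].
Proof. by split. Qed.

Lemma is_hom_comp (Y Z : proPType p) (f : X -> Y) (g : Y -> Z) :
  is_hom f -> is_hom g -> is_hom (g \o f).
Proof.
move=> [fc fM] [gc gM]; split=> [x|x y] /=; last by rewrite fM gM.
by apply: continuous_comp; [exact: fc|exact: gc].
Qed.

Lemma normal_preimage (Y : proPType p) (f : X -> Y) (A : set Y) :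
  is_hom f -> is_normal A -> is_normal (f @^-1` A).
Proof.
move=> hf [sA nA]; split; first exact: hom_preimage_subgroup.
by move=> x y Ax; rewrite /preimage /= (homJ hf); exact: nA.
Qed.

Lemma normal_kernel (Y : proPType p) (f : X -> Y) :
  is_hom f -> is_normal (f @^-1` [set 1]).
Proof.
move=> hf; apply: normal_preimage => //; split; last first.
  by move=> x y /= ->; rewrite conj1g.
by split=> //= [x y -> ->|x ->]; rewrite ?mulg1 ?invg1.
Qed.

Lemma closed_set1 (x : X) : closed [set x].
Proof. exact/accessible_closed_set1/hausdorff_accessible/proP_hausdorff. Qed.

Lemma closed_kernel (Y : proPType p) (f : Y -> X) :
  is_hom f -> closed (f @^-1` [set 1]).
Proof. by move=> hf; apply: hom_preimage_closed => //; exact: closed_set1. Qed.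

Lemma normally_generated_sub S B : closed B -> is_normal B -> S `<=` B ->
  normally_generated S `<=` B.
Proof.
move=> cB [sB nB] SB; apply: smallest_sub => // _ [s Ss [g ->]].
by apply: nB; exact: SB.
Qed.

Lemma sub_normally_generated S : S `<=` normally_generated S.
Proof.
move=> s Ss; apply: sub_gen_smallest; exists s => //.
by exists 1; rewrite conjg1.
Qed.

Section Values.
Variables (V : zmodType) (A : set X) (l : X -> V).
Hypotheses (nA : is_normal A) (il : invariant_hom A l).

Lemma invariant_hom1 : l 1 = 0%R.
Proof.
have [[A1 _ _] _] := nA; have [_ lM _] := il.
by apply: (addIr (l 1)); rewrite -lM // mulg1 add0r.
Qed.

Lemma invariant_homV x : A x -> l x^-1 = (- l x)%R.
Proof.
have [[_ _ AV] _] := nA; have [_ lM _] := il => Ax.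
by apply: (addIr (l x)); rewrite addNr -(lM _ _ (AV _ Ax) Ax) mulVg invariant_hom1.
Qed.

Lemma invariant_homX x k : A x -> l (x ^+ k) = (l x *+ k)%R.
Proof.
have [[A1 AM _] _] := nA; have [_ lM _] := il => Ax.
suff [] : A (x ^+ k) /\ l (x ^+ k) = (l x *+ k)%R by [].
elim: k => [|k [Axk IH]]; first by rewrite expg0 mulr0n invariant_hom1.
by rewrite expgS mulrS lM // IH; split=> //; exact: AM.
Qed.

Lemma normal_invariant_kernel : is_normal [set x | A x /\ l x = 0%R].
Proof.
have [[A1 AM AV] AJ] := nA; have [_ lM lJ] := il.
split; first split=> [|x y [Ax x0] [Ay y0]|x [Ax x0]].
- by split=> //; exact: invariant_hom1.
- by split; [exact: AM|rewrite lM // x0 y0 addr0].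
- by split; [exact: AV|rewrite invariant_homV // x0 oppr0].
by move=> x y [Ax x0]; split; [exact: AJ|rewrite lJ].
Qed.

Lemma closed_invariant_kernel : closed A -> closed [set x | A x /\ l x = 0%R].
Proof.
have [lc _ _] := il => cA.
by apply: (closedI cA); exact: (@locally_constant_closed _ _ l [set 0%R] lc).
Qed.

(** The zero set of l in A is a closed normal subgroup, so identities between invariant
    homomorphisms need only be checked on normal generators. *)
Lemma invariant_hom_normally_generated S :
  closed A -> S `<=` A -> (forall s, S s -> l s = 0%R) ->
  forall x, normally_generated S x -> l x = 0%R.
Proof.
move=> cA SA S0 x Sx.
suff [] : [set x | A x /\ l x = 0%R] x by [].
apply: (normally_generated_sub _ _ _ Sx).
- exact: closed_invariant_kernel.
- exact: normal_invariant_kernel.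
- by move=> s Ss; split; [exact: SA|exact: S0].
Qed.

Lemma invariant_hom_preimage (Y : proPType p) (f : Y -> X) :
  is_hom f -> invariant_hom (f @^-1` A) (l \o f).
Proof.
have [lc lM lJ] := il => hf; split.
- by apply: locally_constant_continuous lc _; exact: hf.1.
- by move=> x y Ax Ay /=; rewrite hf.2 lM.
- by move=> x y Ax /=; rewrite (homJ hf) lJ.
Qed.

Lemma invariant_hom_sub B : B `<=` A -> invariant_hom B l.
Proof.
have [lc lM lJ] := il => BA; split=> // [x y Bx By|x y Bx].
  by rewrite (lM _ _ (BA _ Bx) (BA _ By)).
by rewrite (lJ _ _ (BA _ Bx)).
Qed.

End Values.

Lemma invariant_homB (V : zmodType) A (l l' : X -> V) :
  invariant_hom A l -> invariant_hom A l' ->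
  invariant_hom A (fun x => l x - l' x)%R.
Proof.
move=> [lc lM lJ] [lc' lM' lJ']; split.
- exact: (locally_constant_comp2 (fun a b => a - b)%R lc lc').
- by move=> x y Ax Ay; rewrite lM // lM' // opprD addrACA.
- by move=> x y Ax; rewrite lJ // lJ'.
Qed.

Lemma invariant_homD (V : zmodType) A (l l' : X -> V) :
  invariant_hom A l -> invariant_hom A l' ->
  invariant_hom A (fun x => l x + l' x)%R.
Proof.
move=> [lc lM lJ] [lc' lM' lJ']; split.
- exact: (locally_constant_comp2 +%R lc lc').
- by move=> x y Ax Ay; rewrite lM // lM' // addrACA.
- by move=> x y Ax; rewrite lJ // lJ'.
Qed.

Lemma H1_invariant_hom (chi : X -> 'F_p) : H1 X chi <-> invariant_hom setT chi.
Proof.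
split=> [h|[lc lM _]].
  have lc := H1_locally_constant h; have [_ hM] := h; split=> //.
  move=> x y _; rewrite /conjg !hM addrCA -hM mulVg.
  by have -> : chi 1 = 0%R; [apply: (addIr (chi 1)); rewrite -hM mulg1 add0r|rewrite addr0].
split; last by move=> x y; exact: lM.
by move=> c; exact: (@locally_constant_open _ _ chi [set c] lc).
Qed.

End InvariantHoms.

(** * First cohomology, surjectivity and factorization *)

Section Surjectivity.
Variable p : nat.
Hypothesis p_prime : prime p.
Local Open Scope group_scope.

(** A proper closed image would be killed by a nonzero character. *)
Lemma hom_surj_H1 (X Y : proPType p) (f : X -> Y) : is_hom f ->
  (forall chi, H1 Y chi -> (forall x, chi (f x) = 0%R) -> forall y, chi y = 0%R) ->
  set_surj setT setT f.
Proof.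
move=> hf h; have [//|rT] : range f = setT \/ range f <> setT by exact: EM.
  by move=> rT y _; rewrite -/(range f y) rT.
have [chi Hchi [chi0 [a ca]]] := exists_H1 p_prime
  (hom_image_closed hf closedT) (hom_image_subgroup hf (subgroupT X)) rT.
by case: ca; apply: h => // x; apply: chi0; exists x.
Qed.

(** By compactness f is a closed map, and the complement of a fibre of h is the image under f of a
    closed set. *)
Lemma locally_constant_epi (X Y : proPType p) (f : X -> Y) (S : Type) (h : Y -> S) :
  is_hom f -> set_surj setT setT f -> locally_constant (h \o f) ->
  locally_constant h.
Proof.
move=> hf fs lc; apply: fibers_locally_constant => c; rewrite -closedC.
have -> : ~` (h @^-1` [set c]) = f @` ((h \o f) @^-1` (~` [set c])).
  apply/seteqP; split=> [y hy|_ [x hx <-]]; last exact: hx.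
  by have [x _ fx] := fs y I; exists x => //=; rewrite fx.
by apply: hom_image_closed => //; exact: locally_constant_closed.
Qed.

Lemma factor_hom (X Y Z : proPType p) (f : X -> Y) (g : X -> Z) :
  is_hom f -> set_surj setT setT f -> is_hom g ->
  (forall x, f x = 1 -> g x = 1) ->
  exists h : Y -> Z, is_hom h /\ forall x, h (f x) = g x.
Proof.
move=> hf fs hg fg.
have /choice[s fsK] : forall y, exists x, f x = y.
  by move=> y; have [x _ <-] := fs y I; exists x.
have gE x y : f x = f y -> g x = g y.
  move=> fxy; have /fg : f (x^-1 * y) = 1 by rewrite hf.2 (homV hf) fxy mulVg.
  by rewrite hg.2 (homV hg) => /(congr1 (fun z => g x * z)); rewrite mulKVg mulg1.
exists (g \o s); split; last by move=> x /=; apply: gE.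
split; last by move=> x y /=; rewrite -hg.2; apply: gE; rewrite hf.2 !fsK.
apply/continuous_closedP => A cA.
have -> : (g \o s) @^-1` A = f @` (g @^-1` A).
  apply/seteqP; split=> [y Ay|_ [x Ax <-]] /=.
    by exists (s y).
  by rewrite (gE _ x) // fsK.
by apply: hom_image_closed => //; exact: hom_preimage_closed.
Qed.

Lemma factor_sigma_hom (X Y Z : sigmaProPType p) (f : X -> Y) (g : X -> Z) :
  is_sigma_epi f -> is_sigma_hom g -> (forall x, f x = 1 -> g x = 1) ->
  exists h : Y -> Z, is_sigma_hom h /\ forall x, h (f x) = g x.
Proof.
move=> [[hf fS] fs] [hg gS] fg.
have [h [hh hE]] := factor_hom hf fs hg fg; exists h; split=> //; split=> // y.
by have [x _ <-] := fs y I; rewrite -fS !hE gS.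
Qed.

Lemma sigma_epi_isomorphic (X Y Z : sigmaProPType p) (f : X -> Y) (g : X -> Z) :
  is_sigma_epi f -> is_sigma_epi g -> (forall x, f x = 1 <-> g x = 1) ->
  exists2 h : Y -> Z, is_sigma_iso h & forall x, h (f x) = g x.
Proof.
move=> ef eg fg; have [h [hh hE]] := factor_sigma_hom ef eg.1 (fun x => (fg x).1).
exists h => //; apply: sigma_iso_bij => //.
- move=> y y'; have [[x _ <-] [x' _ <-]] := conj (ef.2 y I) (ef.2 y' I).
  rewrite !hE => gxx'; have /fg : g (x^-1 * x') = 1.
    by rewrite eg.1.1.2 (homV eg.1.1) gxx' mulVg.
  rewrite ef.1.1.2 (homV ef.1.1) => /(congr1 (fun z => f x * z)).
  by rewrite mulKVg mulg1.
- by move=> z _; have [x _ <-] := eg.2 z I; exists (f x).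
Qed.

Lemma factor_H1 (X Y : proPType p) (f : X -> Y) (chi : X -> 'F_p) :
  is_hom f -> set_surj setT setT f -> H1 X chi ->
  (forall x, f x = 1 -> chi x = 0%R) ->
  exists2 psi, H1 Y psi & forall x, psi (f x) = chi x.
Proof.
move=> hf fs /H1_invariant_hom ichi fchi; have [lc cM _] := ichi.
have /choice[s fsK] : forall y, exists x, f x = y.
  by move=> y; have [x _ <-] := fs y I; exists x.
have cE x y : f x = f y -> chi x = chi y.
  move=> fxy; have /fchi : f (x^-1 * y) = 1 by rewrite hf.2 (homV hf) fxy mulVg.
  rewrite cM // (invariant_homV (normal_setT X) ichi) // addrC => /eqP.
  by rewrite subr_eq0 => /eqP.
have csf x : (chi \o s) (f x) = chi x by apply: cE.
exists (chi \o s); last exact: csf.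
apply/H1_invariant_hom; split.
- apply: (locally_constant_epi hf fs).
  by rewrite (_ : _ \o f = chi) //; apply/funext => x; exact: csf.
- move=> y y' _ _; have [[x _ <-] [x' _ <-]] := conj (fs y I) (fs y' I).
  by rewrite -hf.2 !csf cM.
- move=> y y' _; have [[x _ <-] [x' _ <-]] := conj (fs y I) (fs y' I).
  by rewrite -(homJ hf) !csf; have [_ _ ->] := ichi.
Qed.

Lemma H1_comp (X Y : proPType p) (f : X -> Y) (chi : Y -> 'F_p) :
  is_hom f -> H1 Y chi -> H1 X (chi \o f).
Proof.
move=> hf /H1_invariant_hom ichi; apply/H1_invariant_hom.
exact: (invariant_hom_preimage ichi hf).
Qed.

End Surjectivity.

Section PrimeFieldVectors.
Variable p : nat.
Hypothesis p_prime : prime p.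

Lemma Fp_scale (V : lmodType 'F_p) (c : 'F_p) (v : V) : c *: v = v *+ c.
Proof. by rewrite -{1}[c]natr_Zp scaler_nat. Qed.

(* Additively closed sets of vectors over F_p are subspaces, hence determined by
   the linear forms vanishing on them. *)
Lemma additive_set_dual d (S : set 'rV['F_p]_d) v :
  S 0 -> (forall u w, S u -> S w -> S (u + w)) ->
  (forall c : 'cV['F_p]_d, (forall w, S w -> (w *m c) 0 0 = 0) -> v *m c = 0) ->
  S v.
Proof.
move=> S0 SD Sc.
pose T := finset (fun w : 'rV['F_p]_d => `[< S w >]).
pose M := \matrix_(i < #|T|) (enum_val i : 'rV['F_p]_d).
have SM i : S (row i M).
  by rewrite rowK; have := enum_valP i; rewrite inE => /asboolP.
have MT w : S w -> exists i, w = row i M.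
  move=> Sw; have wT : w \in T by rewrite inE; exact/asboolP.
  by exists (enum_rank_in wT w); rewrite rowK enum_rankK_in.
have /submxP[w ->] : (v <= M)%MS.
  rewrite submxE; apply/eqP/matrixP => i j; rewrite [RHS]mxE ord1.
  have /(congr1 (fun c : 'M['F_p]_1 => c 0 0)) : v *m col j (cokermx M) = 0.
    apply: Sc => w /MT[k ->].
    by rewrite colE mulmxA -row_mul mulmx_coker row0 mul0mx mxE.
  by rewrite colE mulmxA -colE !mxE.
rewrite mulmx_sum_row; elim/big_ind: _ => // i _.
rewrite Fp_scale; elim: (nat_of_ord _) => [|k IH]; first by rewrite mulr0n.
by rewrite mulrS; exact: SD.
Qed.

Lemma additive_set_full d (S : set 'rV['F_p]_d) :
  S 0 -> (forall u v, S u -> S v -> S (u + v)) ->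
  (forall c : 'cV['F_p]_d, (forall v, S v -> (v *m c) 0 0 = 0) -> c = 0) ->
  forall v, S v.
Proof.
by move=> S0 SD Sc v; apply: additive_set_dual => // c /Sc->; rewrite mulmx0.
Qed.

Lemma col_inj_unitmx d (M : 'M['F_p]_d) :
  (forall c : 'cV['F_p]_d, M *m c = 0 -> c = 0) -> M \in unitmx.
Proof.
move=> kM; rewrite -unitmx_tr -row_free_unit; apply: inj_row_free => v vM.
by apply: trmx_inj; rewrite trmx0; apply: kM; rewrite -[M]trmxK -trmx_mul vM trmx0.
Qed.

Lemma col_inj_row_full k d (M : 'M['F_p]_(k, d)) :
  (forall c : 'cV['F_p]_d, M *m c = 0 -> c = 0) -> row_full M.
Proof.
move=> kM; rewrite /row_full -mxrank_tr -/(row_free M^T); apply: inj_row_free => v vM.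
by apply: trmx_inj; rewrite trmx0; apply: kM; rewrite -[M]trmxK -trmx_mul vM trmx0.
Qed.

Lemma Fp_mulrn (x : 'F_p) : x *+ p = 0.
Proof. by rewrite -mulr_natr (pcharf0 (pchar_Fp p_prime)) mulr0. Qed.

Lemma card_rV d : #|{: 'rV['F_p]_d}| = (p ^ d)%N.
Proof. by rewrite card_mx mul1n card_Fp. Qed.

End PrimeFieldVectors.

Section Frames.
Variable p : nat.
Hypothesis p_prime : prime p.
Local Open Scope group_scope.

Lemma invariant_hom_coord (X : proPType p) (A : set X) d
    (B : X -> 'rV['F_p]_d) j :
  invariant_hom A B -> invariant_hom A (fun x => B x 0%R j).
Proof.
move=> [lc BM BJ]; split.
- exact: (locally_constant_comp (fun v : 'rV['F_p]_d => v 0%R j) lc).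
- by move=> x y Ax Ay; rewrite BM // mxE.
- by move=> x y Ax; rewrite BJ.
Qed.

(* The coordinate functions of [B] form a basis of H^1(X, F_p). *)
Definition H1_frame (X : proPType p) d (B : X -> 'rV['F_p]_d) :=
  [/\ invariant_hom setT B,
      forall chi, H1 X chi -> exists u : 'cV['F_p]_d, forall x, chi x = (B x *m u) 0%R 0%R &
      forall u : 'cV['F_p]_d, (forall x, (B x *m u) 0%R 0%R = 0%R) -> u = 0%R].

Lemma frame_dimH1 (X : proPType p) d (B : X -> 'rV['F_p]_d) :
  H1_frame B -> dimH1 X d.
Proof.
move=> [iB Bchi Bu]; exists (fun i x => B x 0%R i); split.
  by move=> i; exact/H1_invariant_hom/invariant_hom_coord.
have E u x : (B x *m u) 0%R 0%R =
    (\sum_(i < d) [ffun i => u i 0%R : 'F_p] i * B x 0%R i)%R.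
  by rewrite mxE; apply: eq_bigr => i _; rewrite ffunE mulrC.
move=> chi /Bchi[u chiE]; exists [ffun i => u i 0%R]; split.
  by move=> x; rewrite chiE E.
move=> c cE; have : (u - \col_i c i)%R = 0%R.
  apply: Bu => x; rewrite mulmxBr mxE [X in (_ + X)%R]mxE -chiE cE.
  rewrite [X in (_ - X)%R]mxE; apply/eqP; rewrite subr_eq0; apply/eqP.
  by apply: eq_bigr => i _; rewrite !mxE mulrC.
move=> /eqP; rewrite subr_eq0 => /eqP ->.
by apply/ffunP => i; rewrite ffunE mxE.
Qed.

Lemma invariant_hom_row (X : proPType p) (A : set X) d (b : 'I_d -> X -> 'F_p) :
  (forall i, invariant_hom A (b i)) -> invariant_hom A (fun x => \row_i b i x)%R.
Proof.
move=> ib; split.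
- move=> x; have lc i : locally_constant (b i) by have [] := ib i.
  apply: filterS (locally_constant_big x lc) => y e.
  by apply/rowP => i; rewrite !mxE.
- move=> x y Ax Ay; apply/rowP => i; rewrite !mxE.
  by have [_ -> ] := ib i.
- move=> x y Ax; apply/rowP => i; rewrite !mxE.
  by have [_ _ ->] := ib i.
Qed.

Lemma dimH1_frame (X : proPType p) d :
  dimH1 X d -> exists B : X -> 'rV['F_p]_d, H1_frame B.
Proof.
move=> [b [Hb bchi]]; exists (fun x => \row_i b i x)%R.
have E u x : ((\row_i b i x)%R *m u) 0%R 0%R =
    (\sum_(i < d) [ffun i => u i 0%R : 'F_p] i * b i x)%R.
  by rewrite mxE; apply: eq_bigr => i _; rewrite ffunE mxE mulrC.
split.
- by apply: invariant_hom_row => i; exact/H1_invariant_hom.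
- move=> chi /bchi[c [cE _]]; exists (\col_i c i)%R => x.
  by rewrite cE E; apply: eq_bigr => i _; rewrite ffunE mxE.
- move=> u u0; have H0 : H1 X (fun=> 0%R).
    apply/H1_invariant_hom; split=> //; first exact: locally_constant_cst.
    by move=> *; rewrite addr0.
  have [c [_ cU]] := bchi _ H0.
  have cu : c = [ffun i => u i 0%R] by apply: cU => x; rewrite -E u0.
  have c0 : c = [ffun=> 0%R].
    by apply: cU => x; rewrite big1 // => i _; rewrite ffunE mul0r.
  apply/colP => i; rewrite mxE.
  by have := congr1 (fun f : {ffun _} => f i) (etrans (esym cu) c0); rewrite !ffunE.
Qed.

Lemma linear_form_invariant_hom (X : proPType p) (A : set X) d
    (B : X -> 'rV['F_p]_d) (u : 'cV['F_p]_d) :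
  invariant_hom A B -> invariant_hom A (fun x => (B x *m u) 0%R 0%R).
Proof.
move=> [lc BM BJ]; split.
- exact: (locally_constant_comp (fun v : 'rV_d => (v *m u) 0%R 0%R) lc).
- by move=> a b Aa Ab; rewrite BM // mulmxDl mxE.
- by move=> a b Aa; rewrite BJ.
Qed.

(** Column j of M holds the coordinates of the character B_j o f, so M is the matrix of H^1(X) ->
    H^1(Y). *)
Lemma frame_coordinates (X Y : proPType p) (f : Y -> X) d e
    (B : X -> 'rV['F_p]_d) (C : Y -> 'rV['F_p]_e) :
  is_hom f -> H1_frame B -> H1_frame C ->
  exists M : 'M['F_p]_(e, d), forall y, B (f y) = C y *m M.
Proof.
move=> hf [iB _ _] [_ Cchi _].
have /choice[u uE] : forall i : 'I_d, exists u : 'cV['F_p]_e, forall y,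
    B (f y) 0%R i = (C y *m u) 0%R 0%R.
  move=> i; apply: Cchi; apply: (@H1_comp _ _ _ f (fun x => B x 0%R i)) => //.
  exact/H1_invariant_hom/invariant_hom_coord.
exists (\matrix_(i, j) u j i 0%R)%R => y; apply/rowP => i; rewrite uE !mxE.
by apply: eq_bigr => j _; rewrite !mxE.
Qed.

Lemma frame_surj (X : proPType p) d (B : X -> 'rV['F_p]_d) :
  H1_frame B -> forall v, exists x, B x = v.
Proof.
move=> [[lc BM BJ] _ Bu] v.
have iB : invariant_hom setT B by [].
suff : range B v by move=> [x _ <-]; exists x.
apply: additive_set_full => //.
- by exists 1 => //; apply: (invariant_hom1 (normal_setT X) iB).
- by move=> _ _ [x _ <-] [y _ <-]; exists (x * y) => //; rewrite BM.
- by move=> c h; apply: Bu => x; apply: h; exists x.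
Qed.

(** Inflation along f is injective between spaces of the same dimension, hence bijective, so every
    character of X comes from Y. *)
Lemma dimH1_eq_kernel (X Y : proPType p) (f : X -> Y) d chi :
  is_hom f -> set_surj setT setT f -> dimH1 X d -> dimH1 Y d ->
  H1 X chi -> forall x, f x = 1 -> chi x = 0%R.
Proof.
move=> hf fs /dimH1_frame[C fC] /dimH1_frame[B fB] Hchi x fx1.
have [M ME] := frame_coordinates hf fB fC.
have [iB _ Bu] := fB; have [_ /(_ _ Hchi)[u ->] _] := fC.
have kM (w : 'cV['F_p]_d) : M *m w = 0%R -> w = 0%R.
  move=> Mw; apply: Bu => y; have [z _ <-] := fs y I.
  by rewrite ME -mulmxA Mw mulmx0 mxE.
have uM : M \in unitmx by exact: col_inj_unitmx.
rewrite -[u](mulKVmx uM) (mulmxA (C x)) -ME fx1.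
by rewrite (invariant_hom1 (normal_setT Y) iB) mul0mx mxE.
Qed.

Lemma dimH1_epi (X Y : proPType p) (f : X -> Y) d :
  is_hom f -> set_surj setT setT f ->
  (forall chi, H1 X chi -> forall x, f x = 1 -> chi x = 0%R) ->
  dimH1 X d <-> dimH1 Y d.
Proof.
move=> hf fs kf; split=> [/dimH1_frame[B [iB Bchi Bu]]|/dimH1_frame[B [iB Bchi Bu]]].
  have Hb i : H1 X (fun x => B x 0%R i).
    exact/H1_invariant_hom/invariant_hom_coord.
  have /choice[b bE] : forall i, exists psi, H1 Y psi /\ forall x, psi (f x) = B x 0%R i.
    by move=> i; have [psi ? ?] := factor_H1 hf fs (Hb i) (kf _ (Hb i)); exists psi.
  apply: (@frame_dimH1 Y d (fun y => \row_i b i y)%R).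
  have E x : (\row_i b i (f x))%R = B x.
    by apply/rowP => i; rewrite mxE; have [_ ->] := bE i.
  split.
  - by apply: invariant_hom_row => i; apply/H1_invariant_hom; have [] := bE i.
  - move=> chi Hchi; have [u uE] := Bchi _ (H1_comp hf Hchi).
    by exists u => y; have [x _ <-] := fs y I; rewrite E -uE.
  - by move=> u u0; apply: Bu => x; rewrite -E u0.
apply: (@frame_dimH1 X d (B \o f)); split.
- exact: (invariant_hom_preimage iB hf).
- move=> chi Hchi; have [psi Hpsi psiE] := factor_H1 hf fs Hchi (kf _ Hchi).
  by have [u uE] := Bchi _ Hpsi; exists u => x; rewrite -psiE uE.
- by move=> u u0; apply: Bu => y; have [x _ <-] := fs y I; exact: u0.
Qed.

Lemma dimH1_iso (X Y : sigmaProPType p) d :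
  sigma_isomorphic X Y -> dimH1 X d -> dimH1 Y d.
Proof.
move=> [f [hf [g [hg fg gf]]]]; apply: (dimH1_epi d hf.1 _ _).1.
  by move=> y _; exists (g y).
move=> chi /H1_invariant_hom ichi x fx1; rewrite -(fg x) fx1 (hom1 hg.1).
exact: (invariant_hom1 (normal_setT X) ichi).
Qed.

End Frames.

(** * The Zassenhaus filtration as a neighbourhood basis of 1 *)

Section ZassenhausNeighbourhoods.
Variables (p : nat) (X : sigmaProPType p).
Hypothesis p_prime : prime p.
Local Open Scope group_scope.

Let p_gt1 : (1 < p)%N := prime_gt1 p_prime.

Lemma H1_zassenhaus chi i : (2 <= i)%N -> H1 X chi ->
  forall x, zassenhaus X i x -> chi x = 0%R.
Proof.
move=> i2 /H1_invariant_hom ichi x /(zassenhaus_le i2).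
rewrite zassenhausE // => Dx.
have nT := normal_setT X; have [_ cM cJ] := ichi.
suff [] : [set x | setT x /\ chi x = 0%R] x by [].
apply: Dx; split; first split.
- by apply: closed_invariant_kernel => //; exact: closedT.
- by have [] := normal_invariant_kernel nT ichi.
- move=> _ [[a _ <-]|[j [k [a [b [_ _ _ _ [_ ->]]]]]]]; split=> //.
    by rewrite (invariant_homX nT ichi) // Fp_mulrn.
  by rewrite /commg cM // cJ // (invariant_homV nT ichi) // addNr.
Qed.

(** The images [H i] of the D_i in a finite p-group decrease and are constant from some i0 on. If
    [H i0] were nontrivial it would carry a nonzero invariant character; this kills p-th powers and
    commutators with elements of [H i0], hence [H i] for large i, which is [H i0] again. *)
Lemma zassenhaus_nbhs (U : set X) : nbhs (1 : X) U ->
  exists2 i, (2 <= i)%N & zassenhaus X i `<=` U.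
Proof.
move=> /proP_basis[P [f [pP fM of1 f1U]]].
have lf := fibers_finite_quotient fM of1.
have nD i : is_normal (zassenhaus X i) by have [] := zassenhaus_csn X i.
pose H i := image_group fM (nD i).1.
have [i0 i0P] : exists i0, forall i, (#|H i0| <= #|H i|)%N.
  have ex : exists n, `[< exists i, #|H i| = n >] by exists #|H 0%N|; apply/asboolP; exists 0%N.
  case: (ex_minnP ex) => n /asboolP[i <-] h; exists i => j.
  by apply: h; apply/asboolP; exists j.
have HE i : (i0 <= i)%N -> H i = H i0.
  move=> le; apply/eqP; rewrite -val_eqE eqEcard i0P andbT.
  by apply: image_groupS; exact: zassenhaus_le.
suff H1 : (H i0 : {set P}) = 1.
  exists (maxn 2 i0); first by rewrite leq_max leqnn.
  move=> x Dx; apply: f1U => /=; apply/set1P; rewrite -[[set 1]%SET]H1.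
  apply/image_groupP; exists x => //.
  by apply: zassenhaus_le Dx; rewrite leq_max leqnn orbT.
apply/trivgP/negPn/negP => nH.
have pG : p.-group (image_group fM (subgroupT X)).
  by exact: pgroupS (finset.subsetT _) pP.
have [l [lM lJ _ [_ /image_groupP[b Db <-] lb]]] := normal_character p_prime pG
    (image_group_normal fM (nD i0)) (normal1 _) (sub1G _) nH.
have iD x : zassenhaus X i0 x -> f x \in H i0 by move=> Dx; apply/image_groupP; exists x.
have iT x : f x \in image_group fM (subgroupT X) by apply/image_groupP; exists x.
have il : invariant_hom (zassenhaus X i0) (l \o f).
  split; first exact: locally_constant_comp.
    by move=> x y Dx Dy; rewrite /= fM lM ?iD.
  by move=> x g Dx; rewrite /= (morph_groupJ fM) lJ ?iD.
(* As i >= p i0, the p-th powers generating D_i are taken of elements of D_i0; as i >= 2 i0, one of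
   j, k is at least i0 whenever j + k = i; the last 2 makes [zassenhausE] applicable. *)
pose i := (p * i0 + 2 * i0 + 2)%N.
have ii0 : (i0 <= i)%N by rewrite /i; lia.
have lD x : zassenhaus X i x -> l (f x) = 0%R.
  move=> Dx; suff [] : [set x | zassenhaus X i0 x /\ (l \o f) x = 0%R] x by [].
  move: Dx; rewrite zassenhausE ?/i //; last lia.
  apply; split; first split.
  - by apply: closed_invariant_kernel => //; exact: zassenhaus_rec_closed.
  - by have [] := normal_invariant_kernel (nD i0) il.
  have [_ lM' lJ'] := il; have [[_ DM DV] DJ] := nD i0.
  move=> _ [[a Da <-]|[j [k [a [c [j0 k0 jk Da [Dc ->]]]]]]].
    have {}Da : zassenhaus X i0 a.
      by apply: zassenhaus_le Da; rewrite leq_divRL; nia.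
    split; last first.
      rewrite (invariant_homX (nD i0) il) //.
      exact: Fp_mulrn.
    exact: subgroupX (nD i0).1 _.
  have [ji|ki] : (i0 <= j)%N \/ (i0 <= k)%N by lia.
    have {}Da := zassenhaus_le ji Da; rewrite /commg; split.
      by apply: DM; [exact: DV|exact: DJ].
    by rewrite lM' ?lJ' ?(invariant_homV (nD i0) il) ?addNr //; [exact: DV|exact: DJ].
  have {}Dc := zassenhaus_le ki Dc.
  have -> : [~ a, c] = c^-1 ^ a * c by rewrite /commg /conjg !mulgA.
  split; first by apply: DM => //; apply: DJ; exact: DV.
  by rewrite lM' ?lJ' ?(invariant_homV (nD i0) il) ?addNr //; [exact: DV|apply: DJ; exact: DV].
have : f b \in H i by rewrite HE //; exact: iD.
by move=> /image_groupP[x Dx fx]; move: lb; rewrite /= -fx lD ?eqxx.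
Qed.

End ZassenhausNeighbourhoods.

(** * Free sigma-pro-p-groups *)

(** An alias of P carrying the proof that P is a p-group, so that a pro-p structure can be attached
    to it and the universal property of free groups applies to finite targets. *)
Definition discrete_group (p : nat) (P : finGroupType)
  (pP : (p.-group [set: P]%G)%g) : Type := P.

Section DiscreteGroup.
Variables (p : nat) (P : finGroupType) (pP : (p.-group [set: P]%G)%g).
Local Notation T := (discrete_group pP).
Local Open Scope group_scope.

HB.instance Definition _ := monoid.Group.copy T P.
HB.instance Definition _ := Choice.copy T P.
HB.instance Definition _ := @isOpenTopological.Build T (fun _ => True) I
  (fun _ _ _ _ => I) (fun _ _ _ => I).

Let continuous_discrete (S : topologicalType) (f : T -> S) : continuous f.
Proof.
move=> x W /nbhs_singleton Wx.
by apply: (@open_nbhs_nbhs _ x (f @^-1` W)); split.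
Qed.

Let discrete_mul : continuous (fun xy : T * T => xy.1 * xy.2).
Proof.
move=> [x y] W /nbhs_singleton /= Wxy; exists ([set x], [set y]) => /=.
  by split; apply: open_nbhs_nbhs; split.
by move=> [a b] [/= -> ->].
Qed.

Let discrete_inv : continuous (fun x : T => x^-1).
Proof. exact: continuous_discrete. Qed.

Let discrete_compact : compact [set: T].
Proof. exact/finite_compact/finite_finset. Qed.

Let discrete_hausdorff : hausdorff_space T.
Proof.
move=> x y xy; have [z [/= -> ->//]] :
    (([set x] : set T) `&` ([set y] : set T)) !=set0.
by apply: xy; apply: open_nbhs_nbhs; split.
Qed.

Let discrete_basis (U : set T) : nbhs (1 : T) U ->
  exists (P : finGroupType) (f : T -> P),
    [/\ p.-group [set: P]%G, {morph f : x y / x * y},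
        open (f @^-1` [set 1]) & f @^-1` [set 1] `<=` U].
Proof. by move=> /nbhs_singleton U1; exists P, id; split=> // x ->. Qed.

HB.instance Definition _ := @isProP.Build p T discrete_mul discrete_inv
  discrete_compact discrete_hausdorff discrete_basis.

End DiscreteGroup.

Section MinusPart.
Variable p : nat.
Hypotheses (p_prime : prime p) (p_gt2 : (2 < p)%N).
Local Open Scope group_scope.

Lemma sigma1 (X : sigmaProPType p) : sigma (1 : X) = 1.
Proof. exact: hom1 (sigma_hom X). Qed.

Lemma closed_minus (X : sigmaProPType p) : closed (minus_part X).
Proof.
pose f (x : X) := sigma x * x.
have -> : minus_part X = f @^-1` [set 1].
  apply/seteqP; split=> x; rewrite /minus_part /f /=; first by move=> ->; rewrite mulVg.
  by move=> h; apply: (mulIg x); rewrite h mulVg.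
have fc : continuous f.
  move=> x; apply: (@continuous_comp _ _ _ (fun x : X => (sigma x, x))
    (fun xy : X * X => xy.1 * xy.2)); last exact: mulg_continuous.
  by apply: cvg_pair; [exact: sigma_continuous|exact: cvg_id].
by move/continuous_closedP : fc; apply; exact: (@closed_set1 p X 1).
Qed.

Lemma minusX (X : sigmaProPType p) (x : X) k :
  minus_part X x -> minus_part X (x ^+ k).
Proof. by move=> mx; rewrite /minus_part /= (homX (sigma_hom X)) mx expVgn. Qed.

Lemma minus_mul_sigmaV (X : sigmaProPType p) (x : X) :
  minus_part X (x * (sigma x)^-1).
Proof.
by rewrite /minus_part /= sigmaM (homV (sigma_hom X)) sigmaK invgM invgK.
Qed.

(** The exponent inverts squaring, as the order of P is odd. *)
Lemma half_odd_expg (P : finGroupType) (x : P) :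
  p.-group [set: P]%G -> (x ^+ 2) ^+ (#|P|.+1)./2 = x.
Proof.
move=> pP; have cP : #|[set: P]%G| = #|P| by exact: cardsT.
have oP : odd #|P|.
  rewrite -cP; apply: odd_pgroup_odd pP.
  by case: (even_prime p_prime) p_gt2 => [->|].
have xP : x ^+ #|P| = 1 by rewrite -cP; apply: expg_cardG; rewrite inE.
by rewrite -expgM mulnC muln2 even_halfK /= ?oP // expgS xP mulg1.
Qed.

(* For [f u = q] with [q] in the minus part, [u (sigma u)^-1] lies in the minus
   part and maps to [q ^ 2]; square roots exist as [p] is odd. *)
Lemma minus_lift (X Y : sigmaProPType p) (f : X -> Y) q :
  is_sigma_epi f -> minus_part Y q -> exists2 a, minus_part X a & f a = q.
Proof.
move=> [[hf fS] fs] mq; apply: contrapT => nq.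
(* The square root is not taken in Y but in a finite p-group P in which q would be separated from
   the closed set f(X^-); there it is a power with an exponent depending on P. *)
have [|P [g [pP gM lg]]] := separate_closed (a := q)
  (hom_image_closed hf (@closed_minus X)).
  by move=> [a ma fa]; apply: nq; exists a.
have [u _ fu] := fs q I.
pose w := u * (sigma u)^-1.
have fw : f w = q ^+ 2 by rewrite hf.2 (homV hf) fS fu mq invgK.
have gX k x : g (x ^+ k) = g x ^+ k.
  elim: k => [|k IH]; first by rewrite !expg0 (morph_group1 gM).
  by rewrite !expgS gM IH.
apply; exists (f (w ^+ (#|P|.+1)./2)).
  by exists (w ^+ (#|P|.+1)./2) => //; apply: minusX; exact: minus_mul_sigmaV.
by rewrite (homX hf) fw !gX half_odd_expg.
Qed.

End MinusPart.

Section FreeGroups.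
Variable p : nat.
Hypotheses (p_prime : prime p) (p_gt2 : (2 < p)%N).
Local Open Scope group_scope.

Lemma pgroup_Fp : p.-group [set: 'F_p]%G.
Proof. by rewrite /pgroup cardsT card_Fp // pnat_id. Qed.

Lemma H1_discrete_hom (X : proPType p) (chi : X -> 'F_p) :
  H1 X chi <-> is_hom (chi : X -> discrete_group pgroup_Fp).
Proof.
split=> [Hchi|[cc cM]].
  have lc := H1_locally_constant Hchi; have [_ cM] := Hchi; split.
    exact: (@locally_constant_continuousT X (discrete_group pgroup_Fp) chi lc).
  by move=> x y; exact: cM.
split; last by move=> x y; exact: cM.
by move=> c; move/continuousP: cc => /(_ [set c]); exact.
Qed.

Section Basis.
Variables (n : nat) (F : freeSigmaProP p n).

Lemma free_hom_eq (H : proPType p) (f g : F -> H) :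
  is_hom f -> is_hom g -> (forall i, f (free_gen F i) = g (free_gen F i)) -> f = g.
Proof.
move=> hf hg fg; have [h [_ hU]] := free_univ F (fun i => g (free_gen F i)).
by rewrite -(hU f) // -(hU g).
Qed.

Lemma free_sigma_hom_exists (H : sigmaProPType p) (y : 'I_n -> H) :
  (forall i, minus_part H (y i)) ->
  exists f : F -> H, is_sigma_hom f /\ forall i, f (free_gen F i) = y i.
Proof.
move=> my; have [f [[hf fy] _]] := free_univ F y; exists f; split=> //; split=> //.
suff e : f \o sigma = sigma \o f by move=> x; exact: (congr1 (fun h => h x) e).
apply: free_hom_eq.
- exact: is_hom_comp (sigma_hom F) hf.
- exact: is_hom_comp hf (sigma_hom H).
- by move=> i; rewrite /= free_gen_sigma (homV hf) fy (my i).
Qed.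

Lemma free_gen_minus i : minus_part F (free_gen F i).
Proof. exact: free_gen_sigma. Qed.

Lemma free_H1_eq (chi psi : F -> 'F_p) : H1 F chi -> H1 F psi ->
  (forall i, chi (free_gen F i) = psi (free_gen F i)) -> chi = psi.
Proof.
move=> /H1_discrete_hom hc /H1_discrete_hom hp e.
exact: (free_hom_eq hc hp e).
Qed.

Lemma H1_0 (X : proPType p) : H1 X (fun=> 0%R).
Proof.
apply/H1_invariant_hom; split=> //; first exact: locally_constant_cst.
by move=> *; rewrite addr0.
Qed.

Lemma free_H1_0 (chi : F -> 'F_p) : H1 F chi ->
  (forall i, chi (free_gen F i) = 0%R) -> forall x, chi x = 0%R.
Proof.
by move=> Hchi c0 x; rewrite (free_H1_eq Hchi (H1_0 F) c0).
Qed.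

(** The character chi o sigma + chi vanishes on the generators, which sigma inverts. *)
Lemma free_H1_sigma (chi : F -> 'F_p) : H1 F chi ->
  forall x, chi (sigma x) = (- chi x)%R.
Proof.
move=> Hchi x; have ichi := (H1_invariant_hom chi).1 Hchi.
have isig : invariant_hom setT (chi \o sigma).
  exact: (invariant_hom_preimage ichi (sigma_hom F)).
have Hs : H1 F (fun x => chi (sigma x) + chi x)%R.
  by apply/H1_invariant_hom; exact: (invariant_homD isig ichi).
apply/eqP; rewrite -addr_eq0; apply/eqP; apply: (free_H1_0 Hs) => i.
rewrite free_gen_sigma (invariant_homV (normal_setT F) ichi) //.
by rewrite addNr.
Qed.

Lemma free_H1_exists (c : 'I_n -> 'F_p) :
  exists2 chi, H1 F chi & forall i, chi (free_gen F i) = c i.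
Proof.
have [f [[hf fc] _]] := free_univ F (c : 'I_n -> discrete_group pgroup_Fp).
by exists f => //; exact/H1_discrete_hom.
Qed.

Lemma free_generated (A : set F) : closed A -> is_subgroup A ->
  (forall i, A (free_gen F i)) -> A = setT.
Proof.
move=> cA sA Ag; apply: contrapT => AT.
have [chi Hchi [c0 [a]]] := exists_H1 p_prime cA sA AT.
by apply; apply: free_H1_0 => // i; exact: c0.
Qed.

Lemma free_frame : exists2 B : F -> 'rV['F_p]_n, H1_frame B &
  forall i, B (free_gen F i) = delta_mx 0%R i.
Proof.
have /choice[b bP] : forall j : 'I_n, exists chi,
    H1 F chi /\ forall i, chi (free_gen F i) = (i == j)%:R%R.
  by move=> j; have [chi ? ?] := free_H1_exists (fun i => (i == j)%:R%R); exists chi.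
have Bg i : (\row_j b j (free_gen F i))%R = delta_mx 0%R i.
  by apply/rowP => j; have [_ e] := bP j; rewrite !mxE e eqxx eq_sym.
exists (fun x => \row_j b j x)%R => //; split.
- by apply: invariant_hom_row => j; apply/H1_invariant_hom; have [] := bP j.
- move=> chi Hchi; exists (\col_j chi (free_gen F j))%R => x.
  pose psi x := ((\row_j b j x)%R *m (\col_j chi (free_gen F j))%R) 0%R 0%R.
  suff e : chi = psi by exact: (congr1 (fun h => h x) e).
  apply: free_H1_eq => // [|i].
    apply/H1_invariant_hom; pose g (v : 'rV['F_p]_n) : 'F_p := (v *m (\col_j chi (free_gen F j))%R) 0%R 0%R.
    have ib : invariant_hom setT (fun x => \row_j b j x)%R.
      by apply: invariant_hom_row => j; apply/H1_invariant_hom; have [] := bP j.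
    have [lc bM bJ] := ib; split.
    + exact: (locally_constant_comp g lc).
    + by move=> y z _ _; rewrite /psi bM // mulmxDl mxE.
    + by move=> y z _; rewrite /psi bJ.
  by rewrite /psi Bg -rowE !mxE.
- move=> u u0; apply/colP => i; rewrite [RHS]mxE.
  by have := u0 (free_gen F i); rewrite Bg -rowE mxE.
Qed.

Lemma dimH1_free : dimH1 F n.
Proof. by have [B fB _] := free_frame; exact: frame_dimH1 fB. Qed.

(** Projectivity of F: the generators are sent into Y^-, and [minus_lift] lifts these images to
    X^-. *)
Lemma free_lift (X Y : sigmaProPType p) (f : X -> Y) (g : F -> Y) :
  is_sigma_epi f -> is_sigma_hom g ->
  exists h : F -> X, is_sigma_hom h /\ forall x, f (h x) = g x.
Proof.
move=> ef [hg gS].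
have /choice[y yP] : forall i, exists a, minus_part X a /\ f a = g (free_gen F i).
  move=> i; have mg : minus_part Y (g (free_gen F i)).
    by rewrite /minus_part /= -gS free_gen_sigma (homV hg).
  by have [a ? ?] := minus_lift p_prime p_gt2 ef mg; exists a.
have [h [hh hy]] : exists h : F -> X, is_sigma_hom h /\ forall i, h (free_gen F i) = y i.
  by apply: free_sigma_hom_exists => i; have [] := yP i.
exists h; split=> //; have := comp_hom hh ef.1 => -[hfh _].
suff e : f \o h = g by move=> x; exact: (congr1 (fun k => k x) e).
by apply: free_hom_eq => // i; rewrite /= hy; have [] := yP i.
Qed.

(* F has only finitely many homomorphisms to a finite p-group, so a surjective
   endomorphism acts bijectively on them. *)
Lemma free_hopfian (a : F -> F) : is_hom a -> set_surj setT setT a -> injective a.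
Proof.
move=> ha sa; suff k1 x : a x = 1 -> x = 1.
  move=> x y axy; have /k1 : a (x^-1 * y) = 1 by rewrite ha.2 (homV ha) axy mulVg.
  by move=> /(congr1 (fun z => x * z)); rewrite mulKVg mulg1.
move=> ax1; apply: contrapT => x1.
have [P [f [pP fM lf]]] := separate_closed (@closed_set1 p F 1) x1; apply.
exists 1 => //; rewrite (morph_group1 fM).
pose D := discrete_group pP.
have hom_f : @is_hom p F D f.
  by split=> //; exact: (@locally_constant_continuousT F D f lf).
have /choice[ext extP] : forall y : {ffun 'I_n -> P}, exists g : F -> D,
    is_hom g /\ forall i, g (free_gen F i) = y i.
  by move=> y; have [g [h _]] := free_univ F (y : 'I_n -> D); exists g.
(* [Phi] is precomposition with a on Hom(F, P) = P^n. Once f is known to be of the form g o a, it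
   cannot distinguish x from 1. *)
pose Phi (y : {ffun 'I_n -> P}) := [ffun i => ext y (a (free_gen F i)) : P].
have comp (g : F -> D) : is_hom g -> @is_hom p F D (g \o a) := is_hom_comp ha.
have iPhi : injective Phi.
  move=> y y' e; have [[hy ey] [hy' ey']] := conj (extP y) (extP y').
  have eya : ext y \o a = ext y' \o a.
    apply: free_hom_eq; [exact: comp|exact: comp|move=> i].
    by have := congr1 (fun g : {ffun 'I_n -> P} => g i) e; rewrite !ffunE.
  apply/ffunP => i; rewrite -ey -ey'; have [z _ <-] := sa (free_gen F i) I.
  exact: (congr1 (fun g => g z) eya).
have [y yE] : exists y, Phi y = [ffun i => f (free_gen F i)].
  by have [g _ gK] := injF_bij iPhi; exists (g [ffun i => f (free_gen F i)]); rewrite gK.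
have [hy ey] := extP y.
have -> : f = ext y \o a :> (F -> D).
  apply: free_hom_eq; [exact: hom_f|exact: comp|move=> i].
  by have := congr1 (fun g : {ffun 'I_n -> P} => g i) yE; rewrite !ffunE.
by rewrite /= ax1; exact: (esym (hom1 hy)).
Qed.

Lemma free_surj_iso (a : F -> F) : is_sigma_epi a -> sigma_Aut F a.
Proof.
by move=> [ha sa]; apply: sigma_iso_bij => //; apply: free_hopfian => //; exact: ha.1.
Qed.

(** Equal dimensions make every character of X factor through f, so one that kills the image of h is
    zero because f o h is onto. *)
Lemma free_lift_epi (X Y : sigmaProPType p) (f : X -> Y) (h : F -> X) d :
  is_sigma_epi f -> is_sigma_hom h -> set_surj setT setT (f \o h) ->
  dimH1 X d -> dimH1 Y d -> is_sigma_epi h.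
Proof.
move=> [[hf fS] fs] hh sfh dX dY; split=> //.
apply: (hom_surj_H1 p_prime hh.1) => chi Hchi c0.
have [psi Hpsi psiE] := factor_H1 hf fs Hchi
  (dimH1_eq_kernel hf fs dX dY Hchi).
by move=> x; rewrite -psiE; have [y _ <-] := sfh (f x) I; rewrite /= psiE.
Qed.

(** A lift a of pi' through pi is onto since F and H have the same number of generators, and then
    bijective by the Hopfian property. *)
Lemma free_epi_conj (H : sigmaProPType p) (pi pi' : F -> H) :
  dimH1 H n -> is_sigma_epi pi -> is_sigma_epi pi' ->
  exists2 a, sigma_Aut F a & forall x, pi (a x) = pi' x.
Proof.
move=> dH ep ep'; have [a [ha aE]] := free_lift ep ep'.1.
exists a => //; apply: free_surj_iso; apply: free_lift_epi ep ha _ dimH1_free dH.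
by move=> y _; have [x _ <-] := ep'.2 y I; exists x => //=; rewrite aE.
Qed.

Section Rebase.
Variable y : 'I_n -> F.
Hypotheses (minus_y : forall i, minus_part F (y i))
  (gen_y : forall chi, H1 F chi -> (forall i, chi (y i) = 0%R) ->
     forall x, chi x = 0%R).

Lemma rebase_univ (H : proPType p) (z : 'I_n -> H) :
  exists! f : F -> H, is_hom f /\ forall i, f (y i) = z i.
Proof.
have [g [hg gE]] := free_sigma_hom_exists minus_y.
have eg : is_sigma_epi g.
  split=> //; apply: (hom_surj_H1 p_prime hg.1) => chi Hchi c0; apply: gen_y => // i.
  by rewrite -gE.
have [_ [g' [hg' gK g'K]]] := free_surj_iso eg.
have [f [[hf fz] fU]] := free_univ F z.
exists (f \o g'); split.
  by split; [exact: is_hom_comp hg'.1 hf|move=> i; rewrite /= -gE gK].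
move=> f' [hf' fz']; apply/funext => x /=.
have -> : f = f' \o g; last by rewrite /= g'K.
by apply: fU; split; [exact: is_hom_comp hg.1 hf'|move=> i; rewrite /= gE].
Qed.

(* By the Hopfian property a generating n-tuple in the minus part is again a
   basis. *)
Definition rebase : freeSigmaProP p n :=
  @FreeSigmaProP p n F y rebase_univ minus_y.

End Rebase.

End Basis.

Lemma generators_row_full (k d : nat) (E : freeSigmaProP p k) (H : sigmaProPType p)
    (q : E -> H) (B : H -> 'rV['F_p]_d) : is_sigma_epi q -> H1_frame B ->
  row_full (\matrix_(i < k) B (q (free_gen E i)))%R.
Proof.
move=> eq [iB _ Bu]; apply: col_inj_row_full => c Mc.
apply: Bu => y; have [x _ <-] := eq.2 y I; move: x.
have HB : H1 H (fun y => (B y *m c) 0%R 0%R).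
  exact/H1_invariant_hom/linear_form_invariant_hom.
apply: (free_H1_0 (H1_comp eq.1.1 HB)) => i /=.
by rewrite -[B _](rowK (fun i => B (q (free_gen E i)))) -row_mul Mc row0 mxE.
Qed.

Lemma dimH1_le (k n : nat) (E : freeSigmaProP p k) (H : sigmaProPType p) (q : E -> H) :
  is_sigma_epi q -> dimH1 H n -> (n <= k)%N.
Proof.
move=> eq /dimH1_frame[B fB]; have /eqP <- := generators_row_full eq fB.
exact: rank_leq_row.
Qed.

(** Burnside basis theorem: among the images under q of the k generators, all in the minus part, n
    have coordinates forming an invertible matrix, and these generate H. *)
Lemma exists_epi (k n : nat) (E : freeSigmaProP p k) (F : freeSigmaProP p n)
    (H : sigmaProPType p) (q : E -> H) :
  is_sigma_epi q -> dimH1 H n -> exists pi : F -> H, is_sigma_epi pi.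
Proof.
move=> eq /dimH1_frame[B fB]; have [_ Bchi _] := fB; have [[hq qS] _] := eq.
pose M := \matrix_(i < k) B (q (free_gen E i)).
have full : row_full M := generators_row_full eq fB.
pose f := fullrankfun full.
have mq i : minus_part H (q (free_gen E i)).
  by rewrite /minus_part /= -qS free_gen_sigma (homV hq).
have [pi [hpi piE]] := free_sigma_hom_exists F (fun i => mq (f i)).
exists pi; split=> //; apply: (hom_surj_H1 p_prime hpi.1) => chi Hchi c0 y.
have [u uE] := Bchi _ Hchi; rewrite uE.
have Nu : rowsub f M *m u = 0%R.
  apply/colP => i; rewrite [RHS]mxE -(c0 (free_gen F i)) piE uE !mxE.
  by apply: eq_bigr => j _; rewrite !mxE.
by rewrite -(mulKmx (fullrowsub_unit full) u) Nu !mulmx0 mxE.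
Qed.

End FreeGroups.

(** * Minimal generators of normal subgroups *)

Section Coordinates.
Variable p : nat.
Hypotheses (p_prime : prime p) (p_gt2 : (2 < p)%N).
Local Open Scope group_scope.

(* The coordinates on the F_p-vector space A / A^p[A, X], whose dimension is
   the number of generators of A as a normal subgroup. *)
Definition normal_coordinates (X : proPType p) (A : set X) m (chi : X -> 'rV['F_p]_m) :=
  [/\ invariant_hom A chi, forall v, exists2 a, A a & chi a = v &
      forall B, closed B -> is_normal B -> B `<=` A ->
        (forall v, exists2 b, B b & chi b = v) -> A `<=` B].

(** The coordinates are dual to a minimal normal generating family y. They exist because a linear
    relation satisfied by the values on y of all invariant homomorphisms would make one of the y i
    redundant. *)
Lemma exists_normal_coordinates (X : proPType p) (A : set X) m :
  min_normal_generators A m -> exists chi : X -> 'rV['F_p]_m, normal_coordinates A chi.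
Proof.
move=> [[y Ay] Amin].
have cA : closed A by rewrite Ay; exact: generated_closed.
have nA : is_normal A by rewrite Ay; exact: normally_generated_normal.
have yA i : A (y i) by rewrite Ay; apply: sub_normally_generated; exists i.
have l0 (V : zmodType) (l : X -> V) : invariant_hom A l ->
    (forall i, l (y i) = 0%R) -> forall a, A a -> l a = 0%R.
  move=> il ly a; rewrite {1}Ay => Aa.
  apply: (invariant_hom_normally_generated nA il cA _ _ Aa).
    by move=> _ [i _ <-].
  by move=> _ [i _ <-].
have dual (v : 'rV['F_p]_m) :
    exists2 l : X -> 'F_p, invariant_hom A l & forall i, l (y i) = v 0%R i.
  pose S : set 'rV['F_p]_m := [set v | exists2 l : X -> 'F_p, invariant_hom A l &
    forall i, l (y i) = v 0%R i].
  apply: (@additive_set_full p m S).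
  - exists (fun=> 0%R); last by move=> i; rewrite mxE.
    by split=> [|a b _ _|//]; [exact: locally_constant_cst|rewrite addr0].
  - move=> u w [l il lu] [l' il' lw]; exists (fun x => l x + l' x)%R.
      exact: invariant_homD.
    by move=> i; rewrite lu lw mxE.
  move=> c Sc; apply: contrapT => /eqP/cV0Pn[i0 ci0].
  have {}Sc (l : X -> 'F_p) : invariant_hom A l -> ((\row_i l (y i)) *m c)%R 0%R 0%R = 0%R.
    by move=> il; apply: Sc; exists l => // i; rewrite mxE.
  clear v S; case: m i0 c ci0 y Ay Amin yA l0 Sc => [[]//|m'] i0 c ci0 y Ay Amin yA l0 Sc.
  pose z (j : 'I_m') := y (lift i0 j).
  suff Az : A = normally_generated (range z) by have := Amin _ z Az; rewrite ltnn.
  have zA : normally_generated (range z) `<=` A.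
    by apply: normally_generated_sub => // _ [j _ <-]; exact: yA.
  apply/seteqP; split=> //; apply: contrapT => nAz.
  (* An l killing all y j with j different from i0 also kills y i0, by the relation c with nonzero
     entry at i0; so l would vanish on A. *)
  have [l [il lz [a Aa /eqP]]] := exists_invariant_hom p_prime nA
    (@generated_closed p X _) (@normally_generated_normal p X _) zA nAz.
  apply; apply: l0 => // i; apply/eqP; case: (unliftP i0 i) => [j|] ->.
    by apply/eqP; apply: lz; apply: sub_normally_generated; exists j.
  have := Sc l il.
  rewrite mxE (bigD1 i0) //= big1 ?addr0; last first.
    move=> k; rewrite eq_sym => /unlift_some[j -> _]; rewrite mxE.
    rewrite [l _](_ : _ = 0%R) ?mul0r //.
    by apply: lz; apply: sub_normally_generated; exists j.
  by move=> /eqP; rewrite mxE mulf_eq0 (negPf ci0) orbF.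
have /choice[b bP] : forall j : 'I_m, exists l : X -> 'F_p,
    invariant_hom A l /\ forall i, l (y i) = (i == j)%:R%R.
  move=> j; have [l il ly] := dual (\row_i (i == j)%:R)%R; exists l; split=> // i.
  by rewrite ly mxE.
pose chi x := (\row_j b j x)%R.
have ichi : invariant_hom A chi by apply: invariant_hom_row => j; have [] := bP j.
have chiy i : chi (y i) = delta_mx 0%R i.
  by apply/rowP => j; have [_ e] := bP j; rewrite !mxE e eqxx eq_sym.
exists chi; split=> //.
  have [[A1 AM _] _] := nA; have [_ chiM _] := ichi.
  apply: additive_set_full.
  - by exists 1 => //; exact: (invariant_hom1 nA ichi).
  - move=> _ _ [a Aa <-] [a' Aa' <-]; exists (a * a'); first exact: AM.
    by rewrite chiM.
  move=> c h; apply/colP => i; rewrite [RHS]mxE.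
  by have /h : exists2 a, A a & chi a = chi (y i); [exists (y i)|rewrite chiy -rowE mxE].
(* A proper B would be killed by some nonzero l. This l is the linear form u in chi, and u = 0 since
   chi is onto already on B. *)
move=> B cB nB BA Bfull; apply: contrapT => nAB.
have [l [il lB [a Aa /eqP]]] := exists_invariant_hom p_prime nA cB nB BA nAB.
apply; pose u := (\col_i l (y i))%R.
have lE x : A x -> (l x - (chi x *m u) 0 0 = 0)%R.
  apply: (l0 _ (fun x => l x - (chi x *m u) 0 0)%R).
    by apply: invariant_homB => //; exact: linear_form_invariant_hom.
  by move=> i; rewrite chiy -rowE !mxE subrr.
have u0 : u = 0%R.
  apply/colP => i; rewrite [RHS]mxE; have [x Bx xE] := Bfull (delta_mx 0%R i).
  by have := lE x (BA _ Bx); rewrite lB // xE -rowE mxE sub0r => /eqP; rewrite oppr_eq0 => /eqP.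
by have := lE a Aa; rewrite u0 mulmx0 mxE subr0.
Qed.

End Coordinates.

Section RelativeCoordinates.
Variable p : nat.
Hypotheses (p_prime : prime p) (p_gt2 : (2 < p)%N).
Local Open Scope group_scope.

Lemma normal_image (X Y : proPType p) (f : X -> Y) (A : set X) :
  is_hom f -> set_surj setT setT f -> is_normal A -> is_normal (f @` A).
Proof.
move=> hf fs [sA nA]; split; first exact: hom_image_subgroup.
move=> _ y [x Ax <-]; have [z _ <-] := fs y I.
by exists (x ^ z); [exact: nA|exact: homJ].
Qed.

Lemma quo_pi_eq (X : sigmaProPType p) (D : set X) x y : closed_sigma_normal D ->
  quo_pi D x = quo_pi D y <-> D (x^-1 * y).
Proof. by move=> cD; rewrite -[X in _ <-> X _](sigma_kernel_id cD); exact: quo_piP. Qed.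

Lemma quo_pi_eq1 (X : sigmaProPType p) (D : set X) x : closed_sigma_normal D ->
  quo_pi D x = 1 <-> D x.
Proof.
move=> cD; have e : quo_pi D 1 = quo_pi D x <-> D (1^-1 * x) by exact: quo_pi_eq.
rewrite invg1 mul1g in e; split; first by move=> h; apply/e; rewrite h.
by move=> /e <-.
Qed.

(* The coordinates on M / D M^p[M, F] for M = N D, where N = ker pi. *)
Definition relative_coordinates (X : proPType p) (D M : set X) m
    (chi : X -> 'rV['F_p]_m) :=
  [/\ invariant_hom M chi, forall d, D d -> chi d = 0%R,
      forall v, exists2 a, M a & chi a = v &
      forall B, closed B -> is_normal B -> B `<=` M ->
        (forall v, exists2 b, B b & chi b = v) ->
        forall u, M u -> exists b d, [/\ B b, D d & u = b * d]].

(** These are the coordinates of ND / D pulled back from X / D; the factor d in the last clause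
    accounts for passing from the image of B back to B. *)
Lemma exists_relative_coordinates (X G : sigmaProPType p) (D : set X) (pi : X -> G) m :
  closed_sigma_normal D -> is_sigma_epi pi ->
  min_normal_generators (quo_pi D @` (pi @^-1` [set 1])) m ->
  exists chi : X -> 'rV['F_p]_m,
    relative_coordinates D [set u | exists2 d, D d & pi u = pi d] chi.
Proof.
move=> cD epi /(exists_normal_coordinates p_prime)[chi [ichi chi_surj chiB]].
set M := [set u | _].
have [[hq _] qs] := @quo_pi_epi p X D.
have [D1 DM DV] : is_subgroup D by have [_ []] := cD.
pose A := quo_pi D @` (pi @^-1` [set 1]).
have AE : quo_pi D @^-1` A = M.
  apply/seteqP; split=> u.
    move=> [x /= px] /(quo_pi_eq _ _ cD) Dxu; exists (x^-1 * u) => //.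
    by rewrite epi.1.1.2 (homV epi.1.1) px invg1 mul1g.
  move=> [d Dd pu]; exists (u * d^-1).
    by rewrite /= epi.1.1.2 (homV epi.1.1) pu mulgV.
  by apply/(quo_pi_eq _ _ cD); rewrite invgM invgK mulgKV.
have nA : is_normal A by apply: normal_image => //; exact: normal_kernel epi.1.1.
exists (chi \o quo_pi D); split.
- by have h := invariant_hom_preimage ichi hq; rewrite -AE.
- move=> d Dd /=; have -> : quo_pi D d = 1 by exact/(quo_pi_eq1 _ cD).
  exact: (invariant_hom1 nA ichi).
- move=> v; have [_ [u pu <-] <-] := chi_surj v; exists u => //.
  by exists 1 => //; rewrite pu (hom1 epi.1.1).
move=> B cB nB BM Bfull u Mu.
have : (quo_pi D @` B) (quo_pi D u).
  apply: (chiB (quo_pi D @` B)).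
  - exact: hom_image_closed.
  - exact: normal_image.
  - by move=> _ [b /BM Mb <-]; move: Mb; rewrite -AE.
  - by move=> v; have [b Bb <-] := Bfull v; exists (quo_pi D b) => //; exists b.
  - by move: Mu; rewrite -AE.
move=> [b Bb /(quo_pi_eq _ _ cD) Dbu]; exists b, (b^-1 * u); split=> //.
by rewrite mulKVg.
Qed.

(* As the relators of a presentation of G lie in the minus part, sigma acts
   on the coordinates by -1. *)
Lemma relative_coordinates_sigma (k n : nat) (E : freeSigmaProP p k)
    (F : freeSigmaProP p n) (G : sigmaProPType p) (S : set E) (f : E -> G)
    (pi : F -> G) (D : set F) m (chi : F -> 'rV['F_p]_m) :
  let M := [set u | exists2 d, D d & pi u = pi d] in
  closed_sigma_normal D -> S `<=` minus_part E -> is_sigma_epi f ->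
  (forall x, f x = 1 <-> normally_generated S x) ->
  is_sigma_epi pi -> dimH1 G n -> closed M -> is_normal M ->
  relative_coordinates D M chi ->
  forall u, M u -> chi (sigma u) = (- chi u)%R.
Proof.
move=> M cD Sm ef fS epi dG cM nM [ichi chiD _ _].
(* The presentation may have more than n generators, so its relators are carried to F by a lift psi
   of f through pi. *)
have [psi [hpsi psiE]] := free_lift p_prime p_gt2 epi ef.1.
have epsi : is_sigma_epi psi.
  apply: (free_lift_epi p_prime epi hpsi _ (dimH1_free p_prime F) dG) => y _.
  by have [x _ <-] := ef.2 y I; exists x => //=.
have [_ [[_ _ DV] _] sD] := cD.
have Msigma u : M u -> M (sigma u).
  by move=> [d Dd e]; exists (sigma d); [exact: sD|rewrite !epi.1.2 e].
have isig : invariant_hom M (chi \o sigma).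
  apply: (invariant_hom_sub (invariant_hom_preimage ichi (sigma_hom F))).
  exact: Msigma.
have idelta := invariant_homD isig ichi.
have psiM : is_normal (psi @^-1` M) by exact: normal_preimage hpsi.1 nM.
have psi0 w : f w = 1 -> chi (sigma (psi w)) + chi (psi w) = 0 :> 'rV_m.
  move=> /fS; apply: (invariant_hom_normally_generated psiM
      (invariant_hom_preimage idelta hpsi.1)).
  - exact: (hom_preimage_closed hpsi.1).
  - move=> s Ss; exists 1; first by have [] := cD => _ [[]].
    rewrite psiE (hom1 epi.1.1); apply/fS; exact: sub_normally_generated.
  - move=> s Ss; rewrite /= -hpsi.2 (Sm s Ss) (homV hpsi.1).
    rewrite (invariant_homV nM ichi) ?addNr //; exists 1.
      by have [] := cD => _ [[]].
    by rewrite psiE (hom1 epi.1.1); apply/fS; exact: sub_normally_generated.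
(* Up to the factor d, the element u lies in ker pi, and every element of ker pi is psi w for some w
   with f w = 1. *)
move=> u [d Dd pu].
have [w _ wE] := epsi.2 (u * d^-1) I.
have Md : M d by exists d.
have Mud : M (u * d^-1) by have [[_ MM MV] _] := nM; apply: MM; [exists d|exact: MV].
have [_ dM _] := idelta; have := dM _ _ Mud Md; rewrite mulgKV /=.
rewrite -wE psi0 ?(chiD _ (sD _ Dd)) ?(chiD _ Dd) ?add0r; last first.
  by rewrite -psiE wE epi.1.1.2 (homV epi.1.1) pu mulgV.
by move=> /eqP; rewrite addr_eq0 => /eqP.
Qed.

End RelativeCoordinates.

Section EpiImage.
Variable p : nat.
Hypotheses (p_prime : prime p) (p_gt2 : (2 < p)%N).
Local Open Scope group_scope.
Variables (n : nat) (F : freeSigmaProP p n) (D : set F).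

(** This is [image_of] for a single free group instead of the family; the two agree by
    conversion. *)
Definition epi_image (X : sigmaProPType p) : set X :=
  [set g | exists2 pi : F -> X, is_sigma_epi pi & (pi @` D) g].

Hypothesis D_Aut : forall alpha, sigma_Aut F alpha -> alpha @` D = D.

Lemma epi_imageE (X : sigmaProPType p) (pi : F -> X) :
  dimH1 X n -> is_sigma_epi pi -> @epi_image X = pi @` D.
Proof.
move=> dX epi; apply/seteqP; split=> g; last by exists pi.
move=> [pi' epi' [d Dd <-]].
have [a Aa aE] := free_epi_conj p_prime p_gt2 dX epi epi'.
by exists (a d); rewrite ?aE // -(D_Aut Aa); exists d.
Qed.

End EpiImage.

Arguments epi_image {p n F} D X _.

(** * Adapted bases of F_(n+l) and the criterion on the relators *)

Section AdaptedBasis.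
Variable p : nat.
Hypotheses (p_prime : prime p) (p_gt2 : (2 < p)%N).
Local Open Scope group_scope.

Variables (n l : nat) (F : freeSigmaProP p n) (E : freeSigmaProP p (n + l)).
Lemma adapted_section : exists iota : F -> E,
  is_sigma_hom iota /\ forall i, iota (free_gen F i) = free_gen E (lshift l i).
Proof. by apply: free_sigma_hom_exists => i; exact: free_gen_minus. Qed.

Lemma adapted_retraction : exists psi : E -> F, [/\ is_sigma_hom psi,
  forall i, psi (free_gen E (lshift l i)) = free_gen F i &
  forall j, psi (free_gen E (rshift n j)) = 1].
Proof.
pose y (i : 'I_(n + l)) := match fintype.split i with
  | inl a => free_gen F a | inr _ => 1 end.
have [i|psi [hpsi psiE]] := @free_sigma_hom_exists _ _ E F y.
  rewrite /y; case: fintype.split => a; first exact: free_gen_minus.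
  by rewrite /minus_part /= sigma1 invg1.
exists psi; split=> // i; rewrite psiE /y.
  by rewrite -[lshift l i]/(unsplit (inl i)) unsplitK.
by rewrite -[rshift n i]/(unsplit (inr i)) unsplitK.
Qed.

(** The function e records the exponents mod p of the l additional generators. *)
Lemma adapted_exponents : exists e : E -> 'rV['F_p]_l, [/\ invariant_hom setT e,
  forall i, e (free_gen E (lshift l i)) = 0%R,
  forall j, e (free_gen E (rshift n j)) = delta_mx 0%R j &
  forall chi, H1 E chi -> (forall i, chi (free_gen E (lshift l i)) = 0%R) ->
    exists c : 'cV['F_p]_l, forall x, chi x = (e x *m c) 0%R 0%R].
Proof.
have [B [iB Bchi Bu] Bg] := free_frame p_prime E.
have [lc BM BJ] := iB.
exists (rsubmx \o B); split.
- split; first exact: locally_constant_comp.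
    by move=> x y _ _; rewrite /= BM // linearD.
  by move=> x y _; rewrite /= BJ.
- move=> i; rewrite /= Bg; apply/rowP => j; rewrite !mxE /=.
  by rewrite eq_rlshift.
- move=> j; rewrite /= Bg; apply/rowP => k; rewrite !mxE /=.
  by rewrite (inj_eq (@rshift_inj _ _)).
move=> chi Hchi chi0; have [u uE] := Bchi _ Hchi; exists (dsubmx u) => x.
have u0 : usubmx u = 0%R.
  apply/colP => i; rewrite mxE [RHS]mxE.
  by have := chi0 i; rewrite uE Bg -rowE mxE.
rewrite uE -[in LHS](hsubmxK (B x)) -[in LHS](vsubmxK u) mul_row_col u0 mulmx0.
by rewrite add0r.
Qed.

End AdaptedBasis.

Section Criterion.
Variable p : nat.
Hypotheses (p_prime : prime p) (p_gt2 : (2 < p)%N).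
Local Open Scope group_scope.

Variables (n l m : nat) (F : freeSigmaProP p n) (E : freeSigmaProP p (n + l)).
Variables (Q : sigmaProPType p) (phi0 : F -> Q) (phi : E -> Q).
Hypotheses (ephi0 : is_sigma_epi phi0) (ephi : is_sigma_epi phi).
Hypothesis phil : forall i, phi (free_gen E (lshift l i)) = phi0 (free_gen F i).
Hypothesis phir : forall j, phi (free_gen E (rshift n j)) = 1.
Variables (iota : F -> E) (psi : E -> F) (e : E -> 'rV['F_p]_l).
Hypotheses (hiota : is_sigma_hom iota) (hpsi : is_sigma_hom psi).
Hypothesis iotaE : forall i, iota (free_gen F i) = free_gen E (lshift l i).
Hypothesis psil : forall i, psi (free_gen E (lshift l i)) = free_gen F i.
Hypothesis psir : forall j, psi (free_gen E (rshift n j)) = 1.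
Hypothesis ie : invariant_hom setT e.
Hypothesis el : forall i, e (free_gen E (lshift l i)) = 0%R.
Hypothesis er : forall j, e (free_gen E (rshift n j)) = delta_mx 0%R j.
Hypothesis eH1 : forall chi, H1 E chi ->
  (forall i, chi (free_gen E (lshift l i)) = 0%R) ->
  exists c : 'cV['F_p]_l, forall x, chi x = (e x *m c) 0%R 0%R.
Variables (D : set F) (chi : F -> 'rV['F_p]_m).
Local Notation M := (phi0 @^-1` [set 1]).
Local Notation L := (phi @^-1` [set 1]).
Hypotheses (cD : closed_sigma_normal D) (DM : D `<=` M).
Hypothesis rchi : relative_coordinates D M chi.
Hypothesis MH1 : forall psi, H1 F psi -> forall u, M u -> psi u = 0%R.

Lemma retraction_sectionK x : psi (iota x) = x.
Proof.
suff h : psi \o iota = id by exact: (congr1 (fun k => k x) h).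
apply: free_hom_eq; [exact: is_hom_comp hiota.1 hpsi.1|exact: (id_hom F).1|move=> i /=].
by rewrite iotaE psil.
Qed.

Lemma phi_psi x : phi x = phi0 (psi x).
Proof.
suff h : phi = phi0 \o psi by exact: (congr1 (fun k => k x) h).
apply: free_hom_eq; [exact: ephi.1.1|exact: is_hom_comp hpsi.1 ephi0.1.1|move=> i /=].
by case: (split_ordP i) => j ->; rewrite ?phil ?psil // phir psir (hom1 ephi0.1.1).
Qed.

Lemma phi_iota u : phi (iota u) = phi0 u.
Proof. by rewrite phi_psi retraction_sectionK. Qed.

Lemma e_iota u : e (iota u) = 0%R.
Proof.
apply/rowP => j; rewrite [RHS]mxE; move: u.
apply: (@free_H1_0 p p_prime n F (fun u => e (iota u) 0%R j)).
  apply: (@H1_comp p _ _ iota (fun x => e x 0%R j)); first exact: hiota.1.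
  exact/H1_invariant_hom/invariant_hom_coord.
by move=> i; rewrite iotaE el mxE.
Qed.

(** With K the normal closure of the additional generators, the set K iota(F) is closed by
    compactness and a subgroup by normality of K, and it contains all generators of E. *)
Lemma adapted_decomposition x : exists k u,
  normally_generated (range (fun j => free_gen E (rshift n j))) k /\ x = k * iota u.
Proof.
set K := normally_generated _.
have nK : is_normal K := normally_generated_normal _.
have [[K1 KM KV] KJ] := nK.
pose A := [set x | exists k u, K k /\ x = k * iota u].
have cA : closed A.
  have -> : A = (fun xy : E * E => xy.1 * xy.2) @` (K `*` range iota).
    apply/seteqP; split=> y.
      by move=> [k [u [Kk ->]]]; exists (k, iota u) => //; split=> //; exists u.
    by move=> [[k _] [/= Kk [u _ <-]] <-]; exists k, u.
  apply: compact_closed; first exact: (@proP_hausdorff p E).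
  apply: continuous_compact.
    by apply: continuous_subspaceT => y; exact: mulg_continuous.
  apply: compact_setX.
    exact: (subclosed_compact (@generated_closed p E _) (@proP_compact p E)).
  apply: (subclosed_compact _ (@proP_compact p E)) => //.
  exact: (hom_image_closed hiota.1 closedT).
have sA : is_subgroup A.
  split.
  - by exists 1, 1; split=> //; rewrite mul1g (hom1 hiota.1).
  - move=> _ _ [k [u [Kk ->]]] [k' [u' [Kk' ->]]].
    exists (k * (k' ^ (iota u)^-1)), (u * u'); split; first by apply: KM => //; exact: KJ.
    by rewrite hiota.1.2 /conjg invgK !mulgA mulgKV.
  - move=> _ [k [u [Kk ->]]]; exists (k^-1 ^ iota u), u^-1; split.
      by apply: KJ; exact: KV.
    by rewrite (homV hiota.1) invgM /conjg !mulgA mulgK.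
suff : A x by [].
rewrite (free_generated p_prime cA sA) // => i.
case: (split_ordP i) => j ->.
  by exists 1, (free_gen F j); split=> //; rewrite mul1g iotaE.
exists (free_gen E (rshift n j)), 1; split; last by rewrite (hom1 hiota.1) mulg1.
by apply: sub_normally_generated; exists j.
Qed.

(** The coordinates on V: those of M / D M^p[M, F] through the retraction psi, and the exponents of
    the additional generators. *)
Definition big_coordinates (x : E) : 'rV['F_p]_(m + l) := row_mx (chi (psi x)) (e x).

Lemma L_normal : is_normal L. Proof. exact: normal_kernel ephi.1.1. Qed.
Lemma L_closed : closed L. Proof. exact: closed_kernel ephi.1.1. Qed.

Lemma big_coordinates_hom : invariant_hom L big_coordinates.
Proof.
have [ichi _ _ _] := rchi; have [lc cM cJ] := invariant_hom_preimage ichi hpsi.1.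
have [lce eM eJ] := ie.
have LM x : L x -> (psi @^-1` M) x by rewrite /preimage /= phi_psi.
split.
- exact: (locally_constant_comp2 (fun a b => row_mx a b) lc lce).
- move=> x y /LM Lx /LM Ly; rewrite /big_coordinates eM //.
  by have := cM _ _ Lx Ly => /= ->; rewrite add_row_mx.
- move=> x g /LM Lx; rewrite /big_coordinates eJ //.
  by have := cJ _ g Lx => /= ->.
Qed.

(** The first m coordinates are filled by iota(M), the last l by the additional generators, which
    lie in L. *)
Lemma big_coordinates_surj v : exists2 x, L x & big_coordinates x = v.
Proof.
have [ichi chiD chis _] := rchi; have [_ eM _] := ie.
have [[L1 LM _] _] := L_normal; have [_ bM _] := big_coordinates_hom.
have chi1 : chi 1 = 0%R by apply: chiD; have [_ [[]]] := cD.
apply: (@additive_set_full p (m + l) [set v | exists2 x, L x & big_coordinates x = v]).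
- exists 1 => //; exact: (invariant_hom1 L_normal big_coordinates_hom).
- move=> _ _ [x Lx <-] [y Ly <-]; exists (x * y); first exact: LM.
  by rewrite bM.
move=> c; rewrite -[c]vsubmxK; move: (usubmx c) (dsubmx c) => a b c0.
apply/eqP; rewrite col_mx_eq0; apply/andP; split; apply/eqP/colP => i; rewrite [RHS]mxE.
  have [u Mu uE] := chis (delta_mx 0%R i).
  have := c0 (big_coordinates (iota u)); rewrite /big_coordinates.
  rewrite retraction_sectionK e_iota uE mul_row_col mul0mx addr0 -rowE mxE; apply.
  exists (iota u); last by rewrite retraction_sectionK e_iota uE.
  by rewrite /= phi_iota.
have := c0 (big_coordinates (free_gen E (rshift n i))); rewrite /big_coordinates.
rewrite psir er chi1 mul_row_col mul0mx add0r -rowE mxE; apply.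
by exists (free_gen E (rshift n i)); rewrite /= ?phir // psir er chi1.
Qed.

Section Relators.
Variables (J : Type) (r : J -> E) (H : sigmaProPType p) (q : E -> H).
Hypothesis eq_q : is_sigma_epi q.
Hypothesis qr : forall x, q x = 1 <-> normally_generated (range r) x.
Hypothesis D_Aut : forall alpha, sigma_Aut F alpha -> alpha @` D = D.

Local Notation epi_imageE0 := (epi_imageE p_prime p_gt2 D_Aut).

Lemma relators_in_kernel w : (forall i, phi (r i) = 1) -> q w = 1 -> L w.
Proof.
move=> Lr /qr; apply: normally_generated_sub; [exact: L_closed|exact: L_normal|].
by move=> _ [i _ <-]; exact: Lr.
Qed.

(** The additional generators lie in L, so q sends them into the image of D, which characters do not
    see; hence q o iota is onto and the image of D in H is q(iota(D)). Therefore L is the product of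
    iota(D) and the relation subgroup, and a form vanishing on the relators vanishes on L. *)
Lemma criterion_forward :
  dimH1 H n -> (forall w, phi w = 1 <-> epi_image D H (q w)) ->
  (forall i, phi (r i) = 1) /\
  forall c : 'cV_(m + l), (forall i, (big_coordinates (r i) *m c) 0%R 0%R = 0%R) -> c = 0%R.
Proof.
move=> dH kphi.
have q_r i : q (r i) = 1 by apply/qr; apply: sub_normally_generated; exists i.
have [pi1 epi1] := exists_epi p_prime F eq_q dH.
have Lr i : phi (r i) = 1.
  apply/kphi; rewrite q_r (epi_imageE0 dH epi1); exists 1; last exact: hom1 epi1.1.1.
  by have [_ [[]]] := cD.
split=> // c c0.
have epi : is_sigma_epi (q \o iota).
  split; first exact: comp_hom hiota eq_q.1.
  apply: (hom_surj_H1 p_prime (is_hom_comp hiota.1 eq_q.1.1)) => psi' Hpsi' psi0 y.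
  have [x _ <-] := eq_q.2 y I; move: x.
  apply: (free_H1_0 p_prime (H1_comp eq_q.1.1 Hpsi')) => i /=.
  case: (split_ordP i) => j ->; first by rewrite -iotaE; exact: psi0.
  have /kphi := phir j; rewrite (epi_imageE0 dH epi1) => -[d Dd <-].
  by apply: (MH1 (H1_comp epi1.1.1 Hpsi')); exact: DM.
have lin := linear_form_invariant_hom c big_coordinates_hom.
have L0 x : L x -> (big_coordinates x *m c) 0%R 0%R = 0%R.
  move=> /kphi; rewrite (epi_imageE0 dH epi) => -[d Dd /= qd].
  have Nx : normally_generated (range r) ((iota d)^-1 * x).
    by apply/qr; rewrite eq_q.1.1.2 (homV eq_q.1.1) qd mulVg.
  have Lid : L (iota d) by rewrite /= phi_iota; exact: DM.
  have LN y : normally_generated (range r) y -> L y.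
    by move=> /qr; exact: relators_in_kernel.
  rewrite -[x](mulKVg (iota d)); have [_ linM _] := lin.
  rewrite linM //; last exact: LN.
  rewrite (invariant_hom_normally_generated L_normal lin L_closed _ _ Nx) ?addr0.
  - rewrite /big_coordinates retraction_sectionK e_iota.
    by have [_ -> // _ _] := rchi; rewrite row_mx0 mul0mx mxE.
  - by move=> _ [i _ <-]; exact: Lr.
  - by move=> _ [i _ <-]; exact: c0.
apply/colP => i; rewrite [RHS]mxE.
have [x Lx xE] := big_coordinates_surj (delta_mx 0%R i).
by have := L0 x Lx; rewrite xE -rowE mxE.
Qed.

(** The Frattini argument is transferred to F: H is a quotient of F by pi = q o iota, and q = pi o
    theta for a retraction theta of iota. If ker pi fills the coordinates chi, then M = (ker pi)
    D. *)
Lemma criterion_backward :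
  (forall i, phi (r i) = 1) ->
  (forall c : 'cV_(m + l), (forall i, (big_coordinates (r i) *m c) 0%R 0%R = 0%R) -> c = 0%R) ->
  dimH1 H n /\ (forall w, phi w = 1 <-> epi_image D H (q w)).
Proof.
move=> Lr span.
have q_r i : q (r i) = 1 by apply/qr; apply: sub_normally_generated; exists i.
pose pi := q \o iota.
have epi : is_sigma_epi pi.
  split; first exact: comp_hom hiota eq_q.1.
  apply: (hom_surj_H1 p_prime (is_hom_comp hiota.1 eq_q.1.1)) => psi' Hpsi' psi0 y.
  have [x _ <-] := eq_q.2 y I.
  (* A character of H killing the image of pi is, on E, a form in the exponents e. It vanishes on
     the relators, so the spanning hypothesis makes it zero. *)
  have [c cE] := eH1 (H1_comp eq_q.1.1 Hpsi') (fun i => etrans (congr1 _ (congr1 q (esym (iotaE i)))) (psi0 (free_gen F i))).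
  have : col_mx (0 : 'cV['F_p]_m) c = 0%R.
    apply: span => i; rewrite mul_row_col mulmx0 add0r -cE /= q_r.
    have ipsi := (H1_invariant_hom psi').1 Hpsi'.
    exact: (invariant_hom1 (normal_setT H) ipsi).
  move=> /eqP; rewrite col_mx_eq0 => /andP[_ /eqP c0].
  by have := cE x; rewrite c0 mulmx0 mxE.
have N'M u : pi u = 1 -> M u.
  by move=> /(relators_in_kernel Lr); rewrite /= phi_iota.
have dH : dimH1 H n.
  apply/(dimH1_epi n epi.1.1 epi.2); last exact: dimH1_free.
  by move=> psi' Hpsi' u /N'M Mu; exact: (MH1 Hpsi').
split=> // w; rewrite (epi_imageE0 dH epi).
have [ichi chiD _ chiF] := rchi.
have nM : is_normal M := normal_kernel ephi0.1.1.
split; last first.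
  move=> [d Dd /= qd]; have Lx : L ((iota d)^-1 * w).
    by apply: relators_in_kernel => //; rewrite eq_q.1.1.2 (homV eq_q.1.1) -[q (iota d)]/(pi d) qd mulVg.
  have [[_ LM _] _] := L_normal; rewrite -[w](mulKVg (iota d)); apply: LM Lx.
  by rewrite /= phi_iota; exact: DM.
move=> Lw.
have /choice[y yE] : forall j, exists u, pi u = q (free_gen E (rshift n j)).
  by move=> j; have [u _ <-] := epi.2 (q (free_gen E (rshift n j))) I; exists u.
have My j : M (y j).
  rewrite /= -phi_iota; have : L ((iota (y j))^-1 * free_gen E (rshift n j)).
    by apply: relators_in_kernel => //; rewrite eq_q.1.1.2 (homV eq_q.1.1) -[q (iota _)]/(pi _) yE mulVg.
  by rewrite /= ephi.1.1.2 phir mulg1 (homV ephi.1.1) => /(congr1 (fun z => z^-1)); rewrite invgK invg1.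
pose z (i : 'I_(n + l)) := match fintype.split i with inl a => free_gen F a | inr b => y b end.
(* The additional generators go to preimages y j under pi of their images in H, so theta is a
   homomorphism of pro-p-groups only, without sigma. *)
have [theta [[htheta thetaE] _]] := free_univ E z.
have thetal i : theta (free_gen E (lshift l i)) = free_gen F i.
  by rewrite thetaE /z -[lshift l i]/(unsplit (inl i)) unsplitK.
have thetar j : theta (free_gen E (rshift n j)) = y j.
  by rewrite thetaE /z -[rshift n j]/(unsplit (inr j)) unsplitK.
have pi_theta x : pi (theta x) = q x.
  suff h : pi \o theta = q by exact: (congr1 (fun k => k x) h).
  apply: free_hom_eq; [exact: is_hom_comp htheta epi.1.1|exact: eq_q.1.1|move=> i /=].
  by case: (split_ordP i) => j ->; rewrite ?thetal ?thetar /pi /= ?iotaE //; exact: yE.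
have theta_iota u : theta (iota u) = u.
  suff h : theta \o iota = id by exact: (congr1 (fun k => k u) h).
  apply: free_hom_eq; [exact: is_hom_comp hiota.1 htheta|exact: (id_hom F).1|move=> i /=].
  by rewrite iotaE thetal.
have theta_phi x : phi0 (theta x) = phi x.
  suff h : phi0 \o theta = phi by exact: (congr1 (fun k => k x) h).
  apply: free_hom_eq; [exact: is_hom_comp htheta ephi0.1.1|exact: ephi.1.1|move=> i /=].
  by case: (split_ordP i) => j ->; rewrite ?thetal ?thetar ?phil ?phir //; exact: My.
pose Y := (\matrix_(j < l) chi (y j))%R.
have LE : theta @^-1` M = L by apply/seteqP; split=> x /=; rewrite theta_phi.
have LE' : psi @^-1` M = L by apply/seteqP; split=> x /=; rewrite phi_psi.
(* The maps theta and psi differ only on the additional generators, where the j-th one contributes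
   row j of [Y]. By [adapted_decomposition] it suffices to compare on these and on iota(M). *)
have key x : L x -> chi (theta x) = (chi (psi x) + e x *m Y)%R.
  have i1 : invariant_hom L (chi \o theta) by have h := invariant_hom_preimage ichi htheta; rewrite -LE.
  have i2 : invariant_hom L (chi \o psi) by have h := invariant_hom_preimage ichi hpsi.1; rewrite -LE'.
  have i3 : invariant_hom L (fun x => e x *m Y).
    have [lc eM eJ] := ie; split.
    - exact: (locally_constant_comp (fun v : 'rV['F_p]_l => v *m Y) lc).
    - by move=> a b _ _; rewrite eM // mulmxDl.
    - by move=> a b _; rewrite eJ.
  have i4 := invariant_homB i1 (invariant_homD i2 i3).
  have iota0 u : M u -> ((chi \o theta) (iota u) - ((chi \o psi) (iota u) + e (iota u) *m Y) = 0)%R.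
    by move=> Mu; rewrite /= theta_iota retraction_sectionK e_iota mul0mx addr0 subrr.
  have gen0 k : normally_generated (range (fun j => free_gen E (rshift n j))) k ->
      ((chi \o theta) k - ((chi \o psi) k + e k *m Y) = 0)%R.
    apply: (invariant_hom_normally_generated L_normal i4 L_closed).
      by move=> _ [j _ <-]; exact: phir.
    move=> _ [j _ <-]; rewrite /= thetar psir er (chiD 1); last by have [_ [[]]] := cD.
    by rewrite add0r -rowE rowK subrr.
  move=> Lx; have [k [u [Kk xE]]] := adapted_decomposition x.
  have Lk : L k.
    apply: (normally_generated_sub L_closed L_normal _ Kk).
    by move=> _ [j _ <-]; exact: phir.
  have Mu : M u.
    by move: Lx; rewrite xE /= ephi.1.1.2 Lk mul1g phi_iota.
  have Lu : L (iota u) by rewrite /= phi_iota.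
  have [_ i4M _] := i4; have := i4M _ _ Lk Lu.
  rewrite (gen0 _ Kk) (iota0 _ Mu) addr0 -xE => /eqP.
  by rewrite subr_eq0 => /eqP.
(* The relation subgroup contains an element with coordinates (v, 0); its vanishing e-part removes
   the correction term of [key]. *)
have full v : exists2 u, pi u = 1 & chi u = v.
  have [t Nt tE] : exists2 t, normally_generated (range r) t & big_coordinates t = row_mx v 0%R.
    apply: (@additive_set_full p _ [set b | exists2 t, normally_generated (range r) t & big_coordinates t = b]).
    - exists 1; first by have [[]] := normally_generated_normal (range r).
      exact: (invariant_hom1 L_normal big_coordinates_hom).
    - move=> _ _ [a Na <-] [b Nb <-]; exists (a * b).
        by have [[_ NM _] _] := normally_generated_normal (range r); exact: NM.
      have [_ -> //] := big_coordinates_hom.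
        by apply: relators_in_kernel => //; exact/qr.
      by apply: relators_in_kernel => //; exact/qr.
    move=> c c0; apply: span => i; apply: c0; exists (r i) => //.
    by apply: sub_normally_generated; exists i.
  exists (theta t); first by rewrite pi_theta; exact/qr.
  have Lt : L t by apply: relators_in_kernel => //; exact/qr.
  have /eq_row_mx[tv t0] := tE.
  by rewrite key // tv t0 mul0mx addr0.
have [u _ uE] := epi.2 (q w) I.
have Mu : M u.
  rewrite /= -phi_iota; have : L ((iota u)^-1 * w).
    by apply: relators_in_kernel => //; rewrite eq_q.1.1.2 (homV eq_q.1.1) -[q (iota u)]/(pi u) uE mulVg.
  by rewrite /= ephi.1.1.2 Lw mulg1 (homV ephi.1.1) => /(congr1 (fun z => z^-1)); rewrite invgK invg1.
have [||||b [d [pb Dd ubd]]] := chiF (pi @^-1` [set 1]) _ _ _ _ u Mu.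
- exact: closed_kernel epi.1.1.
- exact: normal_kernel epi.1.1.
- exact: N'M.
- exact: full.
by exists d => //; rewrite -uE ubd epi.1.1.2 pb mul1g.
Qed.

End Relators.

End Criterion.

Section AdaptedBasisExists.
Variable p : nat.
Hypotheses (p_prime : prime p) (p_gt2 : (2 < p)%N).
Local Open Scope group_scope.

(** On u sigma(u)^-1, an element of the minus part, B takes the value 2 B u, and (p + 1)/2 is the
    inverse of 2 mod p. *)
Lemma half_minusX (X : sigmaProPType p) (V : lmodType 'F_p) (B : X -> V) (A : set X) u :
  is_normal A -> sigma_stable A -> invariant_hom A B ->
  (forall x, A x -> B (sigma x) = (- B x)%R) ->
  A u -> exists a, [/\ minus_part X a, A a & B a = B u].
Proof.
move=> nA sA iB Bs Au; have [[A1 AM AV] AJ] := nA; have [_ BM _] := iB.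
have Aw : A (u * (sigma u)^-1) by apply: AM => //; apply: AV; exact: sA.
exists ((u * (sigma u)^-1) ^+ (p.+1)./2); split.
- by apply: minusX; exact: minus_mul_sigmaV.
- exact: subgroupX nA.1 Aw.
rewrite (invariant_homX nA iB) // BM //; last by apply: AV; exact: sA.
rewrite (invariant_homV nA iB) ?Bs ?opprK //; last exact: sA.
rewrite -mulr2n -mulrnA mul2n even_halfK; last first.
  by case: (even_prime p_prime) p_gt2 => [->|/= ->].
by rewrite mulrS -[B u]scale1r scalerMnl Fp_mulrn // scale0r addr0.
Qed.

Variables (n l : nat) (F : freeSigmaProP p n) (E : freeSigmaProP p (n + l)).
Variables (Q : sigmaProPType p) (phi0 : F -> Q) (phi : E -> Q).
Hypotheses (ephi0 : is_sigma_epi phi0) (ephi : is_sigma_epi phi).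
Hypothesis dQ : dimH1 Q n.

(** The first n elements lift the phi0 (x_i) to E^-. The others are elements of ker phi in E^- whose
    coordinates form a basis of the left kernel of N, the matrix of the map that phi induces on
    Frattini quotients. *)
Lemma exists_adapted_basis : exists y : 'I_(n + l) -> E,
  [/\ forall i, minus_part E (y i),
      forall chi, H1 E chi -> (forall i, chi (y i) = 0%R) -> forall x, chi x = 0%R,
      forall i, phi (y (lshift l i)) = phi0 (free_gen F i) &
      forall j, phi (y (rshift n j)) = 1].
Proof.
have [B fB] := dimH1_frame (dimH1_free p_prime E); have [iB Bchi Bu] := fB.
have [BQ fBQ] := dimH1_frame dQ; have [iBQ BQchi BQu] := fBQ.
have [N NE] := frame_coordinates ephi.1.1 fBQ fB.
have Bs x : B (sigma x) = (- B x)%R.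
  apply/rowP => j; rewrite mxE; move: x.
  apply: (free_H1_sigma p_prime (chi := fun x => B x 0%R j)).
  exact/H1_invariant_hom/invariant_hom_coord.
(* Forms that vanish on ker phi come from Q. By duality, the coordinates of ker phi fill the whole
   left kernel of N. *)
have kerB (c : 'cV['F_p]_(n + l)) :
    (forall x, phi x = 1 -> (B x *m c) 0%R 0%R = 0%R) -> exists c' : 'cV['F_p]_n, c = N *m c'.
  move=> h; have HB : H1 E (fun x => (B x *m c) 0%R 0%R).
    exact/H1_invariant_hom/linear_form_invariant_hom.
  have [psi Hpsi psiE] := factor_H1 ephi.1.1 ephi.2 HB h.
  have [c' c'E] := BQchi _ Hpsi; exists c'.
  apply/eqP; rewrite -subr_eq0; apply/eqP; apply: Bu => x.
  rewrite mulmxBr mxE -psiE c'E NE mulmxA.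
  by rewrite [X in (_ + X)%R]mxE addrN.
have /choice[a aP] : forall i : 'I_n, exists x, minus_part E x /\ phi x = phi0 (free_gen F i).
  move=> i; have m0 : minus_part Q (phi0 (free_gen F i)).
    by rewrite /minus_part /= -ephi0.1.2 free_gen_sigma (homV ephi0.1.1).
  by have [x ? ?] := minus_lift p_prime p_gt2 ephi m0; exists x.
pose A := (\matrix_i B (a i))%R.
have uAN : A *m N \in unitmx.
  apply: col_inj_unitmx => c Ac; apply: BQu => y; have [u _ <-] := ephi0.2 y I; move: u.
  have HB : H1 Q (fun y => (BQ y *m c) 0%R 0%R).
    exact/H1_invariant_hom/linear_form_invariant_hom.
  apply: (free_H1_0 p_prime (H1_comp ephi0.1.1 HB)) => i /=.
  have [_ <-] := aP i; rewrite NE -[B _](rowK (fun i => B (a i))) -/A.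
  by rewrite -row_mul -row_mul Ac row0 mxE.
have rN : \rank (kermx N) = l.
  have rN : \rank N = n.
    apply/eqP; apply: (col_inj_row_full (M := N)) => c Nc.
    by rewrite -(mulKmx uAN c) -mulmxA Nc !mulmx0.
  by rewrite mxrank_ker rN addKn.
have : exists K : 'M['F_p]_(\rank (kermx N), n + l), row_free K /\ K *m N = 0%R.
  exists (row_base (kermx N)); split; first exact: row_base_free.
  by apply/sub_kermxP; rewrite eq_row_base.
rewrite rN => -[K [fK KN]].
have /choice[b bP] : forall j : 'I_l, exists x,
    [/\ minus_part E x, phi x = 1 & B x = row j K].
  move=> j.
  have nL : is_normal (phi @^-1` [set 1]) := normal_kernel ephi.1.1.
  have iL := invariant_hom_sub iB (@subsetT _ (phi @^-1` [set 1])).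
  have [[L1 LM _] _] := nL; have [_ BM _] := iL.
  have : [set v | exists2 x, phi x = 1 & B x = v] (row j K).
    apply: additive_set_dual.
    - by exists 1; [exact: L1|exact: (invariant_hom1 nL iL)].
    - move=> _ _ [x Lx <-] [y Ly <-]; exists (x * y); first exact: LM.
      by rewrite BM.
    move=> c h; have [|c' ->] := kerB c; first by move=> x Lx; apply: h; exists x.
    by rewrite mulmxA -row_mul KN row0 mul0mx.
  move=> [u Lu Bu']; rewrite -Bu'.
  have [||x [mx Lx xE]] := half_minusX nL _ iL _ Lu; last by exists x.
    by move=> x /= Lx; rewrite ephi.1.2 Lx sigma1.
  by move=> x _; exact: Bs.
pose y (i : 'I_(n + l)) := match fintype.split i with inl i => a i | inr j => b j end.
have yl i : y (lshift l i) = a i by rewrite /y -[lshift l i]/(unsplit (inl i)) unsplitK.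
have yr j : y (rshift n j) = b j by rewrite /y -[rshift n j]/(unsplit (inr j)) unsplitK.
exists y; split.
- by move=> i; case: (split_ordP i) => j ->; rewrite ?yl ?yr; [have [] := aP j|have [] := bP j].
- move=> chi /Bchi[c cE] y0 x; rewrite cE.
  have /eqP : col_mx A K *m c = 0%R.
    apply/row_matrixP => i; rewrite row_mul row0; apply/rowP => k; rewrite ord1 [RHS]mxE.
    rewrite -(y0 i) cE; congr ((_ *m _) _ _).
    case: (split_ordP i) => j ->; rewrite ?rowKu ?rowKd ?yl ?yr ?rowK //.
    by have [_ _ ->] := bP j.
  (* Multiplying a relation between the rows by N kills the rows of [K] and leaves the invertible
     matrix A N; the rows of [K] alone are independent. *)
  have uAK : col_mx A K \in unitmx.
    rewrite -row_free_unit; apply: inj_row_free => v.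
    rewrite -[v]hsubmxK mul_row_col => e.
    have vl : lsubmx v = 0%R.
      have /(congr1 (fun M => M *m N)) := e.
      rewrite mulmxDl -!mulmxA KN mulmx0 addr0 mul0mx => h.
      by rewrite -(mulmxK uAN (lsubmx v)) h mul0mx.
    move: e; rewrite vl mul0mx add0r => /eqP; rewrite mulmx_free_eq0 // => /eqP ->.
    by rewrite row_mx0.
  by move=> /eqP e; rewrite -(mulKmx uAK c) e !mulmx0 mxE.
- by move=> i; rewrite yl; have [] := aP i.
- by move=> j; rewrite yr; have [] := bP j.
Qed.

End AdaptedBasisExists.

(** * Dependence on the Zassenhaus quotients *)

Section Stability.
Variable p : nat.
Hypotheses (p_prime : prime p) (p_gt2 : (2 < p)%N).
Local Open Scope group_scope.

(** The kernel of a nonzero character is maximal: for b outside it, each y is an element of the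
    kernel times b^k, with k = chi y / chi b. *)
Lemma H1_frattini (X : proPType p) chi : H1 X chi ->
  forall x, frattini X x -> chi x = 0%R.
Proof.
move=> Hchi x frx; apply: contrapT => cx.
have ichi := (H1_invariant_hom chi).1 Hchi; have nT := normal_setT X.
have [_ cM _] := ichi.
pose A := [set x | setT x /\ chi x = 0%R].
have [sA _] : is_normal A := normal_invariant_kernel nT ichi.
suff mA : maximal_subgroup A by have [] := frx A mA.
split=> //.
- by apply: closed_invariant_kernel => //; exact: closedT.
- by apply/eqP => AT; apply: cx; have [] : A x by rewrite AT.
move=> B cB sB AB; have [BA|/existsNP[b /not_implyP[Bb nAb]]] := pselect (B `<=` A).
  by left; apply/seteqP; split.
right; apply/seteqP; split=> // y _.
have cb : chi b != 0%R by apply/eqP => cb; apply: nAb.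
pose k := (chi y / chi b)%R : nat.
have [_ BM _] := sB; rewrite -[y](mulgKV (b ^+ k)); apply: BM; last exact: subgroupX.
apply: AB; split=> //; rewrite cM // (invariant_homV nT ichi) //.
rewrite (invariant_homX nT ichi) // /k -mulr_natr natr_Zp mulrC divfK //.
by rewrite addrN.
Qed.

Lemma comp_sigma_epi (X Y Z : sigmaProPType p) (f : X -> Y) (g : Y -> Z) :
  is_sigma_epi f -> is_sigma_epi g -> is_sigma_epi (g \o f).
Proof.
move=> [hf fs] [hg gs]; split; first exact: comp_hom.
move=> z _; have [y _ <-] := gs z I; have [x _ <-] := fs y I; by exists x.
Qed.

Lemma iso_epi (X Y : sigmaProPType p) (f : X -> Y) :
  is_sigma_iso f -> is_sigma_epi f /\ forall x, f x = 1 -> x = 1.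
Proof.
move=> [hf [g [hg fg gf]]]; split; first by split=> // y _; exists (g y).
by move=> x fx; rewrite -(fg x) fx (hom1 hg.1).
Qed.

Variables (n : nat) (F : freeSigmaProP p n) (D : set F).
Hypothesis cD : closed_sigma_normal D.
Hypothesis D_frattini : D `<=` frattini F.
Hypothesis D_Aut : forall alpha, sigma_Aut F alpha -> alpha @` D = D.

Lemma quo_epi_image (H : sigmaProPType p) (pi : F -> H) :
  dimH1 H n -> is_sigma_epi pi ->
  is_sigma_epi (quo_pi (epi_image D H) \o pi) /\
  forall u, quo_pi (epi_image D H) (pi u) = 1 <-> exists2 d, D d & pi u = pi d.
Proof.
move=> dH epi; have imE := epi_imageE p_prime p_gt2 D_Aut dH epi.
split; first exact: comp_sigma_epi epi (quo_pi_epi _).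
move=> u; rewrite (quo_pi_eq1 (pi u)); last first.
  by rewrite imE; exact: epi_image_csn epi cD.
by rewrite imE; split=> -[d Dd e]; exists d.
Qed.

(** Characters kill D as a part of the Frattini subgroup, and they kill ker pi because F and H have
    the same number of generators. *)
Lemma H1_relative_kernel (H : sigmaProPType p) (pi : F -> H) chi :
  dimH1 H n -> is_sigma_epi pi -> H1 F chi ->
  forall u, (exists2 d, D d & pi u = pi d) -> chi u = 0%R.
Proof.
move=> dH epi Hchi u [d Dd pu].
have ichi := (H1_invariant_hom chi).1 Hchi; have [_ cM _] := ichi.
rewrite -[u](mulgKV d) cM // (H1_frattini Hchi (D_frattini Dd)) addr0.
apply: (dimH1_eq_kernel epi.1.1 epi.2 (dimH1_free p_prime F) dH Hchi).
by rewrite epi.1.1.2 (homV epi.1.1) pu mulgV.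
Qed.

Lemma dimH1_quo_epi_image (H : sigmaProPType p) (pi : F -> H) :
  dimH1 H n -> is_sigma_epi pi -> dimH1 (quo (epi_image D H)) n.
Proof.
move=> dH epi; have [eq kq] := quo_epi_image dH epi.
apply/(dimH1_epi n eq.1.1 eq.2); last exact: dimH1_free.
by move=> chi Hchi u /kq; exact: H1_relative_kernel.
Qed.

Variables (Q : sigmaProPType p) (phi0 : F -> Q).
Hypotheses (ephi0 : is_sigma_epi phi0) (dQ : dimH1 Q n).

(** Two epimorphisms from F to Q differ by an automorphism of F, which preserves D; composing pi
    with it turns (ker pi) D into ker phi0. *)
Lemma normalized_epi (H : sigmaProPType p) (pi : F -> H) :
  dimH1 H n -> is_sigma_epi pi -> sigma_isomorphic (quo (epi_image D H)) Q ->
  exists2 pi' : F -> H, is_sigma_epi pi' &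
    forall u, phi0 u = 1 <-> exists2 d, D d & pi' u = pi' d.
Proof.
move=> dH epi [h /iso_epi[eh h1]]; have [eq kq] := quo_epi_image dH epi.
have h1E x : h x = 1 <-> x = 1.
  by split=> [/h1//|->]; exact: hom1 eh.1.1.
have [a Aa aE] := free_epi_conj p_prime p_gt2 dQ (comp_sigma_epi eq eh) ephi0.
have [ea _] := iso_epi Aa.
exists (pi \o a); first exact: comp_sigma_epi.
move=> u; rewrite -aE /= h1E kq; split=> -[d Dd pu].
  by move: Dd; rewrite -{1}(D_Aut Aa) => -[d' Dd' ad']; exists d'; rewrite ?ad'.
by exists (a d) => //; rewrite -(D_Aut Aa); exists d.
Qed.

Lemma quo_epi_image_iso (H : sigmaProPType p) (pi : F -> H) :
  dimH1 H n -> is_sigma_epi pi ->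
  (forall u, phi0 u = 1 <-> exists2 d, D d & pi u = pi d) ->
  sigma_isomorphic (quo (epi_image D H)) Q.
Proof.
move=> dH epi kpi; have [eq kq] := quo_epi_image dH epi.
have [|h ih _] := sigma_epi_isomorphic eq ephi0; last by exists h.
by move=> u; rewrite /= kq kpi.
Qed.

Variables (m : nat) (chi : F -> 'rV['F_p]_m).
Hypothesis rchi : relative_coordinates D (phi0 @^-1` [set 1]) chi.
Hypothesis open_ker : open (phi0 @^-1` [set 1]).

(* D_i(F_n) lies in M^p[M, F_n]D for large i, so that the generators of M modulo
   D can be recognized modulo D_i(F_n). *)
Lemma quo_epi_image_stable : exists2 i, (2 <= i)%N &
  forall (H H' : sigmaProPType p) (pi : F -> H), is_sigma_epi pi -> dimH1 H n ->
    sigma_isomorphic (quo (epi_image D H)) Q ->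
    sigma_isomorphic (quo (zassenhaus H i)) (quo (zassenhaus H' i)) ->
    dimH1 H' n /\ sigma_isomorphic (quo (epi_image D H')) Q.
Proof.
have [ichi chiD chis chiF] := rchi.
set M := phi0 @^-1` [set 1] in ichi chis chiF *.
have nM : is_normal M := normal_kernel ephi0.1.1.
have [[M1 MM MV] MJ] := nM; have [_ cM _] := ichi.
(* With this i, factors from D_i(F) change neither membership in M nor, on M, the value of chi. *)
have [i i2 iW] : exists2 i, (2 <= i)%N & zassenhaus F i `<=` [set u | M u /\ chi u = 0%R].
  apply: (zassenhaus_nbhs p_prime); apply: open_nbhs_nbhs; split.
    have [lc _ _] := ichi.
    by apply: openI open_ker _; exact: (@locally_constant_open _ _ chi [set 0%R] lc).
  by split=> //; exact: (invariant_hom1 nM ichi).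
exists i => // H H' pi0 epi0 dH isoQ [f isof].
have [ef f1] := iso_epi isof.
have [pi epi kpi] := normalized_epi dH epi0 isoQ.
have eqH := @quo_pi_epi p H (zassenhaus H i).
have eqH' := @quo_pi_epi p H' (zassenhaus H' i).
have dH' : dimH1 H' n.
  have kD (X : sigmaProPType p) psi : H1 X psi -> forall x,
      quo_pi (zassenhaus X i) x = 1 -> psi x = 0%R.
    move=> Hpsi x /(quo_pi_eq1 _ (zassenhaus_csn X i)).
    exact: (H1_zassenhaus p_prime i2 Hpsi).
  apply/(dimH1_epi n eqH'.1.1 eqH'.2 (kD H')).
  have dq := (dimH1_epi n eqH.1.1 eqH.2 (kD H)).1 dH.
  by apply: dimH1_iso dq; exists f.
pose g := f \o (quo_pi (zassenhaus H i) \o pi).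
have eg : is_sigma_epi g by apply: comp_sigma_epi ef; exact: comp_sigma_epi.
have [pi' [hpi' pi'E]] := free_lift p_prime p_gt2 eqH' eg.1.
have dquo : dimH1 (quo (zassenhaus H' i)) n.
  apply/(dimH1_epi n eqH'.1.1 eqH'.2 _) => // psi Hpsi x.
  move=> /(quo_pi_eq1 _ (zassenhaus_csn H' i)).
  exact: (H1_zassenhaus p_prime i2 Hpsi).
have epi' : is_sigma_epi pi'.
  apply: (free_lift_epi p_prime eqH' hpi' _ dH' dquo) => y _.
  by have [x _ <-] := eg.2 y I; exists x => //=; rewrite pi'E.
split=> //; apply: (quo_epi_image_iso dH' epi').
(* Since rho maps D_i(F) onto D_i(X), an element sent into D_i(X) lies in ker rho up to a factor
   from D_i(F). *)
have lift_ker (X : sigmaProPType p) (rho : F -> X) u : is_sigma_epi rho ->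
    quo_pi (zassenhaus X i) (rho u) = 1 -> exists2 w, zassenhaus F i w & rho w = rho u.
  move=> erho /(quo_pi_eq1 _ (zassenhaus_csn X i)).
  by move=> /(zassenhaus_rec_epi erho.1.1 erho.2)[w Dw <-]; exists w.
have g1 u : g u = 1 <-> quo_pi (zassenhaus H i) (pi u) = 1.
  by split=> [/f1//|h]; rewrite /g /= h; exact: hom1 ef.1.1.
have DM d : D d -> M d by move=> Dd; apply/kpi; exists d.
have ker'M u : pi' u = 1 -> M u.
  move=> pu; have /g1 : g u = 1 by rewrite -pi'E pu (hom1 eqH'.1.1).
  move=> /(lift_ker _ _ _ epi)[w Dw ww].
  rewrite -[u](mulKVg w); apply: MM; first by have [] := iW w Dw.
  apply/kpi; exists 1; first by have [_ [[]]] := cD.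
  by rewrite epi.1.1.2 (homV epi.1.1) ww mulVg (hom1 epi.1.1).
(* An element of M is moved into ker pi by a factor from D, then into ker pi' by one from D_i(F);
   neither changes chi. *)
have full v : exists2 b, pi' b = 1 & chi b = v.
  have [u Mu <-] := chis v; have /kpi[d Dd pu] := Mu.
  have pud : pi (u * d^-1) = 1 by rewrite epi.1.1.2 (homV epi.1.1) pu mulgV.
  have : g (u * d^-1) = 1 by apply/g1; rewrite pud (hom1 eqH.1.1).
  rewrite -pi'E => /(lift_ker _ _ _ epi')[w Dw ww].
  have [Mw cw] := iW w Dw.
  exists (w^-1 * (u * d^-1)).
    by rewrite epi'.1.1.2 (homV epi'.1.1) ww mulVg.
  have Mud : M (u * d^-1) by apply: MM => //; apply: MV; exact: DM.
  rewrite cM //; last exact: MV.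
  rewrite (invariant_homV nM ichi) // cw oppr0 add0r cM //; last exact/MV/DM.
  by rewrite (invariant_homV nM ichi) ?(chiD d) ?oppr0 ?addr0 //; exact: DM.
move=> u; split.
  move=> Mu; have [||||b [d [pb Dd ->]]] := chiF (pi' @^-1` [set 1]) _ _ _ _ u Mu.
  - exact: closed_kernel epi'.1.1.
  - exact: normal_kernel epi'.1.1.
  - exact: ker'M.
  - exact: full.
  by exists d => //; rewrite epi'.1.1.2 pb mul1g.
move=> [d Dd pu]; rewrite -[u](mulgKV d); apply: MM; last exact: DM.
by apply: ker'M; rewrite epi'.1.1.2 (homV epi'.1.1) pu mulgV.
Qed.

End Stability.

(** * Counting and Haar measure *)

Section FiniteCardinality.

Lemma ncard_seq (T : choiceType) (A : set T) (s : seq T) :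
  uniq s -> (forall x, x \in s <-> A x) -> ncard A = size s.
Proof.
move=> us sA; have fA : finite_set A.
  apply: (@sub_finite_set _ _ [set` s]); last exact: finite_seq.
  by move=> x /sA.
apply: perm_size; apply: uniq_perm; [exact: fset_uniq|exact: us|move=> x].
by apply/idP/idP; rewrite in_fset_set // ?inE => /sA.
Qed.

Lemma finite_set_uniq_seq (T : choiceType) (A : set T) : finite_set A ->
  exists2 s : seq T, uniq s & forall x, x \in s <-> A x.
Proof.
move=> fA; exists (fset_set A); first exact: fset_uniq.
by move=> x; rewrite in_fset_set // inE.
Qed.

Lemma ncard_image (T U : choiceType) (f : T -> U) (A : set T) :
  finite_set A -> {in A &, injective f} -> ncard (f @` A) = ncard A.
Proof.
move=> /finite_set_uniq_seq[s us sA] fi; rewrite (ncard_seq us sA).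
rewrite (@ncard_seq _ _ (map f s)) ?size_map //.
  rewrite map_inj_in_uniq // => x y xs ys.
  by apply: fi; rewrite inE; apply/sA.
move=> y; split=> [/mapP[x xs ->]|[x Ax <-]]; first by exists x => //; apply/sA.
by apply: map_f; apply/sA.
Qed.

Lemma ncard_fin (T : finType) (A : set T) : ncard A = #|[pred x | `[< A x >]]|.
Proof.
rewrite (@ncard_seq _ _ (enum [pred x | `[< A x >]])) -?cardE ?enum_uniq //.
by move=> x; rewrite mem_enum; split=> [/asboolP//|Ax]; exact/asboolP.
Qed.

Lemma ncard_gt0 (T : choiceType) (A : set T) x : finite_set A -> A x -> (0 < ncard A)%N.
Proof.
move=> /finite_set_uniq_seq[s us sA]; rewrite (ncard_seq us sA) => /sA.
by case: s {us sA}.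
Qed.

Lemma ncard_fibers (T U : choiceType) (f : T -> U) (A : set T) c :
  finite_set A -> (forall x, A x -> ncard (A `&` f @^-1` [set f x]) = c) ->
  ncard A = (ncard (f @` A) * c)%N.
Proof.
move=> /finite_set_uniq_seq[s us sA] fc.
pose t := undup (map f s).
have tP y : y \in t <-> (f @` A) y.
  rewrite mem_undup; split=> [/mapP[x /sA Ax ->]|[x /sA xs <-]]; first by exists x.
  exact: map_f.
rewrite (ncard_seq us sA) (ncard_seq (undup_uniq _) tP).
have cE y : y \in t -> count (fun x => f x == y) s = c.
  move=> /tP[x Ax <-]; rewrite -(fc x Ax) -size_filter; apply/esym/ncard_seq.
    exact: filter_uniq.
  move=> z; rewrite mem_filter; split=> [/andP[/eqP fz /sA Az]//|[/sA zs /= ->]].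
  by rewrite eqxx.
rewrite -sum1_size (eq_big_seq (fun x => (\sum_(y <- t) (f x == y))%N)); last first.
  move=> x xs; rewrite -(big_mkcond _ (fun=> 1%N)) sum1_count.
  rewrite (eq_count (a2 := pred1 (f x))); last by move=> y; rewrite /= eq_sym.
  by rewrite count_uniq_mem ?undup_uniq //= mem_undup map_f.
rewrite exchange_big /= (eq_big_seq (fun=> c)); last first.
  by move=> y yt; rewrite -(cE y yt) -(big_mkcond _ (fun=> 1%N)) sum1_count.
by rewrite big_const_seq count_predT iter_addn_0 mulnC.
Qed.

End FiniteCardinality.

Section FullRank.
Variable p : nat.
Hypothesis p_prime : prime p.

(** Row by row: i independent rows span p^i vectors, which the next row has to avoid. *)
Lemma card_row_free d k :
  (#|[pred A : 'M['F_p]_(d, k) | row_free A]| = \prod_(i < d) (p ^ k - p ^ i))%N.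
Proof.
elim: d => [|d IH].
  rewrite big_ord0; apply: (@fintype.eq_card1 _ 0) => A; rewrite !inE [A]flatmx0 eqxx.
  by rewrite /row_free mxrank0.
rewrite big_ord_recr /= -IH.
pose f (Au : 'M['F_p]_(d, k) * 'rV['F_p]_k) : 'M['F_p]_(1 + d, k) := col_mx Au.2 Au.1.
have fK : cancel f (fun M => (dsubmx M, usubmx M)).
  by move=> [A u]; rewrite /f /= col_mxKd col_mxKu.
have Kf : cancel (fun M => (dsubmx M, usubmx M)) f by move=> M; exact: vsubmxK.
have fE A u : row_free (f (A, u)) = row_free A && ~~ (u <= A)%MS.
  rewrite /row_free /f /= -addsmxE; case: (boolP (u <= A)%MS) => uA.
    by rewrite andbF (addsmx_idPr uA) ltn_eqF // ltnS rank_leq_row.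
  rewrite andbT; have -> : \rank (u + A)%MS = (\rank A).+1; last by rewrite eqSS.
  apply/eqP; rewrite eqn_leq; apply/andP; split.
    apply: leq_trans (mxrank_adds_leqif u A).1 _.
    by rewrite -[leqRHS]add1n leq_add2r rank_leq_row.
  rewrite ltn_neqAle (mxrank_leqif_sup (addsmxSr u A)).2.
  rewrite (mxrank_leqif_sup (addsmxSr u A)).1 andbT.
  by apply: contra uA; apply: submx_trans; exact: addsmxSl.
rewrite -sum1_card (reindex f) /=; last by exists (fun M => (dsubmx M, usubmx M)) => x _.
rewrite -sum1_card big_distrl /=.
rewrite (eq_bigl (fun Au => row_free Au.1 && ~~ (Au.2 <= Au.1)%MS)); last first.
  by move=> [A u]; rewrite inE fE.
rewrite -(pair_big_dep (fun A => row_free A) (fun A u => ~~ (u <= A)%MS) (fun _ _ => 1%N)) /=.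
apply: eq_big => [A|A fA]; first by rewrite inE.
rewrite mul1n sum1_card -(card_rV p_prime k) -[X in (_ - X)%N](_ : #|rowg A| = _); last first.
  by rewrite card_rowg card_Fp // (eqP fA).
rewrite -(cardC (mem (rowg A))) addKn.
by apply: eq_card => u; rewrite !inE.
Qed.

End FullRank.

Section SpanningFamilies.
Variable p : nat.
Hypothesis p_prime : prime p.

Definition spanning k d : set {ffun 'I_k -> 'rV['F_p]_d} :=
  [set y | forall c : 'cV['F_p]_d, (forall i, (y i *m c) 0 0 = 0) -> c = 0].

Lemma spanning_row_free k d (y : {ffun 'I_k -> 'rV['F_p]_d}) :
  spanning y <-> row_free (\matrix_(a < d, i < k) y i 0 a).
Proof.
set A := \matrix_(a, i) _.
have AE (c : 'cV['F_p]_d) i : (y i *m c) 0 0 = (c^T *m A) 0 i.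
  by rewrite !mxE; apply: eq_bigr => j _; rewrite !mxE mulrC.
split=> [h|fA c c0].
  apply: inj_row_free => v vA; apply: trmx_inj; rewrite trmx0; apply: h => i.
  by rewrite AE trmxK vA mxE.
apply: trmx_inj; apply/eqP; rewrite trmx0 -(mulmx_free_eq0 _ fA).
by apply/eqP/rowP => i; rewrite -AE c0 mxE.
Qed.

Lemma ncard_spanning k d :
  (ncard (@spanning k d) = \prod_(i < d) (p ^ k - p ^ i))%N.
Proof.
rewrite -(card_row_free p_prime) ncard_fin.
pose f (y : {ffun 'I_k -> 'rV['F_p]_d}) := \matrix_(a < d, i < k) y i 0 a.
pose g (A : 'M['F_p]_(d, k)) := [ffun i => \row_a A a i].
have fK : cancel f g.
  by move=> y; apply/ffunP => i; rewrite ffunE; apply/rowP => a; rewrite !mxE.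
have gK : cancel g f by move=> A; apply/matrixP => a i; rewrite !mxE ffunE mxE.
rewrite -[RHS]sum1_card (reindex f) /=; last by exists g => x _.
rewrite -sum1_card; apply: eq_bigl => y; rewrite !inE.
by apply/asboolP/idP => /spanning_row_free.
Qed.

Variable R : realType.

Lemma C_part_gt0 k : 0 < C_part R p k.
Proof.
rewrite /C_part big_nat_cond; apply: prodr_gt0 => i; rewrite andbT => /andP[i1 _].
rewrite subr_gt0 exprn_ilt1 ?invr_ge0 ?ler0n //; first by rewrite -lt0n.
by rewrite invf_lt1 ?ltr0n ?prime_gt0 // ltr1n prime_gt1.
Qed.

Lemma C_partS k : C_part R p k.+1 = C_part R p k * (1 - (p%:R^-1) ^+ k.+1).
Proof. by rewrite /C_part big_nat_recr. Qed.

(** This is the probability that k uniform vectors span F_p^d, the product of 1 - p^-j over k - d <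
    j <= k. *)
Lemma ncard_spanning_C_part k d : (d <= k)%N ->
  (ncard (@spanning k d))%:R * ((p ^ d)%:R^-1) ^+ k =
    C_part R p k / C_part R p (k - d) :> R.
Proof.
have p0 : (p%:R : R) != 0 by rewrite pnatr_eq0 -lt0n prime_gt0.
have p0' : (p > 0)%N by exact: prime_gt0.
rewrite ncard_spanning natr_prod; elim: d => [|d IH] dk.
  by rewrite big_ord0 subn0 expn0 invr1 expr1n mulr1 divff // gt_eqF // C_part_gt0.
rewrite big_ord_recr /=.
have -> : ((p ^ d.+1)%:R^-1) ^+ k = ((p ^ d)%:R^-1) ^+ k * ((p%:R : R) ^- k).
  by rewrite expnS natrM invfM exprMn mulrC; congr (_ * _); exact: exprVn.
rewrite mulrACA IH ?(ltnW dk) //; have [j kE] : exists j, k = (d + j.+1)%N.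
  by exists (k - d.+1)%N; lia.
have -> : (k - d.+1)%N = j by lia.
have -> : (k - d)%N = j.+1 by lia.
have q0 : (1 - (p%:R : R)^-1 ^+ j.+1) != 0.
  have := C_part_gt0 j.+1; rewrite C_partS => /lt0r_neq0; rewrite mulf_eq0 negb_or.
  by move=> /andP[].
have -> : (p ^ k - p ^ d)%:R * (p%:R : R) ^- k = 1 - (p%:R : R)^-1 ^+ j.+1.
  rewrite natrB ?leq_exp2l ?prime_gt1 //; last lia.
  rewrite mulrBl !natrX divff ?expf_neq0 //; congr (_ - _).
  by rewrite kE exprD invfM mulrA divff ?expf_neq0 // mul1r exprVn.
by rewrite C_partS invfM mulrA mulfVK.
Qed.

End SpanningFamilies.

Section FiberMeasures.
Variable R : realType.

Lemma measure_fibers d (T : measurableType d) (mu : probability T R)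
    (Y : choiceType) (f : T -> Y) (S : set Y) (c : R) : finite_set S ->
  (forall y, S y -> measurable (f @^-1` [set y]) /\ mu (f @^-1` [set y]) = c%:E) ->
  mu (f @^-1` S) = ((ncard S)%:R * c)%:E.
Proof.
move=> fS hf; have -> : f @^-1` S = \bigcup_(y in S) (f @^-1` [set y]).
  by apply/seteqP; split=> [x Sx|x [y Sy /= fxy]]; [exists (f x)|rewrite /= fxy].
rewrite measure_fin_bigcup //; last 2 first.
- by move=> y z _ _ [x [/= <- <-]].
- by move=> y /hf[].
rewrite fsbig_finite //= (eq_big_seq (fun=> c%:E)); last first.
  by move=> y; rewrite in_fset_set // inE => /hf[].
rewrite sumEFin big_const_seq count_predT iter_addr addr0 mulr_natl.
by [].
Qed.

Lemma power_measure_fibers d (T : measurableType d) (mu : probability T R) k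
    (nu : probability (k.-tuple T) R) (Y : choiceType) (g : T -> Y)
    (S : set {ffun 'I_k -> Y}) (c : R) :
  is_power_measure mu nu -> finite_set S ->
  (forall y, S y -> forall i,
     measurable (g @^-1` [set y i]) /\ mu (g @^-1` [set y i]) = c%:E) ->
  measurable [set t | S [ffun i => g (tnth t i)]] /\
  nu [set t | S [ffun i => g (tnth t i)]] = ((ncard S)%:R * c ^+ k)%:E.
Proof.
move=> hnu fS hS; pose f (t : k.-tuple T) := [ffun i => g (tnth t i)].
have fE y : f @^-1` [set y] = [set t | forall i, (g @^-1` [set y i]) (tnth t i)].
  apply/seteqP; split=> t /=; first by move=> <- i; rewrite ffunE.
  by move=> h; apply/ffunP => i; rewrite ffunE h.
have mf y : S y -> measurable (f @^-1` [set y]).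
  move=> Sy; rewrite fE.
  have -> : [set t : k.-tuple T | forall i, (g @^-1` [set y i]) (tnth t i)] =
      \bigcap_(i in [set: 'I_k]) ((@tnth k T ^~ i) @^-1` (g @^-1` [set y i])).
    by apply/seteqP; split=> t h; [move=> i _; exact: h|move=> i; exact: h].
  apply: fin_bigcap_measurable => [|i _]; first exact: finite_finset.
  rewrite -[X in measurable X]setTI; apply: measurable_tnth => //.
  by have [] := hS y Sy i.
have nf y : S y -> nu (f @^-1` [set y]) = (c ^+ k)%:E.
  move=> Sy; rewrite fE (hnu (fun i => g @^-1` [set y i])); last by move=> i; have [] := hS y Sy i.
  rewrite (eq_bigr (fun=> c%:E)); last by move=> i _; have [] := hS y Sy i.
  by rewrite prodEFin prodr_const card_ord.
split; last first.
  by apply: (@measure_fibers _ _ nu _ f S) => // y Sy; split; [exact: mf|exact: nf].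
have -> : [set t | S (f t)] = \bigcup_(y in S) (f @^-1` [set y]).
  by apply/seteqP; split=> [t St|t [y Sy /= fty]]; [exists (f t)|rewrite /= fty].
by apply: fin_bigcup_measurable => // y Sy; exact: mf.
Qed.

End FiberMeasures.

Section HaarFibers.
Variables (R : realType) (p : nat).
Hypotheses (p_prime : prime p) (p_gt2 : (2 < p)%N).
Local Open Scope group_scope.
Variables (X : sigmaProPType p) (mu : probability (borel_minus X) R).
Hypothesis haar_mu : is_haar mu.

Lemma minus_valP (a : borel_minus X) : minus_part X (minus_val a).
Proof. exact: set_valP. Qed.

Lemma measurable_minus_val (A : set X) : open A ->
  measurable ((@minus_val p X) @^-1` A).
Proof. by move=> oA; apply: sub_sigma_algebra; exists A. Qed.

(** Only the independence of the coset is recorded; masses of fibres are later obtained from a total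
    mass, without counting the minus part of [quo W]. *)
Lemma haar_coset (W : set X) : open W -> is_normal W -> sigma_stable W ->
  exists c : R, forall x, minus_part X x ->
    mu [set a | W (x^-1 * minus_val a)] = c%:E.
Proof.
move=> oW nW sW; exists ((ncard (minus_part (quo W)))%:R^-1)%R => x mx.
have cW : closed_sigma_normal W.
  split=> //; have [[W1 WM WV] _] := nW.
  rewrite -openC.
  have -> : ~` W = \bigcup_(k in ~` W) ((fun x => k^-1 * x) @^-1` W).
    apply/seteqP; split=> [y nWy|y [k nWk /= Wky] Wy].
      by exists y => //=; rewrite mulVg.
    by apply: nWk; rewrite -[k]invgK -(mulgK y k^-1) invgM invgK; apply: WM => //; apply: WV.
  by apply: bigcup_open => k _; apply: open_comp => // y _; exact: mull_continuous.
have mb : minus_part (quo W) (quo_pi W x).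
  by rewrite /minus_part /= -quo_pi_sigma mx quo_piV.
rewrite -(haar_mu oW nW sW mb); congr (mu _); apply/seteqP; split=> a /=.
  by move=> h; apply/esym/(quo_pi_eq _ _ cW).
by move=> /esym/(quo_pi_eq _ _ cW).
Qed.

Lemma haar_hom (Q : sigmaProPType p) (phi : X -> Q) :
  finite_set [set: Q] -> open (phi @^-1` [set 1]) -> is_sigma_epi phi ->
  forall q, minus_part Q q ->
    measurable [set a : borel_minus X | phi (minus_val a) = q] /\
    mu [set a | phi (minus_val a) = q] = ((ncard (minus_part Q))%:R^-1)%:E.
Proof.
move=> fQ oK ephi.
have nK : is_normal (phi @^-1` [set 1]) := normal_kernel ephi.1.1.
have [c cE] : exists c : R, forall x, minus_part X x ->
    mu [set a | (phi @^-1` [set 1]) (x^-1 * minus_val a)] = c%:E.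
  by apply: haar_coset => // x /= px; rewrite ephi.1.2 px sigma1.
have fm : finite_set (minus_part Q) by exact: sub_finite_set fQ.
have mE q : measurable [set a : borel_minus X | phi (minus_val a) = q].
  have [x _ <-] := ephi.2 q I.
  have -> : [set a : borel_minus X | phi (minus_val a) = phi x] =
      (@minus_val p X) @^-1` ((fun y => x^-1 * y) @^-1` (phi @^-1` [set 1])).
    apply/seteqP; split=> a /=; rewrite ephi.1.1.2 (homV ephi.1.1).
      by move=> ->; rewrite mulVg.
    by move=> /(congr1 (fun z => phi x * z)); rewrite mulKVg mulg1.
  by apply: measurable_minus_val; apply: open_comp => // y _; exact: mull_continuous.
have muE q : minus_part Q q -> mu [set a | phi (minus_val a) = q] = c%:E.
  move=> mq; have [x mx <-] := minus_lift p_prime p_gt2 ephi mq.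
  rewrite -(cE x mx); congr (mu _); apply/seteqP; split=> a /=;
    rewrite ephi.1.1.2 (homV ephi.1.1).
    by move=> ->; rewrite mulVg.
  by move=> /(congr1 (fun z => phi x * z)); rewrite mulKVg mulg1.
move=> q mq; split=> //; rewrite muE //.
have := @measure_fibers R _ _ mu _ (phi \o (@minus_val p X)) (minus_part Q) c fm.
rewrite (_ : _ @^-1` _ = setT); last first.
  apply/seteqP; split=> // a _ /=.
  by rewrite /minus_part /= -ephi.1.2 (minus_valP a) (homV ephi.1.1).
rewrite probability_setT => h.
have [e] := h (fun y my => conj (mE y) (muE y my)); congr (_%:E).
have n0 : (ncard (minus_part Q))%:R != 0%R :> R.
  by apply: contra_eq_neq e => ->; rewrite mul0r oner_neq0.
by apply: (mulfI n0); rewrite -e divff.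
Qed.

(** The p^d sets into which chi cuts L are cosets of the kernel of chi in L, each represented in the
    minus part by [half_minusX]; so they share the mass c equally. *)
Lemma haar_coordinates (L : set X) d (chi : X -> 'rV['F_p]_d) (c : R) :
  open L -> is_normal L -> sigma_stable L -> invariant_hom L chi ->
  (forall x, L x -> chi (sigma x) = (- chi x)%R) ->
  (forall v, exists2 x, L x & chi x = v) ->
  mu [set a | L (minus_val a)] = c%:E ->
  forall v, measurable [set a : borel_minus X | L (minus_val a) /\ chi (minus_val a) = v] /\
    mu [set a | L (minus_val a) /\ chi (minus_val a) = v] = (c * ((p ^ d)%:R^-1))%R%:E.
Proof.
move=> oL nL sL ichi chis chiv cE.
pose W := [set x | L x /\ chi x = 0%R].
have [lc cM cJ] := ichi; have [[L1 LM LV] LJ] := nL.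
have nW : is_normal W := normal_invariant_kernel nL ichi.
have oW : open W by apply: openI oL _; exact: (@locally_constant_open _ _ chi [set 0%R] lc).
have [c' c'E] : exists c : R, forall x, minus_part X x ->
    mu [set a | W (x^-1 * minus_val a)] = c%:E.
  apply: haar_coset => // x [Lx x0]; split; first exact: sL.
  by rewrite chis // x0 oppr0.
pose E v := [set a : borel_minus X | L (minus_val a) /\ chi (minus_val a) = v].
have mE v : measurable (E v).
  apply: (measurable_minus_val (A := L `&` chi @^-1` [set v])).
  by apply: openI oL _; exact: (@locally_constant_open _ _ chi [set v] lc).
have muE v : mu (E v) = c'%:E.
  have [u Lu <-] := chiv v.
  have [x [mx Lx <-]] := half_minusX p_prime p_gt2 nL sL ichi chis Lu.
  rewrite -(c'E x mx); congr (mu _); apply/seteqP; split=> a /= [La ca].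
    split; first by apply: LM => //; exact: LV.
    by rewrite cM ?(invariant_homV nL ichi) ?ca ?addNr //; exact: LV.
  have La' : L (minus_val a) by rewrite -[minus_val a](mulKVg x); exact: LM.
  split=> //; apply/eqP; rewrite -subr_eq0 addrC; apply/eqP.
  by rewrite -(invariant_homV nL ichi) // -cM //; exact: LV.
move=> v; split; first exact: mE.
rewrite -[X in mu X]/(E v) muE; congr (_%:E).
(* [None] marks what lies outside L, so that L becomes the union of the fibres over [Some]. *)
pose f (a : borel_minus X) := if `[< L (minus_val a) >] then Some (chi (minus_val a)) else None.
have fE w : f @^-1` [set Some w] = E w.
  apply/seteqP; split=> a; rewrite /f /E /=.
    by case: asboolP => // La [<-].
  by move=> [La <-]; case: asboolP.
have := @measure_fibers R _ _ mu _ f (Some @` [set: 'rV['F_p]_d]) c'.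
rewrite ncard_image; [|exact: finite_finset|by move=> x y _ _ []].
have -> : f @^-1` (Some @` setT) = [set a | L (minus_val a)].
  apply/seteqP; split=> a; rewrite /f /=; first by case: asboolP => // _ [].
  by move=> La; case: asboolP => // _; exists (chi (minus_val a)).
have -> : ncard [set: 'rV['F_p]_d] = (p ^ d)%N.
  by rewrite ncard_fin -(card_rV p_prime); apply: eq_card => w; rewrite !inE; apply/asboolP.
rewrite cE => h; have {h} : c%:E = ((p ^ d)%:R * c')%:E.
  apply: h; first exact: finite_finset.
  by move=> _ [w _ <-]; rewrite fE; split; [exact: mE|exact: muE].
move=> -[->]; rewrite mulrC mulKf //.
by rewrite pnatr_eq0 expn_eq0 negb_and -lt0n prime_gt0.
Qed.

End HaarFibers.

Section Events.
Variable p : nat.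
Hypotheses (p_prime : prime p) (p_gt2 : (2 < p)%N).
Local Open Scope group_scope.

Lemma open_finite_kernel (X Q : proPType p) (phi : X -> Q) :
  finite_set [set: Q] -> is_hom phi -> open (phi @^-1` [set 1]).
Proof.
move=> fQ hphi; rewrite -closedC; apply: (hom_preimage_closed hphi (A := ~` [set 1])).
have aQ : accessible_space Q by exact/hausdorff_accessible/proP_hausdorff.
have h := iffLR accessible_finite_set_closed aQ.
apply: h; exact: sub_finite_set fQ.
Qed.

Variables (n : nat) (F : freeSigmaProP p n) (D : set F).
Hypothesis cD : closed_sigma_normal D.
Hypothesis D_Aut : forall alpha, sigma_Aut F alpha -> alpha @` D = D.
Variables (Q : sigmaProPType p) (phi0 : F -> Q).
Hypotheses (ephi0 : is_sigma_epi phi0) (dQ : dimH1 Q n).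
Local Notation M := (phi0 @^-1` [set 1]).
Hypothesis DM : D `<=` M.
Hypothesis MH1 : forall psi, H1 F psi -> forall u, M u -> psi u = 0%R.
Variables (m : nat) (chi : F -> 'rV['F_p]_m).
Hypothesis rchi : relative_coordinates D M chi.
Hypothesis chi_sigma : forall u, M u -> chi (sigma u) = (- chi u)%R.

(* Here m + l is the dimension of L / D L^p[L, E] for L = ker phi. *)
Lemma exists_relator_coordinates l (E : freeSigmaProP p (n + l)) (phi : E -> Q) :
  is_sigma_epi phi -> exists b : E -> 'rV['F_p]_(m + l),
  [/\ invariant_hom (phi @^-1` [set 1]) b,
      forall x, phi x = 1 -> b (sigma x) = (- b x)%R,
      forall v, exists2 x, phi x = 1 & b x = v &
      forall (J : Type) (r : J -> E) (H : sigmaProPType p) (q : E -> H),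
        is_sigma_epi q -> (forall x, q x = 1 <-> normally_generated (range r) x) ->
        (dimH1 H n /\ forall w, phi w = 1 <-> epi_image D H (q w)) <->
        ((forall i, phi (r i) = 1) /\
         forall c : 'cV['F_p]_(m + l), (forall i, (b (r i) *m c) 0%R 0%R = 0%R) -> c = 0%R)].
Proof.
move=> ephi; have [y [my gy yl yr]] := exists_adapted_basis p_prime p_gt2 ephi0 ephi dQ.
pose E' := rebase p_prime my gy.
have ephi' : @is_sigma_epi p E' Q phi by exact: ephi.
have [iota [hiota iotaE]] := adapted_section F E'.
have [psi [hpsi psil psir]] := adapted_retraction F E'.
have [e [ie el er eH1]] := adapted_exponents p_prime E'.
exists (@big_coordinates p n l m F E' psi e chi); split.
- exact: (big_coordinates_hom ephi0 ephi' yl yr hpsi psil psir ie rchi).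
- move=> x px; rewrite /big_coordinates hpsi.2 chi_sigma; last first.
    by rewrite /= -(phi_psi ephi0 ephi' yl yr hpsi psil psir).
  have -> : e (sigma x) = (- e x)%R.
    apply/rowP => j; rewrite mxE.
    apply: (free_H1_sigma p_prime (F := E') (chi := fun x => e x 0%R j)).
    exact/H1_invariant_hom/invariant_hom_coord.
  by rewrite opp_row_mx.
- exact: (big_coordinates_surj p_prime ephi0 ephi' yl yr hiota hpsi iotaE psil psir ie el er cD rchi).
move=> J r H q eq_q qr; split=> -[h1 h2].
  exact: (criterion_forward p_prime p_gt2 ephi0 ephi' yl yr hiota hpsi iotaE
    psil psir ie el er cD DM rchi MH1 eq_q qr D_Aut h1 h2).
exact: (criterion_backward p_prime p_gt2 ephi0 ephi' yl yr hiota hpsi iotaE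
  psil psir ie el er eH1 cD DM rchi MH1 eq_q qr D_Aut h1 h2).
Qed.

End Events.

Section CountingEpis.
Variables (R : realType) (p : nat).
Hypotheses (p_prime : prime p) (p_gt2 : (2 < p)%N).
Local Open Scope group_scope.
Variables (k n : nat) (E : freeSigmaProP p k) (Q : sigmaProPType p).
Hypotheses (fQ : finite_set [set: Q]) (dQ : dimH1 Q n).

Definition epis : set (E -> Q) := [set phi | is_sigma_epi phi].

Definition generating_families : set {ffun 'I_k -> Q} :=
  [set y | (forall i, minus_part Q (y i)) /\
    forall chi, H1 Q chi -> (forall i, chi (y i) = 0%R) -> forall q, chi q = 0%R].

Lemma finite_ffun : finite_set [set: {ffun 'I_k -> Q}].
Proof.
have [s us sQ] := finite_set_uniq_seq fQ.
pose f (y : {ffun 'I_k -> seq_sub s}) : {ffun 'I_k -> Q} := [ffun i => ssval (y i)].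
apply: (sub_finite_set (B := f @` setT)); last first.
  by apply: finite_image; exact: finite_finset.
move=> y _; exists [ffun i => SeqSub ((sQ (y i)).2 I)] => //.
by apply/ffunP => i; rewrite !ffunE.
Qed.

Definition generator_values (phi : E -> Q) : {ffun 'I_k -> Q} :=
  [ffun i => phi (free_gen E i)].

Lemma generator_values_inj : {in epis &, injective generator_values}.
Proof.
move=> f g; rewrite !inE => ef eg fg; apply: (free_hom_eq ef.1.1 eg.1.1) => i.
by have := congr1 (fun h : {ffun 'I_k -> Q} => h i) fg; rewrite !ffunE.
Qed.

Lemma generator_values_epis : generator_values @` epis = generating_families.
Proof.
apply/seteqP; split=> [_ [phi ephi <-]|y [my gy]].
  split=> [i|chi Hchi c0 q].
    by rewrite ffunE /minus_part /= -ephi.1.2 free_gen_sigma (homV ephi.1.1).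
  have [x _ <-] := ephi.2 q I; move: x; apply: (free_H1_0 p_prime (H1_comp ephi.1.1 Hchi)).
  by move=> i; have := c0 i; rewrite ffunE.
have [phi [hphi phiE]] := free_sigma_hom_exists E my.
exists phi; last by apply/ffunP => i; rewrite ffunE phiE.
split=> //; apply: (hom_surj_H1 p_prime hphi.1) => chi Hchi c0; apply: gy => // i.
by rewrite -phiE.
Qed.

Lemma finite_epis : finite_set epis.
Proof.
have /choice[g gP] : forall y : {ffun 'I_k -> Q}, exists phi : E -> Q,
    generating_families y -> epis phi /\ generator_values phi = y.
  move=> y; have [gy|ngy] := pselect (generating_families y); last by exists (fun=> 1).
  by move: gy; rewrite -generator_values_epis => -[phi ephi <-]; exists phi.
apply: (sub_finite_set (B := g @` setT)); last by apply: finite_image; exact: finite_ffun.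
move=> phi ephi; exists (generator_values phi) => //.
have [|eg gE] := gP (generator_values phi); first by rewrite -generator_values_epis; exists phi.
by apply: generator_values_inj; rewrite ?inE.
Qed.

Definition hom_kernel (phi : E -> Q) : set E := phi @^-1` [set 1].

Lemma ncard_epis_kernels :
  ncard epis = (ncard (hom_kernel @` epis) * ncard (sigma_Aut Q))%N.
Proof.
apply: ncard_fibers; first exact: finite_epis.
move=> phi ephi; set A := _ `&` _.
have fA : finite_set A by apply: sub_finite_set finite_epis => ? [].
have /choice[g gP] : forall psi : E -> Q, exists a : Q -> Q,
    A psi -> sigma_Aut Q a /\ forall x, a (phi x) = psi x.
  move=> psi; have [Apsi|nA] := pselect (A psi); last by exists id.
  have [epsi kpsi] := Apsi.
  have [|a ia aE] := sigma_epi_isomorphic ephi epsi; last by exists a.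
  by move=> x; have := congr1 (fun S : set E => S x) kpsi; rewrite /hom_kernel /= => <-.
rewrite -(ncard_image (f := g) fA).
  congr ncard; apply/seteqP; split=> [_ [psi Apsi <-]|a aA]; first by have [] := gP _ Apsi.
  have [ea a1] := iso_epi aA.
  have Aa : A (a \o phi).
    split; first exact: comp_sigma_epi.
    apply/seteqP; split=> x /=; first exact: a1.
    by rewrite /hom_kernel /= => ->; exact: hom1 ea.1.1.
  exists (a \o phi) => //; have [_ gE] := gP _ Aa; apply/funext => q.
  by have [x _ <-] := ephi.2 q I; rewrite gE.
move=> psi psi'; rewrite !inE => Apsi Apsi' gg; apply/funext => x.
by have [[_ <-] [_ <-]] := conj (gP _ Apsi) (gP _ Apsi'); rewrite gg.
Qed.

Variable (mu : probability (borel_minus E) R).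
Hypothesis haar_mu : is_haar mu.
Variable nu : probability (k.-tuple (borel_minus E)) R.
Hypothesis nuP : is_power_measure mu nu.

(* Both sides are the probability that the images of the k random elements under
   a fixed epimorphism generate Q. *)
Lemma ncard_epis (rho : E -> Q) : is_sigma_epi rho ->
  ((ncard epis)%:R * ((ncard (minus_part Q))%:R^-1) ^+ k =
   (ncard (@spanning p k n))%:R * ((p ^ n)%:R^-1) ^+ k :> R)%R.
Proof.
move=> erho; have [B fB] := dimH1_frame dQ; have [iB Bchi Bu] := fB.
have nT := normal_setT E.
have iBr : invariant_hom setT (B \o rho) by exact: (invariant_hom_preimage iB erho.1.1).
have oK : open (rho @^-1` [set 1]) by exact: open_finite_kernel erho.1.1.
have E1 : nu [set t | generating_families [ffun i => rho (minus_val (tnth t i))]] =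
    ((ncard generating_families)%:R * ((ncard (minus_part Q))%:R^-1) ^+ k)%R%:E.
  have [//||_ ->//] := @power_measure_fibers R _ _ mu k nu _ (rho \o (@minus_val p E))
    generating_families ((ncard (minus_part Q))%:R^-1)%R nuP.
    by apply: sub_finite_set finite_ffun.
  move=> y [my _] i; exact: (haar_hom p_prime p_gt2 haar_mu fQ oK erho (my i)).
have cB := @haar_coordinates R p p_prime p_gt2 E mu haar_mu setT n (B \o rho) 1%R.
have E2 : nu [set t | spanning [ffun i => B (rho (minus_val (tnth t i)))]] =
    ((ncard (@spanning p k n))%:R * ((p ^ n)%:R^-1) ^+ k)%R%:E.
  have [||_ ->//] := @power_measure_fibers R _ _ mu k nu _ (B \o rho \o (@minus_val p E))
    (@spanning p k n) ((p ^ n)%:R^-1)%R nuP.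
    exact: finite_finset.
  move=> y _ i.
  have -> : (B \o rho \o (@minus_val p E)) @^-1` [set y i] =
      [set a | setT (minus_val a) /\ (B \o rho) (minus_val a) = y i].
    by apply/seteqP; split=> [a|a []].
  rewrite -[((p ^ n)%:R^-1)%R]mul1r; apply: cB => //; first exact: openT.
  - move=> x _ /=; rewrite -[LHS]/((B \o rho) (sigma x)); apply/rowP => j; rewrite mxE.
    move: x; apply: (free_H1_sigma p_prime (chi := fun x => (B \o rho) x 0%R j)).
    exact/H1_invariant_hom/(invariant_hom_coord _ iBr).
  - move=> v; have [q <-] := frame_surj fB v; have [x _ <-] := erho.2 q I.
    by exists x.
  - by rewrite -(@probability_setT _ _ _ mu); congr (mu _); apply/seteqP; split.
(* Characters of Q are the linear forms in B, so generating Q means that the coordinates span. *)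
have E3 : [set t | generating_families [ffun i => rho (minus_val (tnth t i))]] =
    [set t | spanning [ffun i => B (rho (minus_val (tnth t i)))]].
  apply/seteqP; split=> t.
    move=> [_ gy] c c0; apply: Bu; apply: (gy (fun q => (B q *m c) 0%R 0%R)).
      exact/H1_invariant_hom/linear_form_invariant_hom.
    by move=> i; have := c0 i; rewrite !ffunE.
  move=> sp; split=> [i|chi Hchi c0 q].
    by rewrite ffunE /minus_part /= -erho.1.2 minus_valP (homV erho.1.1).
  have [c cE] := Bchi _ Hchi; rewrite cE (sp c) ?mulmx0 ?mxE // => i.
  by have := c0 i; rewrite !ffunE cE.
have := etrans (esym E1) (etrans (congr1 nu E3) E2) => -[<-]; congr (_%:R * _)%R.
rewrite -generator_values_epis ncard_image //; first exact: finite_epis.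
exact: generator_values_inj.
Qed.

End CountingEpis.

(** * The probability of U_{D,G} *)

Section EventProbability.
Variables (R : realType) (p : nat).
Hypotheses (p_prime : prime p) (p_gt2 : (2 < p)%N).
Local Open Scope group_scope.

Definition presented_group k (E : freeSigmaProP p k)
    (r : k.-tuple (borel_minus E)) : sigmaProPType p :=
  quo (normally_generated (range (fun i => minus_val (tnth r i)))).

Definition presentation k (E : freeSigmaProP p k) (r : k.-tuple (borel_minus E)) :
    E -> presented_group r :=
  quo_pi (normally_generated (range (fun i => minus_val (tnth r i)))).

Lemma presentation_epi k (E : freeSigmaProP p k) (r : k.-tuple (borel_minus E)) :
  is_sigma_epi (presentation r).
Proof. exact: quo_pi_epi. Qed.

Lemma presentation_ker k (E : freeSigmaProP p k) (r : k.-tuple (borel_minus E)) x :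
  presentation r x = 1 <->
  normally_generated (range (fun i => minus_val (tnth r i))) x.
Proof. exact: quo_pi_eq1 (relators_csn r). Qed.

Variables (n : nat) (F : freeSigmaProP p n) (D : set F).
Hypothesis cD : closed_sigma_normal D.
Hypothesis D_Aut : forall alpha, sigma_Aut F alpha -> alpha @` D = D.
Variables (Q : sigmaProPType p) (phi0 : F -> Q).
Hypotheses (ephi0 : is_sigma_epi phi0) (dQ : dimH1 Q n).
Hypothesis fQ : finite_set [set: Q].
Local Notation M := (phi0 @^-1` [set 1]).
Hypothesis DM : D `<=` M.
Hypothesis MH1 : forall psi, H1 F psi -> forall u, M u -> psi u = 0%R.
Variables (m : nat) (chi : F -> 'rV['F_p]_m).
Hypothesis rchi : relative_coordinates D M chi.
Hypothesis chi_sigma : forall u, M u -> chi (sigma u) = (- chi u)%R.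

Variables (l : nat) (E : freeSigmaProP p (n + l)).
Local Notation k := (n + l)%N.

(** It depends on phi only through ker phi, and r determines this kernel; so two such events
    coincide or are disjoint. *)
Definition event (phi : E -> Q) : set (k.-tuple (borel_minus E)) :=
  [set r | dimH1 (presented_group r) n /\
    forall w, phi w = 1 <-> epi_image D (presented_group r) (presentation r w)].

Definition isomorphic_event : set (k.-tuple (borel_minus E)) :=
  [set r | dimH1 (presented_group r) n /\
    sigma_isomorphic (quo (epi_image D (presented_group r))) Q].

Lemma epi_image_presented (r : k.-tuple (borel_minus E)) :
  dimH1 (presented_group r) n ->
  is_sigma_epi (quo_pi (epi_image D (presented_group r)) \o presentation r) /\
  forall w, quo_pi (epi_image D (presented_group r)) (presentation r w) = 1 <->
    epi_image D (presented_group r) (presentation r w).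
Proof.
move=> dr; split; first exact: comp_sigma_epi (presentation_epi r) (quo_pi_epi _).
move=> w; apply: quo_pi_eq1.
have [pi epi] := exists_epi p_prime F (presentation_epi r) dr.
by rewrite (epi_imageE p_prime p_gt2 D_Aut dr epi); exact: epi_image_csn.
Qed.

(** By the criterion, k relators span a space of dimension m + l. *)
Lemma relators_bound : (exists2 phi, is_sigma_epi phi & exists r, event phi r) ->
  (m + l <= k)%N.
Proof.
move=> [phi ephi [r hr]].
have [b [ib bs bsurj bP]] := exists_relator_coordinates p_prime p_gt2 cD D_Aut
  ephi0 dQ DM MH1 rchi chi_sigma ephi.
have [_ span] := (bP _ _ _ _ (presentation_epi r) (presentation_ker r)).1 hr.
pose A := (\matrix_i b (minus_val (tnth r i)))%R.
have /eqP <- : row_full A.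
  apply: col_inj_row_full => c Ac; apply: span => i.
  by rewrite -[b _](rowK (fun i => b (minus_val (tnth r i)))) -/A -row_mul Ac row0 mxE.
exact: rank_leq_row.
Qed.

Variable (mu : probability (borel_minus E) R).
Hypothesis haar_mu : is_haar mu.
Variable nu : probability (k.-tuple (borel_minus E)) R.
Hypothesis nuP : is_power_measure mu nu.

Lemma event_probability (phi : E -> Q) : is_sigma_epi phi ->
  measurable (event phi) /\
  nu (event phi) = ((ncard (@spanning p k (m + l)))%:R *
    ((ncard (minus_part Q))%:R^-1 * (p ^ (m + l))%:R^-1) ^+ k)%R%:E.
Proof.
move=> ephi.
have [b [ib bs bsurj bP]] := exists_relator_coordinates p_prime p_gt2 cD D_Aut
  ephi0 dQ DM MH1 rchi chi_sigma ephi.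
pose L := phi @^-1` [set 1].
have oL : open L by exact: open_finite_kernel ephi.1.1.
have nL : is_normal L := normal_kernel ephi.1.1.
have sL : sigma_stable L by move=> x /= px; rewrite /L /= ephi.1.2 px sigma1.
pose g (a : borel_minus E) :=
  if `[< L (minus_val a) >] then Some (b (minus_val a)) else None.
pose S : set {ffun 'I_k -> option 'rV['F_p]_(m + l)} :=
  (fun y : {ffun 'I_k -> 'rV['F_p]_(m + l)} => [ffun i => Some (y i)]) @` @spanning p k (m + l).
have -> : event phi = [set r | S [ffun i => g (tnth r i)]].
  apply/seteqP; split=> r.
    move=> /(bP _ _ _ _ (presentation_epi r) (presentation_ker r)) [Lr span].
    exists [ffun i => b (minus_val (tnth r i))].
      by move=> c c0; apply: span => i; have := c0 i; rewrite ffunE.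
    apply/ffunP => i; rewrite !ffunE /g.
    by case: asboolP => // nLr; case: nLr; exact: Lr.
  move=> [y sy yE]; apply/(bP _ _ _ _ (presentation_epi r) (presentation_ker r)).
  have yi i : L (minus_val (tnth r i)) /\ b (minus_val (tnth r i)) = y i.
    have := congr1 (fun h : {ffun 'I_k -> option 'rV['F_p]_(m + l)} => h i) yE.
    by rewrite !ffunE /g; case: asboolP => // Lr [].
  split; first by move=> i; have [] := yi i.
  by move=> c c0; apply: sy => i; have [_ <-] := yi i; exact: c0.
have cS : ncard S = ncard (@spanning p k (m + l)).
  apply: ncard_image; first exact: finite_finset.
  move=> y y' _ _ e; apply/ffunP => i.
  have := congr1 (fun h : {ffun 'I_k -> option 'rV['F_p]_(m + l)} => h i) e.
  by rewrite !ffunE => -[].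
rewrite -cS; apply: (power_measure_fibers nuP).
  by apply: finite_image; exact: finite_finset.
move=> _ [y sy <-] i; rewrite ffunE.
have -> : g @^-1` [set Some (y i)] =
    [set a | L (minus_val a) /\ b (minus_val a) = y i].
  apply/seteqP; split=> a; rewrite /g /=; first by case: asboolP => // La [].
  by move=> [La <-]; case: asboolP.
have muL : mu [set a | L (minus_val a)] = ((ncard (minus_part Q))%:R^-1)%:E.
  have m1 : minus_part Q 1 by rewrite /minus_part /= sigma1 invg1.
  by have [] := haar_hom p_prime p_gt2 haar_mu fQ oL ephi m1.
exact: (haar_coordinates p_prime p_gt2 haar_mu oL nL sL ib bs bsurj muL).
Qed.

Lemma isomorphic_event_probability (rho : E -> Q) : is_sigma_epi rho -> (m <= n)%N ->
  nu isomorphic_event =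
  (C_part R p k / C_part R p l * (C_part R p k / C_part R p (n - m)) *
    (ncard (sigma_Aut Q))%:R^-1)%R%:E.
Proof.
move=> erho mn.
(* The kernel attached to r. The default [set0] is never a kernel, as it misses 1, so the event is
   the preimage of the set of kernels. *)
pose f (r : k.-tuple (borel_minus E)) : set E :=
  if `[< isomorphic_event r >]
  then [set w | epi_image D (presented_group r) (presentation r w)] else set0.
pose K := @hom_kernel p k E Q @` @epis p k E Q.
have fE (phi : E -> Q) : is_sigma_epi phi -> f @^-1` [set hom_kernel phi] = event phi.
  move=> ephi; apply/seteqP; split=> r; rewrite /f /=.
    case: asboolP => [[dr isoQ] e|_ e].
      by split=> // w; have := congr1 (fun S : set E => S w) e => /= ->.
    have : hom_kernel phi 1 by exact: hom1 ephi.1.1.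
    by rewrite -e.
  move=> [dr hr]; case: asboolP => [_|[]].
    by apply/seteqP; split=> w /hr.
  split=> //; have [eq kq] := epi_image_presented dr.
  have [|h ih _] := sigma_epi_isomorphic eq ephi; last by exists h.
  by move=> x; rewrite /= kq hr.
have -> : isomorphic_event = f @^-1` K.
  apply/seteqP; split=> r; last first.
    move=> [phi ephi e]; suff [dr hr] : event phi r.
      have [eq kq] := epi_image_presented dr; split=> //.
      have [|h ih _] := sigma_epi_isomorphic eq ephi; last by exists h.
      by move=> x; rewrite /= kq hr.
    by rewrite -fE.
  move=> Ur; have [dr [h ih]] := Ur; have [eh h1] := iso_epi ih.
  have [eq kq] := epi_image_presented dr.
  exists (h \o (quo_pi (epi_image D (presented_group r)) \o presentation r)).
    exact: comp_sigma_epi.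
  rewrite /f; case: asboolP => // _; apply/seteqP; split=> w; rewrite /hom_kernel /=.
    by move=> /h1/kq.
  by move=> /kq ->; exact: hom1 eh.1.1.
have fK : finite_set K by apply: finite_image; exact: finite_epis.
have hK S : K S -> measurable (f @^-1` [set S]) /\ nu (f @^-1` [set S]) =
    ((ncard (@spanning p k (m + l)))%:R *
    ((ncard (minus_part Q))%:R^-1 * (p ^ (m + l))%:R^-1) ^+ k)%R%:E.
  by move=> [phi ephi <-]; rewrite fE //; exact: event_probability.
rewrite (measure_fibers fK hK); congr (_%:E).
have cE := ncard_epis p_prime p_gt2 fQ dQ haar_mu nuP erho.
have kE := ncard_epis_kernels p_prime E fQ.
have Aut0 : (ncard (sigma_Aut Q))%:R != 0%R :> R.
  rewrite pnatr_eq0 -lt0n; have : (0 < ncard (@epis p k E Q))%N.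
    by apply: (@ncard_gt0 _ _ rho) => //; exact: finite_epis.
  by rewrite kE muln_gt0 => /andP[].
apply: (mulIf Aut0); rewrite mulfVK //.
have nk : (n <= k)%N by exact: leq_addr.
have mk : (m + l <= k)%N by rewrite leq_add2r.
have spn := ncard_spanning_C_part p_prime R nk.
have spm := ncard_spanning_C_part p_prime R mk.
rewrite addKn in spn; rewrite (_ : k - (m + l) = n - m)%N in spm; last by lia.
rewrite -spn -spm -cE kE natrM exprMn.
move: (_ ^+ k)%R (_ ^+ k)%R => u v; ring.
Qed.

End EventProbability.

Section Limits.
Variables (R : realType) (p : nat).
Hypothesis p_prime : prime p.

Let q : R := p%:R^-1.

Let q01 : 0 <= q < 1.
Proof.
rewrite invr_ge0 ler0n /= invf_lt1 ?ltr0n ?prime_gt0 //.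
by rewrite ltr1n prime_gt1.
Qed.

Lemma cvg_C_part : C_part R p @ \oo --> C_infty R p.
Proof.
apply: nonincreasing_is_cvgn; last by exists 0 => _ [k _ <-]; exact/ltW/C_part_gt0.
apply/nonincreasing_seqP => k; rewrite C_partS; apply: ler_piMr; first exact/ltW/C_part_gt0.
by rewrite gerBl exprn_ge0 //; case/andP: q01.
Qed.

(** The ratio is the product of the n factors 1 - p^-(l+1), ..., 1 - p^-(l+n), each tending to 1. *)
Lemma cvg_C_part_ratio n : C_part R p (n + l) / C_part R p l @[l --> \oo] --> (1 : R).
Proof.
elim: n => [|n IH].
  rewrite (_ : (fun l => _) = fun=> 1); first exact: cvg_cst.
  by apply/funext => l; rewrite add0n divff // gt_eqF // C_part_gt0.
rewrite (_ : (fun l => _) =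
    fun l => C_part R p (n + l) / C_part R p l * (1 - q ^+ (l + n.+1))); last first.
  by apply/funext => l; rewrite addSn C_partS mulrAC addnS addnC.
have h : q ^+ l @[l --> \oo] --> (0 : R).
  by apply: cvg_expr; rewrite ger0_norm; case/andP: q01.
have h1 : 1 - q ^+ (l + n.+1) @[l --> \oo] --> (1 - 0 : R).
  apply: cvgB; first exact: cvg_cst.
  by move: h; rewrite -(cvg_shiftn n.+1).
by have := cvgM IH h1; rewrite subr0 mulr1; apply.
Qed.

End Limits.

Section FreeEpis.
Variable p : nat.
Hypotheses (p_prime : prime p) (p_gt2 : (2 < p)%N).
Local Open Scope group_scope.

Lemma exists_epi_le (n l : nat) (F : freeSigmaProP p n) (E : freeSigmaProP p (n + l))
    (Q : sigmaProPType p) (phi0 : F -> Q) :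
  is_sigma_epi phi0 -> exists rho : E -> Q, is_sigma_epi rho.
Proof.
move=> ephi0.
have [psi [hpsi psil psir]] := adapted_retraction F E.
exists (phi0 \o psi); apply: comp_sigma_epi ephi0; split=> //.
apply: (hom_surj_H1 p_prime hpsi.1) => chi Hchi c0.
by apply: (free_H1_0 p_prime Hchi) => i; rewrite -psil.
Qed.

Lemma quo_epi_image_transport (n : nat) (F : freeSigmaProP p n) (D : set F)
    (H H' : sigmaProPType p) (pi : F -> H) : closed_sigma_normal D ->
  (forall alpha, sigma_Aut F alpha -> alpha @` D = D) ->
  is_sigma_epi pi -> dimH1 H n -> sigma_isomorphic H H' ->
  sigma_isomorphic (quo (epi_image D H')) (quo (epi_image D H)).
Proof.
move=> cD D_Aut epi dH isoH; have [f /iso_epi[ef f1]] := isoH.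
have dH' := dimH1_iso isoH dH.
have [eq kq] := quo_epi_image p_prime p_gt2 cD D_Aut dH epi.
apply: (quo_epi_image_iso p_prime p_gt2 cD D_Aut eq dH' (comp_sigma_epi epi ef)) => u.
rewrite /= kq; split=> -[d Dd e]; exists d => //=; first by rewrite e.
apply: (mulIg (pi d)^-1); rewrite mulgV; apply: f1.
by rewrite ef.1.1.2 (homV ef.1.1) e mulgV.
Qed.

End FreeEpis.

(** * Openness, closedness and measure of U_{D,G} *)

Section WeakSchur.
Variable p : nat.
Hypotheses (p_prime : prime p) (p_gt2 : (2 < p)%N).
Local Open Scope group_scope.
Variable F : forall n, freeSigmaProP p n.
Variables (n : nat) (D : set (F n)).
Hypothesis cD : closed_sigma_normal D.
Hypothesis D_frattini : D `<=` frattini (F n).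
Hypothesis D_Aut : forall alpha, sigma_Aut (F n) alpha -> alpha @` D = D.

Lemma weak_schur_epi (H : sigmaProPType p) : weak_schur F H -> dimH1 H n ->
  exists pi : F n -> H, is_sigma_epi pi.
Proof.
move=> [k [r Hr]] dH; have [f /iso_epi[ef _]] := sigma_iso_sym Hr.
exact: (exists_epi p_prime (F n) (comp_sigma_epi (presentation_epi r) ef) dH).
Qed.

Variable G : sigmaProPType p.

(** [U_DG] asks for some representative of the class; by invariance under isomorphism a given one
    can be tested instead. *)
Lemma U_DGP (H : sigmaProPType p) (wH : weak_schur F H) :
  U_DG D G (Sch_class wH) <->
  dimH1 H n /\ sigma_isomorphic (quo (epi_image D H)) (quo (epi_image D G)).
Proof.
split=> [[H' [wH' [/Sch_classP HH' dH' isoH']]]|[dH isoH]]; last by exists H, wH.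
have H'H := sigma_iso_sym HH'.
split; first exact: dimH1_iso H'H dH'.
have [pi epi] := weak_schur_epi wH' dH'.
apply: sigma_iso_trans isoH'.
exact: (quo_epi_image_transport p_prime p_gt2 cD D_Aut epi dH' H'H).
Qed.

Hypotheses (G_schur : weak_schur F G) (dG : dimH1 G n).
Hypothesis GD_finite : finite_set [set: quo (epi_image D G)].
Variables (m : nat) (mP : is_mDG D G m).

Lemma quotient_coordinates : exists (phi0 : F n -> quo (epi_image D G))
    (chi : F n -> 'rV['F_p]_m),
  [/\ is_sigma_epi phi0, D `<=` phi0 @^-1` [set 1],
      forall psi, H1 (F n) psi -> forall u, phi0 u = 1 -> psi u = 0%R,
      relative_coordinates D (phi0 @^-1` [set 1]) chi &
      forall u, phi0 u = 1 -> chi (sigma u) = (- chi u)%R].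
Proof.
have [pi epi min] := mP; have [chi rchi] := exists_relative_coordinates p_prime cD epi min.
have [eq kq] := quo_epi_image p_prime p_gt2 cD D_Aut dG epi.
set phi0 := _ \o pi in eq; exists phi0, chi.
have ME : phi0 @^-1` [set 1] = [set u | exists2 d, D d & pi u = pi d].
  by apply/seteqP; split=> u /kq.
split=> //.
- by rewrite ME => d Dd; exists d.
- by move=> psi Hpsi u /kq; exact: (H1_relative_kernel p_prime D_frattini dG epi Hpsi).
- by rewrite ME.
have [k [r Gr]] := G_schur; have [f /iso_epi[ef f1]] := sigma_iso_sym Gr.
have efr := comp_sigma_epi (presentation_epi r) ef.
move=> u /kq Mu; apply: (relative_coordinates_sigma p_prime p_gt2
  (S := range (fun i => minus_val (tnth r i))) cD _ efr _ epi dG _ _ rchi Mu).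
- by move=> _ [i _ <-]; exact: minus_valP.
- move=> x; rewrite -presentation_ker /=; split; first exact: f1.
  by move=> ->; exact: hom1 ef.1.1.
- by rewrite -ME; exact: closed_kernel eq.1.1.
- by rewrite -ME; exact: normal_kernel eq.1.1.
Qed.

(** The level i is uniform in H, which is what makes the complement open as well. *)
Lemma U_DG_stable : exists2 i, (2 <= i)%N & forall H H' : sigmaProPType p,
  weak_schur F H -> dimH1 H n ->
  sigma_isomorphic (quo (epi_image D H)) (quo (epi_image D G)) ->
  sigma_isomorphic (quo (zassenhaus H i)) (quo (zassenhaus H' i)) ->
  dimH1 H' n /\ sigma_isomorphic (quo (epi_image D H')) (quo (epi_image D G)).
Proof.
have [phi0 [chi [ephi0 DM MH1 rchi chis]]] := quotient_coordinates.
have [pi epi] := weak_schur_epi G_schur dG.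
have dQ := dimH1_quo_epi_image p_prime p_gt2 cD D_frattini D_Aut dG epi.
have oK := open_finite_kernel GD_finite ephi0.1.1.
have [i i2 iP] := quo_epi_image_stable p_prime p_gt2 cD D_Aut ephi0 dQ rchi oK.
exists i => // H H' wH dH isoH; have [pi' epi'] := weak_schur_epi wH dH.
exact: iP epi' dH isoH.
Qed.

Lemma U_DG_open : open (U_DG D G).
Proof.
have [i i2 iP] := U_DG_stable.
suff : Sch_open (U_DG D G) by [].
move=> c; have [H [wH ->]] := Sch_class_surj c => /U_DGP[dH isoH].
exists i, H; split=> //; first by apply/basic_openP; exact: sigma_iso_refl.
move=> d; have [K [wK ->]] := Sch_class_surj d => /basic_openP KH.
by apply/U_DGP; apply: (iP H) => //; exact: sigma_iso_sym.
Qed.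

Lemma U_DG_closed : closed (U_DG D G).
Proof.
have [i i2 iP] := U_DG_stable; rewrite -openC.
suff : Sch_open (~` U_DG D G) by [].
move=> c; have [H [wH ->]] := Sch_class_surj c => nU.
exists i, H; split=> //; first by apply/basic_openP; exact: sigma_iso_refl.
(* The roles are exchanged: if K is close to H and its class lies in the set, then so does that of
   H. *)
move=> d; have [K [wK ->]] := Sch_class_surj d => /basic_openP KH /U_DGP[dK isoK].
by apply: nU; apply/U_DGP; exact: (iP K).
Qed.

(** A presentation of G has as many relators as generators, say n + l, and [relators_bound] applies
    to it. *)
Lemma mDG_le : (m <= n)%N.
Proof.
have [phi0 [chi [ephi0 DM MH1 rchi chis]]] := quotient_coordinates.
have [pi epi] := weak_schur_epi G_schur dG.
have dQ := dimH1_quo_epi_image p_prime p_gt2 cD D_frattini D_Aut dG epi.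
have [k [r Gr]] := G_schur.
have dr : dimH1 (presented_group r) n := dimH1_iso Gr dG.
have nk := dimH1_le p_prime (presentation_epi r) dr.
have [l kE] : exists l, k = (n + l)%N by exists (k - n)%N; rewrite subnKC.
subst k.
have [h /iso_epi[eh h1]] := quo_epi_image_transport p_prime p_gt2 cD D_Aut epi dG Gr.
have [eq kq] := epi_image_presented p_prime p_gt2 cD D_Aut dr.
suff : (m + l <= n + l)%N by rewrite leq_add2r.
apply: (relators_bound p_prime p_gt2 cD D_Aut ephi0 dQ DM MH1 rchi chis (E := F (n + l))).
exists (h \o (quo_pi (epi_image D (presented_group r)) \o presentation r)).
  exact: comp_sigma_epi.
exists r; split=> // w /=; rewrite -kq; split; first exact: h1.
by move=> ->; exact: hom1 eh.1.1.
Qed.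

End WeakSchur.

Theorem proposition10p10 (R : realType) (p : nat)
    (p_prime : prime p) (p_gt2 : (2 < p)%N)
    (F : forall n, freeSigmaProP p n)
    (haar : forall n, probability (borel_minus (F n)) R)
    (haarP : forall n, is_haar (haar n))
    (nu : forall n, probability (n.-tuple (borel_minus (F n))) R)
    (nuP : forall n, is_power_measure (haar n) (nu n))
    (n : nat) (D : set (F n))
    (D_csn : closed_sigma_normal D)
    (D_frattini : D `<=` frattini (F n))
    (D_Aut : forall alpha, sigma_Aut (F n) alpha -> alpha @` D = D)
    (G : sigmaProPType p) (G_schur : weak_schur F G) (dG : dimH1 G n)
    (GD_finite : finite_set [set: quo_by D G])
    (m : nat) (mP : is_mDG D G m) :
  [/\ open (U_DG D G), closed (U_DG D G) &
      mu_infty nu (U_DG D G) =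
      (C_infty R p / C_part R p (n - m) *
       (ncard (sigma_Aut (quo_by D G)))%:R^-1)%:E].
Proof.
have mn := mDG_le p_prime p_gt2 D_csn D_frattini D_Aut G_schur dG mP.
split.
- exact: (U_DG_open p_prime p_gt2 D_csn D_frattini D_Aut G_schur dG GD_finite mP).
- exact: (U_DG_closed p_prime p_gt2 D_csn D_frattini D_Aut G_schur dG GD_finite mP).
have [phi0 [chi [ephi0 DM MH1 rchi chis]]] :=
  quotient_coordinates p_prime p_gt2 D_csn D_frattini D_Aut G_schur dG mP.
have [pi epi] := weak_schur_epi p_prime G_schur dG.
have dQ := dimH1_quo_epi_image p_prime p_gt2 D_csn D_frattini D_Aut dG epi.
pose a : R := (ncard (sigma_Aut (quo_by D G)))%:R^-1.
(* The exact value for all k = n + l; the finitely many k < n do not affect the limit. *)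
have muE l : mu_n nu (n + l)%N (U_DG D G) =
    (C_part R p (n + l) / C_part R p l *
     (C_part R p (n + l) / C_part R p (n - m)) * a)%:E.
  have [rho erho] := exists_epi_le p_prime (F (n + l)) ephi0.
  rewrite -(isomorphic_event_probability p_prime p_gt2 D_csn D_Aut ephi0 dQ GD_finite
    DM MH1 rchi chis (haarP (n + l)%N) (nuP (n + l)%N) erho mn).
  rewrite /mu_n; congr (nu _ _); apply/seteqP; split=> r.
    by move=> /(U_DGP p_prime p_gt2 D_csn D_Aut).
  by move=> h; apply/(U_DGP p_prime p_gt2 D_csn D_Aut).
apply: cvg_lim => //; rewrite -(cvg_shiftn n).
under eq_fun do rewrite addnC muE.
apply: cvg_EFin; first by apply: nearW.
apply: cvgM; last exact: cvg_cst.
rewrite -[X in _ --> X]mul1r; apply: cvgM; first exact: cvg_C_part_ratio.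
apply: cvgM; last exact: cvg_cst.
have := @cvg_C_part R p p_prime; rewrite -(cvg_shiftn n).
by under eq_fun do rewrite addnC.
Qed.
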